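(* Let $\mathcal{H}$ be a complex separable Hilbert space, let $n\ge 1$ and let $r>0$. If $\varphi\in\mathcal{D}^{\mathcal{H}}_r$, then its Fourier transform $\mathcal{F}(\varphi)$ extends from $\mathbb{R}^n$ to a weakly holomorphic function on $\mathbb{C}^n$, denoted $\mathcal{F}^c(\varphi)$, and $\mathcal{F}^c(\varphi)\in\mathcal{PW}^{\mathcal{H}}_{2\pi r}$. Furthermore, $\mathcal{F}^c$ is a linear topological isomorphism of $\mathcal{D}^{\mathcal{H}}_r$ onto $\mathcal{PW}^{\mathcal{H}}_{2\pi r}$. The inverse of $\mathcal{F}^c$ is given by the conjugate weak Fourier transform on $\mathbb{R}^n$, that is, by $F\mapsto \varphi$ with $\varphi(y)=\int_{\mathbb{R}^n}F(x)e^{2\pi i x\cdot y}\,dx$ (weak integral).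
   Context: $(\cdot,\cdot)$ is the inner product of $\mathcal{H}$ (linear in the first variable). $\mathcal{D}_r(\mathbb{R}^n)$ is the space of smooth functions $\mathbb{R}^n\to\mathbb{C}$ supported in the closed ball of radius $r$ centered at the origin. $\mathcal{D}^{\mathcal{H}}_r=\mathcal{D}^{\mathcal{H}}_r(\mathbb{R}^n,\mathcal{H})$ is the space of functions $\varphi:\mathbb{R}^n\to\mathcal{H}$ such that for every $u\in\mathcal{H}$ the function $x\mapsto(\varphi(x),u)$ belongs to $\mathcal{D}_r(\mathbb{R}^n)$, with the topology given by the seminorms $\nu_{N,u}(\varphi)=\max_{|\alpha|\le N}\sup_{x\in\mathbb{R}^n}|D^\alpha(\varphi(x),u)|$, $N\in\mathbb{N}$, $u\in\mathcal{H}$. A function $F:\mathbb{C}^n\to\mathcal{H}$ is weakly holomorphic if $z\mapsto(F(z),u)$ is holomorphic on $\mathbb{C}^n$ for every $u\in\mathcal{H}$. For $s>0$, $\mathcal{PW}^{\mathcal{H}}_s=\mathcal{PW}^{\mathcal{H}}_s(\mathbb{C}^n,\mathcal{H})$ is the space of weakly holomorphic functions $F:\mathbb{C}^n\to\mathcal{H}$ such that for every $u\in\mathcal{H}$ and $N\in\mathbb{N}$ $$\rho_{N,u}(F)=\sup_{z\in\mathbb{C}^n}(1+|z|^2)^N e^{-s|\mathrm{Im}(z)|}\,|(F(z),u)|<\infty,$$ with the topology given by the seminorms $\rho_{N,u}$. Here $|z|=(|z_1|^2+\cdots+|z_n|^2)^{1/2}$. For $\varphi\in\mathcal{D}^{\mathcal{H}}_r$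 the Fourier transform is the weak integral $\mathcal{F}(\varphi)(y)=\int_{\mathbb{R}^n}\varphi(x)e^{-2\pi i x\cdot y}\,dx$, i.e. the vector of $\mathcal{H}$ satisfying $(\mathcal{F}(\varphi)(y),u)=\int_{\mathbb{R}^n}(\varphi(x),u)e^{-2\pi i x\cdot y}\,dx$ for all $u\in\mathcal{H}$. *)

(* Defs.v *)
From HB Require Import structures.
From mathcomp Require Import all_boot all_order all_algebra.
From mathcomp Require Import complex.
From mathcomp Require Import all_classical all_reals all_analysis.
Set Implicit Arguments.
Unset Strict Implicit.
Unset Printing Implicit Defensive.
Import Order.TTheory GRing.Theory Num.Theory.
Import numFieldNormedType.Exports.
Local Open Scope classical_set_scope.
Local Open Scope ring_scope.
Local Open Scope complex_scope.

Section lebesgue_tuple.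
Context {R : realType}.
Local Notation T := (measurableTypeR R).

Definition tuple_of_pair n (p : T * n.-tuple T) : n.+1.-tuple T :=
  [tuple of p.1 :: p.2].

Definition pair_of_tuple n (t : n.+1.-tuple T) : T * n.-tuple T :=
  (thead t, [tuple of behead t]).

Lemma measurable_tuple_of_pair n : measurable_fun setT (@tuple_of_pair n).
Proof. exact: measurable_cons. Qed.

Lemma measurable_pair_of_tuple n : measurable_fun setT (@pair_of_tuple n).
Proof.
apply/measurable_fun_pair; [exact: measurable_tnth|exact: measurable_behead].
Qed.

Lemma pair_of_tupleK n : cancel (@pair_of_tuple n) (@tuple_of_pair n).
Proof. by move=> t; rewrite [RHS]tuple_eta. Qed.

Lemma tuple_of_pairK n : cancel (@tuple_of_pair n) (@pair_of_tuple n).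
Proof. by case=> x t; congr pair; exact/val_inj. Qed.

Section tuple_prod_measure.
Variables (n : nat) (m1 : {sigma_finite_measure set T -> \bar R})
  (m2 : {sigma_finite_measure set (n.-tuple T) -> \bar R}).

Definition tuple_prod_measure : set (n.+1.-tuple T) -> \bar R :=
  pushforward (m1 \x m2)%E (@tuple_of_pair n).

Let mcons := @measurable_tuple_of_pair n.

Let tuple_prod_measure0 : tuple_prod_measure set0 = 0%E.
Proof. exact: measure0. Qed.

Let tuple_prod_measure_ge0 A : (0 <= tuple_prod_measure A)%E.
Proof. exact: measure_ge0. Qed.

Let tuple_prod_measure_sigma_additive :
  semi_sigma_additive tuple_prod_measure.
Proof. exact: measure_semi_sigma_additive. Qed.

HB.instance Definition _ := isMeasure.Build _ _ _ tuple_prod_measure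
  tuple_prod_measure0 tuple_prod_measure_ge0 tuple_prod_measure_sigma_additive.

Lemma tuple_prod_measure_sigma_finite : sigma_finite setT tuple_prod_measure.
Proof.
have /sigma_finiteP[F [TF ndF Foo]] := sigma_finiteT m1.
have /sigma_finiteP[G [TG ndG Goo]] := sigma_finiteT m2.
exists (fun k => @pair_of_tuple n @^-1` (F k `*` G k)).
  rewrite -preimage_bigcup (_ : \bigcup_k _ = setT) ?preimage_setT//.
  rewrite -setXTT TF TG predeqE => -[x y]; split => [[k _ []/= ? ?]|].
    by split; exists k.
  move=> [/= [k _ Fkx] [l _ Gly]]; exists (maxn k l) => //; split.
  - by move: x Fkx; exact/subsetPset/ndF/leq_maxl.
  - by move: y Gly; exact/subsetPset/ndG/leq_maxr.
move=> k; have [? ?] := Foo k; have [? ?] := Goo k; split.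
  rewrite -[X in measurable X]setTI; apply: measurable_pair_of_tuple => //.
  exact: measurableX.
rewrite /tuple_prod_measure /pushforward -comp_preimage.
rewrite (_ : _ \o _ = id); last first.
  by apply/funext => p; exact: tuple_of_pairK.
by rewrite preimage_id product_measure1E// lte_mul_pinfty// ge0_fin_numE.
Qed.

HB.instance Definition _ :=
  Measure_isSigmaFinite.Build _ _ _ tuple_prod_measure
    tuple_prod_measure_sigma_finite.

End tuple_prod_measure.

(* Lebesgue measure on R^n as the n-fold product of the one on R. *)
Fixpoint lebesgue_tuple n : {sigma_finite_measure set (n.-tuple T) -> \bar R} :=
  match n with
  | 0 => \d_([tuple] : 0.-tuple T)
  | n.+1 => tuple_prod_measure (@lebesgue_measure R) (lebesgue_tuple n)
  end.

End lebesgue_tuple.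

Section modulus.
Context {R : realType}.
Implicit Types z w : R[i].

(* The library's `|z| has values in R[i]. *)
Definition cabs z : R := ComplexField.Normc.normc z.

Lemma cabs0 : cabs 0 = 0.
Proof. exact: ComplexField.Normc.normc0. Qed.

Lemma cabs_ge0 z : 0 <= cabs z.
Proof. by case: z => x y; rewrite /cabs /ComplexField.Normc.normc sqrtr_ge0. Qed.

Lemma cabsM z w : cabs (z * w) = cabs z * cabs w.
Proof. exact: ComplexField.Normc.normcM. Qed.

Lemma le_cabsD z w : cabs (z + w) <= cabs z + cabs w.
Proof. exact: le_normcD. Qed.

End modulus.

Section scalar_functions.
Context {R : realType} {n : nat}.
Local Notation T := (measurableTypeR R).
Implicit Types (f : 'rV[R]_n -> R) (g : 'rV[R]_n -> R[i]).

Definition dotr (x y : 'rV[R]_n) : R := \sum_i x 0 i * y 0 i.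

(* Euclidean norms; `|x| is the sup norm on row vectors. *)
Definition enorm (x : 'rV[R]_n) : R := Num.sqrt (dotr x x).

Definition cenorm (z : 'rV[R[i]]_n) : R :=
  Num.sqrt (\sum_i cabs (z 0 i) ^+ 2).

Definition ImC (z : 'rV[R[i]]_n) : 'rV[R]_n := map_mx (@complex.Im R) z.

Definition ofR (x : 'rV[R]_n) : 'rV[R[i]]_n := map_mx (real_complex R) x.

Definition row_of_tuple (t : n.-tuple T) : 'rV[R]_n := \row_i tnth t i.

Definition cintegrable g : Prop :=
  (lebesgue_tuple n).-integrable setT
    (fun t => (complex.Re (g (row_of_tuple t)))%:E) /\
  (lebesgue_tuple n).-integrable setT
    (fun t => (complex.Im (g (row_of_tuple t)))%:E).

Definition cintegral g : R[i] :=
  (\int[lebesgue_tuple n]_t complex.Re (g (row_of_tuple t))) +i*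
  (\int[lebesgue_tuple n]_t complex.Im (g (row_of_tuple t))).

Definition dpartial (s : seq 'I_n) f : 'rV[R]_n -> R :=
  foldr (fun i h => 'D_(delta_mx 0 i) h) f s.

(* smooth = partial derivatives of all orders, in any order of the variables,
   exist and are continuous *)
Definition smooth f : Prop := forall s,
  continuous (dpartial s f) /\
  forall i x, derivable (dpartial s f) x (delta_mx 0 i).

Definition csmooth g : Prop :=
  smooth (fun x => complex.Re (g x)) /\ smooth (fun x => complex.Im (g x)).

Definition cdpartial (s : seq 'I_n) g (x : 'rV[R]_n) : R[i] :=
  dpartial s (fun x => complex.Re (g x)) x +i*
  dpartial s (fun x => complex.Im (g x)) x.

(* the word 0 ... 0 1 ... 1 ... with each index i repeated a i times *)
Definition seq_of_multiindex (a : 'I_n -> nat) : seq 'I_n :=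
  flatten [seq nseq (a i) i | i <- enum 'I_n].

Definition cD (a : 'I_n -> nat) := cdpartial (seq_of_multiindex a).

Definition in_Dr (r : R) g : Prop :=
  csmooth g /\ closure [set x | g x != 0] `<=` [set x | enorm x <= r].

Definition holomorphic (F : 'rV[R[i]]_n -> R[i]^o) : Prop :=
  forall z, differentiable F z.

(* e^{it} *)
Definition cis (t : R) : R[i] := cos t +i* sin t.

Lemma dpartial_linear s (a : R) f h : smooth f -> smooth h ->
  dpartial s (a *: f + h) = a *: dpartial s f + dpartial s h.
Proof.
move=> sf sh; elim: s => //= i s IHs; rewrite IHs; apply/funext => x.
have df := (sf s).2 i x; have dh := (sh s).2 i x.
by rewrite deriveD//; [rewrite deriveZ|exact: derivableZ].
Qed.

Lemma smooth_linear (a : R) f h : smooth f -> smooth h -> smooth (a *: f + h).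
Proof.
move=> sf sh s; rewrite dpartial_linear//.
have [cf df] := sf s; have [ch dh] := sh s; split.
  by move=> x; apply: continuousD; [exact: continuousZl_tmp (cf x)|exact: ch].
by move=> i x; apply: derivableD => //; exact: derivableZ.
Qed.

Lemma smooth0 : smooth (0 : 'rV[R]_n -> R).
Proof.
move=> s; have -> : dpartial s 0 = cst 0.
  elim: s => //= i s ->; apply/funext => x.
  by rewrite derive_cst.
by split=> [|i x]; [exact: cst_continuous|exact: derivable_cst].
Qed.

Lemma csmooth_linear (a : R[i]) g h : csmooth g -> csmooth h ->
  csmooth (fun x => a * g x + h x).
Proof.
move=> [rg ig] [rh ih]; split.
- rewrite (_ : (fun _ => _) = complex.Re a *: (fun x => complex.Re (g x)) +
    ((- complex.Im a) *: (fun x => complex.Im (g x)) +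
     (fun x => complex.Re (h x)))).
    by do 2 apply: smooth_linear => //.
  apply/funext => x; rewrite !fctE /=.
  case: a (g x) (h x) => [a1 a2] [g1 g2] [h1 h2] /=.
  by rewrite /GRing.scale/= mulNr addrA.
- rewrite (_ : (fun _ => _) = complex.Re a *: (fun x => complex.Im (g x)) +
    (complex.Im a *: (fun x => complex.Re (g x)) +
     (fun x => complex.Im (h x)))).
    by do 2 apply: smooth_linear => //.
  apply/funext => x; rewrite !fctE /=.
  case: a (g x) (h x) => [a1 a2] [g1 g2] [h1 h2] /=.
  by rewrite /GRing.scale/= addrA.
Qed.

Lemma in_Dr_linear r (a : R[i]) g h : in_Dr r g -> in_Dr r h ->
  in_Dr r (fun x => a * g x + h x).
Proof.
move=> [sg cg] [sh ch]; split; first exact: csmooth_linear.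
apply: (@subset_trans _ (closure ([set x | g x != 0] `|` [set x | h x != 0]))).
  apply: closure_subset => x /=; have [->|] := eqVneq (g x) 0; last by left.
  by rewrite mulr0 add0r => ?; right.
by rewrite closureU => x [/cg|/ch].
Qed.

Lemma in_Dr0 r : in_Dr r 0.
Proof.
split; first by split; exact: smooth0.
rewrite (_ : [set _ | _] = set0) ?closure0//.
by rewrite -subset0 => x /=; rewrite eqxx.
Qed.

End scalar_functions.

Section spaces.
Context {R : realType} {H : completeNormedModType R[i]}.
Variables (ip : {dot H for Num.conj}) (n : nat).

(* Existence of the scalar integrals is part of the definition, since
   [cintegral] is total. *)
Definition is_weak_integral (f : 'rV[R]_n -> H) (v : H) : Prop :=
  forall u, cintegrable (fun x => ip (f x) u) /\
            ip v u = cintegral (fun x => ip (f x) u).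

Definition is_fourier (phi : 'rV[R]_n -> H) (y : 'rV[R]_n) (v : H) : Prop :=
  is_weak_integral (fun x => cis (- (2 * pi * dotr x y)) *: phi x) v.

Definition is_conj_fourier (f : 'rV[R]_n -> H) (y : 'rV[R]_n) (v : H) : Prop :=
  is_weak_integral (fun x => cis (2 * pi * dotr x y) *: f x) v.

Definition nu (N : nat) (u : H) (phi : 'rV[R]_n -> H) : \bar R :=
  (\big[maxe/0]_(a : {ffun 'I_n -> 'I_N.+1} | (\sum_i (a i : nat) <= N)%N)
    ereal_sup (range (fun x =>
      (cabs (cD (fun i => a i : nat) (fun x => ip (phi x) u) x))%:E)))%E.

Definition DH (r : R) : {pred 'rV[R]_n -> H} :=
  mem [set phi : 'rV[R]_n -> H | forall u, in_Dr r (fun x => ip (phi x) u)].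

Definition weakly_holomorphic (F : 'rV[R[i]]_n -> H) : Prop :=
  forall u, holomorphic (fun z => ip (F z) u).

Definition rho (s : R) (N : nat) (u : H) (F : 'rV[R[i]]_n -> H) : \bar R :=
  ereal_sup (range (fun z =>
    ((1 + cenorm z ^+ 2) ^+ N * expR (- (s * enorm (ImC z))) *
     cabs (ip (F z) u))%:E)).

Definition PWH (s : R) : {pred 'rV[R[i]]_n -> H} :=
  mem [set F : 'rV[R[i]]_n -> H |
    weakly_holomorphic F /\ forall u N, (rho s N u F < +oo)%E].

Lemma DH_submod_closed r : submod_closed (DH r).
Proof.
split.
  rewrite inE /= => u; rewrite (_ : (fun _ => _) = 0); first exact: in_Dr0.
  by apply/funext => x; rewrite linear0l.
move=> a f g; rewrite !inE /= => fD gD u.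
rewrite (_ : (fun _ => _) = fun x => a * ip (f x) u + ip (g x) u).
  exact: in_Dr_linear.
by apply/funext => x; rewrite linearPl.
Qed.

HB.instance Definition _ r :=
  GRing.isSubmodClosed.Build _ _ (DH r) (DH_submod_closed r).

Lemma rho_bounded s N u F : (rho s N u F < +oo)%E <->
  exists M, forall z, (1 + cenorm z ^+ 2) ^+ N *
    expR (- (s * enorm (ImC z))) * cabs (ip (F z) u) <= M.
Proof.
split=> [|[M FM]]; last first.
  apply: (@le_lt_trans _ _ M%:E); last exact: ltry.
  by apply: ge_ereal_sup => _ [z _ <-]; rewrite lee_fin.
case E : (rho s N u F) => [M| |] // _.
  exists M => z; rewrite -lee_fin -E; apply: ereal_sup_ubound.
  by exists z.
suff : (((1 + cenorm (0 : 'rV[R[i]]_n) ^+ 2) ^+ N *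
    expR (- (s * enorm (ImC (0 : 'rV[R[i]]_n)))) *
    cabs (ip (F 0%R) u))%:E <= rho s N u F)%E.
  by rewrite E.
by apply: ereal_sup_ubound; exists 0.
Qed.

Lemma PWH_submod_closed s : submod_closed (PWH s).
Proof.
split.
  rewrite inE /=; split=> [u z|u N].
    rewrite (_ : (fun _ => _) = cst 0); first exact: differentiable_cst.
    by apply/funext => x; rewrite linear0l.
  apply/rho_bounded; exists 0 => z.
  by rewrite linear0l cabs0 mulr0.
move=> a F G; rewrite !inE /= => -[hF bF] [hG bG]; split=> [u z|u N].
  rewrite (_ : (fun _ => _) =
      a *: (fun z => ip (F z) u : R[i]^o) + (fun z => ip (G z) u : R[i]^o)).
    by apply: differentiableD; [apply: differentiableZ; exact: hF|exact: hG].
  by apply/funext => x; rewrite linearPl.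
have /rho_bounded[M FM] := bF u N; have /rho_bounded[M' GM'] := bG u N.
apply/rho_bounded; exists (cabs a * M + M') => z.
rewrite linearPl; set w := _ * expR _.
have w0 : 0 <= w by rewrite mulr_ge0 ?expR_ge0// exprn_ge0// addr_ge0 ?sqr_ge0.
apply: (@le_trans _ _ (w * (cabs (a * ip (F z) u) +
  cabs (ip (G z) u)))).
  by rewrite ler_wpM2l// le_cabsD.
rewrite cabsM mulrDr mulrCA; apply: lerD; last exact: GM'.
by rewrite ler_wpM2l ?cabs_ge0//; exact: FM.
Qed.

HB.instance Definition _ s :=
  GRing.isSubmodClosed.Build _ _ (PWH s) (PWH_submod_closed s).

Record DHspace (r : R) := DHSpace {
  DHval :> 'rV[R]_n -> H ; DHvalP : DHval \in DH r }.

HB.instance Definition _ r := [isSub for @DHval r].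
HB.instance Definition _ r := [Choice of DHspace r by <:].
HB.instance Definition _ r := [SubChoice_isSubLmodule of DHspace r by <:].
HB.instance Definition _ r := isPointed.Build (DHspace r) 0.

Record PWHspace (s : R) := PWHSpace {
  PWHval :> 'rV[R[i]]_n -> H ; PWHvalP : PWHval \in PWH s }.

HB.instance Definition _ s := [isSub for @PWHval s].
HB.instance Definition _ s := [Choice of PWHspace s by <:].
HB.instance Definition _ s := [SubChoice_isSubLmodule of PWHspace s by <:].
HB.instance Definition _ s := isPointed.Build (PWHspace s) 0.

(* The seminorm topologies are generated by the open semiballs. *)
Definition nu_ball r (i : nat * H * DHspace r * R) : set (DHspace r) :=
  let: (N, u, phi, e) := i in [set psi | (nu N u (psi - phi)%R < e%:E)%E].

HB.instance Definition _ r := isSubBaseTopological.Build (DHspace r)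
  [set i : nat * H * DHspace r * R | 0 < i.2] (@nu_ball r).

Definition rho_ball s (i : nat * H * PWHspace s * R) : set (PWHspace s) :=
  let: (N, u, F, e) := i in [set G | (rho s N u (G - F)%R < e%:E)%E].

HB.instance Definition _ s := isSubBaseTopological.Build (PWHspace s)
  [set i : nat * H * PWHspace s * R | 0 < i.2] (@rho_ball s).

End spaces.

(* Main.v *)
(* Proof idea.  Uniform boundedness makes [phi] norm bounded, so for each [z]
   the scalar transform [u |-> \int (phi(x), u) e^{-2 pi i x.z} dx] is a bounded
   conjugate-linear functional and Riesz' theorem represents it by a vector;
   the same works for the inverse transform, and both inversion formulas,
   support, decay and seminorm bounds reduce to scalar functions by pairing with
   [u].

   Scalar part: differentiability under the integral sign comes from a quadratic
   bound on the increment of the kernel, and the decay of the transform from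
   integration by parts in the pure derivatives of order at most 2N.  For [f]
   in the scalar Paley-Wiener space, Goursat's theorem in each variable shifts
   the contour of the inverse transform to [R^n + i t y]; letting [t] tend to
   infinity gives the support condition at [y].  Fourier inversion on [R^n],
   proved with Gaussian regularization, is applied not only to [f] on [R^n] but
   to each translate [x |-> f(x + i eta)]; this identifies the transform of the
   inverse transform with [f] on all of [C^n] without the identity theorem. *)
Require Import Defs.
From HB Require Import structures.
From mathcomp Require Import all_boot all_order all_algebra.
From mathcomp Require Import complex ring lra zify.
From mathcomp Require Import all_classical all_reals all_analysis.
From mathcomp Require Import measurable_realfun.
Set Implicit Arguments.
Unset Strict Implicit.
Unset Printing Implicit Defensive.
Import Order.TTheory GRing.Theory Num.Theory.
Import numFieldNormedType.Exports.
Local Open Scope classical_set_scope.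
Local Open Scope ring_scope.
Local Open Scope complex_scope.

(** Absolute convergence is controlled everywhere by one fixed function, [weight], the product of
    the factors 1 / (1 + x_i^2). It factors over the coordinates, so that Fubini and arguments in
    one variable apply coordinate by coordinate. A bound by a multiple of [weight] comes either from
    compact support or from [n] powers of 1 + |x|^2; this is the origin of (1 + r^2)^n in the direct
    estimates and of the shift N + n in the inverse ones.

    Inversion of the translates works because shifting the contour only multiplies the inverse
    transform g by exp(2 pi eta.y): since g has compact support, the product stays integrable
    although the exponential is unbounded. Conjugation exchanges direct and inverse transforms, so a
    single inversion theorem serves both compositions.

    Continuity is tested with the same vector u on both sides: rho_{N,u} is bounded by a multiple of
    nu_{2N,u}, and nu_{N,u} by a multiple of rho_{N+n,u}. The norm bounds obtained from uniform
    boundedness serve the existence of the representing vectors. *)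

Section modulus.
Context {R : realType}.
Implicit Types (z w : R[i]) (x y a b : R).

Lemma cabsE z : cabs z = Num.sqrt (complex.Re z ^+ 2 + complex.Im z ^+ 2).
Proof. by case: z. Qed.

Lemma normcE z : `|z| = (cabs z)%:C.
Proof. by rewrite normc_def cabsE. Qed.

Lemma sqr_cabs z : cabs z ^+ 2 = complex.Re z ^+ 2 + complex.Im z ^+ 2.
Proof. by rewrite cabsE sqr_sqrtr// addr_ge0// sqr_ge0. Qed.

Lemma cabs_eq0 z : (cabs z == 0) = (z == 0).
Proof. by apply/eqP/eqP => [/ComplexField.Normc.eq0_normc//|->]; rewrite cabs0. Qed.

Lemma cabsN z : cabs (- z) = cabs z.
Proof. by rewrite !cabsE !raddfN /= !sqrrN. Qed.

Lemma cabsJ z : cabs (z^*) = cabs z.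
Proof. by rewrite !cabsE; case: z => a b /=; rewrite sqrrN. Qed.

Lemma cabs_real x : cabs x%:C = `|x|.
Proof. by rewrite cabsE /= expr0n addr0 sqrtr_sqr. Qed.

Lemma cabs1 : cabs (1 : R[i]) = 1.
Proof. by rewrite (cabs_real 1) normr1. Qed.

Lemma cabsX z n : cabs (z ^+ n) = cabs z ^+ n.
Proof. by elim: n => [|n IH]; rewrite ?cabs1// !exprS cabsM IH. Qed.

Lemma le_cabs_sum (I : Type) (s : seq I) (P : pred I) (F : I -> R[i]) :
  cabs (\sum_(i <- s | P i) F i) <= \sum_(i <- s | P i) cabs (F i).
Proof.
elim/big_ind2 : _ => // [|a x b y ax bY]; first by rewrite cabs0.
by rewrite (le_trans (le_cabsD _ _))// lerD.
Qed.

Lemma Re_le_cabs z : `|complex.Re z| <= cabs z.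
Proof.
by rewrite cabsE -[leLHS]sqrtr_sqr ler_wsqrtr// lerDl sqr_ge0.
Qed.

Lemma Im_le_cabs z : `|complex.Im z| <= cabs z.
Proof.
by rewrite cabsE -[leLHS]sqrtr_sqr ler_wsqrtr// lerDr sqr_ge0.
Qed.

Lemma cabs_le_ReIm z : cabs z <= `|complex.Re z| + `|complex.Im z|.
Proof.
have -> : z = (complex.Re z)%:C + 'i%C * (complex.Im z)%:C by exact: complexE.
apply: le_trans (le_cabsD _ _) _; rewrite cabsM !cabs_real.
rewrite -!complexE (_ : cabs 'i%C = 1) ?mul1r//.
by rewrite cabsE /= expr0n expr1n add0r sqrtr1.
Qed.

Lemma ReD z w : complex.Re (z + w) = complex.Re z + complex.Re w.
Proof. by rewrite raddfD. Qed.
Lemma ImD z w : complex.Im (z + w) = complex.Im z + complex.Im w.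
Proof. by rewrite raddfD. Qed.
Lemma ReN z : complex.Re (- z) = - complex.Re z.
Proof. by rewrite raddfN. Qed.
Lemma ImN z : complex.Im (- z) = - complex.Im z.
Proof. by rewrite raddfN. Qed.
Lemma ReM z w : complex.Re (z * w) =
  complex.Re z * complex.Re w - complex.Im z * complex.Im w.
Proof. by case: z w => [a b] [c d]. Qed.
Lemma ImM z w : complex.Im (z * w) =
  complex.Re z * complex.Im w + complex.Im z * complex.Re w.
Proof. by case: z w => [a b] [c d]. Qed.

Lemma complexP z w : complex.Re z = complex.Re w ->
  complex.Im z = complex.Im w -> z = w.
Proof. by case: z w => [a b] [c d] /= -> ->. Qed.

End modulus.

(** * The complex exponential and its second-order remainder *)

Section cexp.
Context {R : realType}.
Implicit Types (z w : R[i]) (x y a b : R).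

Definition cexp z : R[i] := (expR (complex.Re z))%:C * cis (complex.Im z).

Lemma cis0 : cis 0 = 1 :> R[i].
Proof. by rewrite /cis cos0 sin0. Qed.

Lemma cisD x y : cis (x + y) = cis x * cis y.
Proof. by apply: complexP; rewrite ?ReM ?ImM /= ?cosD ?sinD //; ring. Qed.

Lemma cexpD z w : cexp (z + w) = cexp z * cexp w.
Proof.
rewrite /cexp ReD ImD expRD cisD rmorphM /=; ring.
Qed.

Lemma cabs_cis x : cabs (cis x) = 1.
Proof. by rewrite cabsE /= cos2Dsin2 sqrtr1. Qed.

Lemma cabs_cexp z : cabs (cexp z) = expR (complex.Re z).
Proof. by rewrite cabsM cabs_cis mulr1 cabs_real ger0_norm ?expR_ge0. Qed.

Lemma norm_sin_le x : `|sin x| <= `|x|.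
Proof.
wlog x0 : x / 0 <= x.
  move=> h; have [/h//|x0] := leP 0 x.
  by rewrite -normrN -sinN -[leRHS]normrN h// oppr_ge0 ltW.
rewrite (ger0_norm x0).
have [->|xn0] := eqVneq x 0; first by rewrite sin0 normr0.
have {}x0 : 0 < x by rewrite lt0r xn0.
have [c _ E] := @MVT_segment R sin cos 0 x (ltW x0) (fun t _ => is_derive_sin t)
  (continuous_subspaceT (@continuous_sin R)).
move: E; rewrite sin0 !subr0 => ->.
by rewrite normrM (gtr0_norm x0) ler_piMl ?cos_max// ltW.
Qed.

Lemma norm_cosB1_le x : `|cos x - 1| <= x ^+ 2.
Proof.
have -> : cos x - 1 = - (2 * sin (x / 2) ^+ 2).
  rewrite {1}[x](_ : _ = x / 2 + x / 2); last by field.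
  rewrite cosD; have := cos2Dsin2 (x / 2); nra.
rewrite normrN ger0_norm; last by rewrite mulr_ge0// sqr_ge0.
have : sin (x / 2) ^+ 2 <= (x / 2) ^+ 2.
  rewrite -(@real_normK _ (sin _)) ?num_real// -(@real_normK _ (x / 2)) ?num_real//.
  by rewrite lerXn2r ?nnegrE// norm_sin_le.
have := sqr_ge0 x; rewrite exprMn; set s := sin _; lra.
Qed.

Lemma norm_sinB_le x : `|sin x - x| <= 2 * x ^+ 2.
Proof.
wlog x0 : x / 0 <= x.
  move=> h; have [/h//|x0] := leP 0 x.
  have := h (- x); rewrite sinN -opprD normrN sqrrN; apply.
  by rewrite oppr_ge0 ltW.
(* Beyond 1 the trivial bound 2x is already below 2x^2; up to 1 the mean value theorem leaves (cos c
   - 1) x with c <= x, and the bound c^2 is enough. *)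
have [x1|x1] := leP x 1; last first.
  rewrite (le_trans (ler_normB _ _))// (le_trans (lerD (norm_sin_le x) (lexx _)))//.
  by rewrite (ger0_norm x0); nra.
have [->|xn0] := eqVneq x 0; first by rewrite sin0 subrr normr0 mulr_ge0// sqr_ge0.
have {}x0 : 0 < x by rewrite lt0r xn0.
have [c cx E] := @MVT_segment R sin cos 0 x (ltW x0) (fun t _ => is_derive_sin t)
  (continuous_subspaceT (@continuous_sin R)).
move: E; rewrite sin0 !subr0 => ->.
rewrite -{2}[x]mul1r -mulrBl normrM (gtr0_norm x0).
have := norm_cosB1_le c.
move: cx; rewrite in_itv /= => /andP[c0 cx].
have -> : 2 * x ^+ 2 = 2 * x * x by ring.
move=> h; apply: ler_wpM2r; first exact: ltW.
rewrite (le_trans h)//.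
have : c * c <= x * 1 by rewrite ler_pM// (le_trans cx).
by rewrite expr2; lra.
Qed.

Lemma norm_cosB1_le1 x : `|cos x - 1| <= `|x|.
Proof.
wlog x0 : x / 0 <= x.
  move=> h; have [/h//|x0] := leP 0 x.
  by rewrite -cosN -[leRHS]normrN h// oppr_ge0 ltW.
have [c _ E] := @MVT_segment R cos (fun t => - sin t) 0 x x0 (fun t _ => is_derive_cos t)
  (continuous_subspaceT (@continuous_cos R)).
move: E; rewrite cos0 subr0 => ->.
by rewrite normrM normrN ler_piMl// sin_max.
Qed.

Lemma cabs_cisB1_le x : cabs (cis x - 1) <= 2 * `|x|.
Proof.
rewrite (le_trans (cabs_le_ReIm _))//= oppr0 addr0 mulr_natl mulr2n.
by rewrite lerD ?norm_cosB1_le1 ?norm_sin_le.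
Qed.

Lemma cabs_cisB1B_le x : cabs (cis x - 1 - 'i * x%:C) <= 3 * x ^+ 2.
Proof.
have -> : cis x - 1 - 'i * x%:C = (cos x - 1) +i* (sin x - x).
  by apply: complexP => /=; ring.
rewrite (le_trans (cabs_le_ReIm _))//=.
by have := norm_cosB1_le x; have := norm_sinB_le x; lra.
Qed.

(** The mean value theorem in a form independent of the sign of [x], so that it can be iterated:
    applied to [x] and then to [c], it gives the second-order bound below. *)
Lemma expRB1 x : exists2 c, expR x - 1 = expR c * x & `|c| <= `|x|.
Proof.
have [x0|x0] := leP 0 x.
  have [c cx E] := @MVT_segment R expR expR 0 x x0 (fun t _ => is_derive_expR t)
    (continuous_subspaceT (@continuous_expR R)).
  exists c; first by rewrite -expR0 E subr0.
  move: cx; rewrite in_itv /= => /andP[c0 cx].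
  by rewrite !ger0_norm.
have [c cx E] := @MVT_segment R expR expR x 0 (ltW x0) (fun t _ => is_derive_expR t)
    (continuous_subspaceT (@continuous_expR R)).
exists c; first by rewrite -[LHS]opprB -expR0 E sub0r mulrN opprK.
move: cx; rewrite in_itv /= => /andP[c0 cx].
by rewrite !ler0_norm ?lerN2// ltW.
Qed.

Lemma expRB1B_le x : `|expR x - 1 - x| <= x ^+ 2 * expR `|x|.
Proof.
have [c Ec cx] := expRB1 x; have [d Ed dc] := expRB1 c.
rewrite Ec -{2}[x]mul1r -mulrBl Ed.
rewrite -mulrA normrM (ger0_norm (expR_ge0 _)) mulrC ler_pM ?expR_ge0//.
  by rewrite normrM -[leRHS]real_normK ?num_real// expr2 ler_wpM2r.
by rewrite ler_expR (le_trans (ler_norm _))// (le_trans dc).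
Qed.

(** Source of every quadratic increment bound on the kernel, in its complex argument as well as in
    the real variable. Only the real part of [w] is exponentiated, because [cis] has modulus 1. *)
Lemma cabs_cexpB1B_le w :
  cabs (cexp w - 1 - w) <= 4 * cabs w ^+ 2 * expR `|complex.Re w|.
Proof.
set a := complex.Re w; set b := complex.Im w.
(* The remainder splits into the real one rotated by [cis b], a mixed term, and the remainder of
   [cis]; each is of second order in (a, b). *)
have -> : cexp w - 1 - w = (expR a - 1 - a)%:C * cis b +
    (a%:C * (cis b - 1) + (cis b - 1 - 'i * b%:C)).
  have Ew : w = a%:C + 'i * b%:C by exact: complexE.
  have Ec : cexp w = (expR a)%:C * cis b by [].
  by rewrite Ec {1}Ew !rmorphB /= rmorph1; ring.
have e1 : 1 <= expR `|a| by rewrite -expR0 ler_expR.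
apply: (@le_trans _ _ (a ^+ 2 * expR `|a| + (`|a| * (2 * `|b|) + 3 * b ^+ 2))).
  apply: le_trans (le_cabsD _ _) _; apply: lerD.
    by rewrite cabsM cabs_cis mulr1 cabs_real expRB1B_le.
  apply: le_trans (le_cabsD _ _) _; apply: lerD; last exact: cabs_cisB1B_le.
  by rewrite cabsM cabs_real ler_wpM2l// cabs_cisB1_le.
rewrite sqr_cabs -/a -/b -(@real_normK _ a) ?num_real// -(@real_normK _ b) ?num_real//.
move: (normr_ge0 a) (normr_ge0 b) e1; set p := `|a|; set q := `|b|; set e := expR _.
move=> p0 q0 e1.
have h : p * (2 * q) + 3 * q ^+ 2 <= p ^+ 2 + 4 * q ^+ 2.
  by have := sqr_ge0 (p - q); nra.
have h2 : 0 <= (e - 1) * (p ^+ 2 + 4 * q ^+ 2).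
  by rewrite mulr_ge0// ?subr_ge0//; have := sqr_ge0 p; have := sqr_ge0 q; lra.
have := sqr_ge0 p; have := sqr_ge0 q; nra.
Qed.

End cexp.

(** * The weight 1 / (1 + x^2) on the line *)

Section lebesgue_line.
Context {R : realType}.
Local Notation T := (measurableTypeR R).
Local Notation mu := (@lebesgue_measure R).

Definition oneDsqrV (x : R) : R := (1 + x ^+ 2)^-1.

Lemma oneDsqr_gt0 (x : R) : 0 < 1 + x ^+ 2.
Proof. by rewrite ltr_wpDr// sqr_ge0. Qed.

Lemma oneDsqrV_gt0 x : 0 < oneDsqrV x.
Proof. by rewrite invr_gt0 oneDsqr_gt0. Qed.

Lemma oneDsqrV_ge0 x : 0 <= oneDsqrV x.
Proof. exact/ltW/oneDsqrV_gt0. Qed.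

Lemma oneDsqrV_le1 x : oneDsqrV x <= 1.
Proof. by rewrite invf_le1 ?oneDsqr_gt0// lerDl sqr_ge0. Qed.

Lemma measurable_oneDsqrV : measurable_fun setT (oneDsqrV : T -> T).
Proof. by apply: continuous_measurable_fun; exact: continuous_oneDsqrV. Qed.

Lemma integral_oneDsqrV : (\int[mu]_x (oneDsqrV x)%:E = (pi : R)%:E)%E.
Proof.
rewrite ge0_symfun_integralT//=; first last.
- by move=> x; rewrite /= /oneDsqrV sqrrN.
- exact: continuous_oneDsqrV.
- exact: oneDsqrV_ge0.
rewrite -set_itvcy [X in (_ * X)%E](_ : _ = (pi / 2)%:E)%E; last exact: integral0y_oneDsqr.
by rewrite -EFinM; congr EFin; field.
Qed.

End lebesgue_line.

(** * Adjoining and replacing a coordinate *)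

Section row_vectors.
Context {K : Type}.

Definition consV n (x : K) (v : 'rV[K]_n) : 'rV[K]_n.+1 :=
  \row_i (if unlift ord0 i is Some j then v 0 j else x).

Definition setc n (v : 'rV[K]_n) (j : 'I_n) (s : K) : 'rV[K]_n :=
  \row_i (if i == j then s else v 0 i).

Lemma consV0 n x (v : 'rV[K]_n) : consV x v 0 ord0 = x.
Proof. by rewrite mxE unlift_none. Qed.

Lemma consVS n x (v : 'rV[K]_n) j : consV x v 0 (lift ord0 j) = v 0 j.
Proof. by rewrite mxE liftK. Qed.

Lemma setc_cons0 n x s (v : 'rV[K]_n) : setc (consV x v) ord0 s = consV s v.
Proof.
apply/rowP => i; rewrite !mxE; case: unliftP => [j ->|->].
  by rewrite -(inj_eq val_inj).
by rewrite eqxx.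
Qed.

Lemma setc_consS n x s (v : 'rV[K]_n) j :
  setc (consV x v) (lift ord0 j) s = consV x (setc v j s).
Proof.
apply/rowP => i; rewrite !mxE; case: unliftP => [k ->|->].
  by rewrite (inj_eq lift_inj) !mxE.
by rewrite -(inj_eq val_inj).
Qed.

Lemma setcE n (v : 'rV[K]_n) j s i :
  setc v j s 0 i = if i == j then s else v 0 i.
Proof. by rewrite mxE. Qed.

Lemma setc_id n (v : 'rV[K]_n) j : setc v j (v 0 j) = v.
Proof. by apply/rowP => i; rewrite mxE; case: eqP => [->|]. Qed.

End row_vectors.

(** * Integration on R^n against a product weight *)

Section tuple_integrals.
Context {R : realType}.
Local Notation T := (measurableTypeR R).
Local Notation leb := (@lebesgue_measure R).
Local Notation mu := (@lebesgue_tuple R).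

Lemma row_of_consE n (p : T * n.-tuple T) :
  row_of_tuple (tuple_of_pair p) = consV p.1 (row_of_tuple p.2).
Proof.
apply/rowP => i; rewrite !mxE; case: unliftP => [j ->|->//].
by rewrite mxE tnthS.
Qed.

Definition tmeasurable n (f : 'rV[R]_n -> R) :=
  measurable_fun setT (fun t : n.-tuple T => f (row_of_tuple t) : T).

Definition rint n (f : 'rV[R]_n -> R) : R := \int[mu n]_t f (row_of_tuple t).

(** A product over coordinates, rather than a power of 1 + |x|^2: it factors under Fubini and is
    integrable in every dimension. *)
Definition weight n (x : 'rV[R]_n) : R := \prod_i oneDsqrV (x 0 i).

(** A class of integrable functions that is stable under fixing a coordinate, so that inductions on
    the dimension never have to discuss exceptional null sets. *)
Definition dominated n (f : 'rV[R]_n -> R) :=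
  tmeasurable f /\ exists C, forall x, `|f x| <= C * weight x.

Lemma weight_gt0 n (x : 'rV[R]_n) : 0 < weight x.
Proof. by apply: prodr_gt0 => i _; exact: oneDsqrV_gt0. Qed.

Lemma weight_ge0 n (x : 'rV[R]_n) : 0 <= weight x.
Proof. exact/ltW/weight_gt0. Qed.

Lemma weight_cons n x (v : 'rV[R]_n) :
  weight (consV x v) = oneDsqrV x * weight v.
Proof.
rewrite /weight big_ord_recl consV0; congr (_ * _).
by apply: eq_bigr => i _; rewrite consVS.
Qed.

Lemma weight_le1 n (x : 'rV[R]_n) : weight x <= 1.
Proof.
suff /andP[] : 0 <= weight x <= 1 by [].
apply: (big_ind (fun y => 0 <= y <= 1)); first by rewrite ler01 lexx.
  move=> a b /andP[a0 a1] /andP[b0 b1].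
  by rewrite mulr_ge0//= mulr_ile1.
by move=> i _; rewrite oneDsqrV_ge0 oneDsqrV_le1.
Qed.

Lemma tmeasurable_coord n (i : 'I_n) : tmeasurable (fun x => x 0 i).
Proof.
rewrite /tmeasurable (_ : (fun _ => _) = (fun t : n.-tuple T => tnth t i)).
  exact: measurable_tnth.
by apply/funext => t; rewrite mxE.
Qed.

Lemma tmeasurable_comp n (g : R -> R) (f : 'rV[R]_n -> R) :
  measurable_fun setT (g : T -> T) -> tmeasurable f ->
  tmeasurable (fun x => g (f x)).
Proof. by move=> mg mf; apply: (measurableT_comp mg mf). Qed.

Lemma tmeasurableD n (f g : 'rV[R]_n -> R) :
  tmeasurable f -> tmeasurable g -> tmeasurable (fun x => f x + g x).
Proof. exact: measurable_funD. Qed.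

Lemma tmeasurableB n (f g : 'rV[R]_n -> R) :
  tmeasurable f -> tmeasurable g -> tmeasurable (fun x => f x - g x).
Proof. exact: measurable_funB. Qed.

Lemma tmeasurableM n (f g : 'rV[R]_n -> R) :
  tmeasurable f -> tmeasurable g -> tmeasurable (fun x => f x * g x).
Proof. exact: measurable_funM. Qed.

Lemma tmeasurable_cst n c : tmeasurable (fun _ : 'rV[R]_n => c).
Proof. exact: measurable_cst. Qed.

Lemma tmeasurable_sum n I (s : seq I) (F : I -> 'rV[R]_n -> R) :
  (forall i, tmeasurable (F i)) -> tmeasurable (fun x => \sum_(i <- s) F i x).
Proof.
move=> h; elim: s => [|i s IH]; rewrite /tmeasurable.
  by under eq_fun do rewrite big_nil; exact: tmeasurable_cst.
by under eq_fun do rewrite big_cons; exact: tmeasurableD (h i) IH.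
Qed.

Lemma tmeasurable_prod n I (s : seq I) (F : I -> 'rV[R]_n -> R) :
  (forall i, tmeasurable (F i)) -> tmeasurable (fun x => \prod_(i <- s) F i x).
Proof.
move=> h; elim: s => [|i s IH]; rewrite /tmeasurable.
  by under eq_fun do rewrite big_nil; exact: tmeasurable_cst.
by under eq_fun do rewrite big_cons; exact: tmeasurableM (h i) IH.
Qed.

Lemma tmeasurable_weight n : tmeasurable (@weight n).
Proof.
apply: tmeasurable_prod => i; apply: tmeasurable_comp.
  exact: measurable_oneDsqrV.
exact: tmeasurable_coord.
Qed.

Lemma tmeasurable_consl n (f : 'rV[R]_n.+1 -> R) :
  tmeasurable f <-> measurable_fun setT
    (fun p : T * n.-tuple T => f (consV p.1 (row_of_tuple p.2)) : T).
Proof.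
split=> mf.
  rewrite (_ : (fun _ => _) =
      (fun t => f (row_of_tuple t)) \o (@tuple_of_pair R n)).
    by apply: measurableT_comp => //; exact: measurable_tuple_of_pair.
  by apply/funext => p /=; rewrite row_of_consE.
rewrite /tmeasurable (_ : (fun _ => _) =
  (fun p : T * n.-tuple T => f (consV p.1 (row_of_tuple p.2))) \o
  (@pair_of_tuple R n)).
  by apply: measurableT_comp => //; exact: measurable_pair_of_tuple.
by apply/funext => t; rewrite -{1}(pair_of_tupleK t) row_of_consE.
Qed.

Lemma tmeasurable_slice n (f : 'rV[R]_n.+1 -> R) x :
  tmeasurable f -> tmeasurable (fun v => f (consV x v)).
Proof.
by move/tmeasurable_consl => mf; exact: (measurableT_comp mf (measurable_pair1 x)).
Qed.

Lemma measurable_slice0 n (f : 'rV[R]_n.+1 -> R) (t : n.-tuple T) :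
  tmeasurable f ->
  measurable_fun setT (fun x : T => f (consV x (row_of_tuple t)) : T).
Proof.
by move/tmeasurable_consl => mf; exact: (measurableT_comp mf (measurable_pair2 t)).
Qed.

Lemma row_of_tuple_surj n (x : 'rV[R]_n) : exists t, x = row_of_tuple t.
Proof.
exists [tuple x 0 i | i < n]; apply/rowP => i.
by rewrite mxE tnth_mktuple.
Qed.

Lemma measurable_slice n (f : 'rV[R]_n.+1 -> R) v :
  tmeasurable f -> measurable_fun setT (fun x : T => f (consV x v) : T).
Proof.
by move=> mf; have [t ->] := row_of_tuple_surj v; exact: measurable_slice0.
Qed.

Lemma ge0_integral_cons n (f : 'rV[R]_n.+1 -> R) :
  tmeasurable f -> (forall x, 0 <= f x) ->
  (\int[mu n.+1]_t (f (row_of_tuple t))%:E =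
   \int[leb]_x \int[mu n]_t (f (consV x (row_of_tuple t)))%:E)%E.
Proof.
move=> mf f0; transitivity (\int[leb \x mu n]_p
    (f (consV p.1 (row_of_tuple p.2)))%:E)%E.
  rewrite [LHS]ge0_integral_pushforward//=; first last.
  - by move=> t _; rewrite lee_fin.
  - exact/measurable_EFinP.
  - exact: measurable_tuple_of_pair.
  rewrite preimage_setT; apply: eq_integral => p _.
  by rewrite /= row_of_consE.
apply: (@fubini_tonelli1 _ _ _ _ _ leb (mu n)
  (fun p => (f (consV p.1 (row_of_tuple p.2)))%:E)).
- exact/measurable_EFinP/tmeasurable_consl.
- by move=> p; rewrite lee_fin.
Qed.

(** Serves both the weight and the Gaussians. Tonelli with nonnegative factors peels off the first
    coordinate and the constant of the other ones leaves the integral. *)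
Lemma integral_prod_coord n (k : 'I_n -> R -> R) (c : 'I_n -> R) :
  (forall i, measurable_fun setT (k i : T -> T)) ->
  (forall i x, 0 <= k i x) ->
  (forall i, (\int[leb]_x (k i x)%:E = (c i)%:E)%E) ->
  (\int[mu n]_t (\prod_i k i (row_of_tuple t 0 i))%:E = (\prod_i c i)%:E)%E.
Proof.
elim: n k c => [|n IH] k c mk k0 kc.
  rewrite big_ord0; under eq_integral do rewrite big_ord0.
  by rewrite integral_cst// mul1e /= dirac_measure.diracT.
rewrite (@ge0_integral_cons n (fun x => \prod_i k i (x 0 i))); first last.
- by move=> x; exact: prodr_ge0.
- by apply: tmeasurable_prod => i; apply: tmeasurable_comp => //; exact: tmeasurable_coord.
transitivity (\int[leb]_x ((\prod_i c (lift ord0 i))%:E * (k ord0 x)%:E))%E.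
  apply: eq_integral => x _.
  under eq_integral => t _.
    rewrite big_ord_recl consV0 EFinM.
    under eq_bigr do rewrite consVS.
    over.
  rewrite ge0_integralZl//=; first last.
  - by rewrite lee_fin.
  - by move=> t _; rewrite lee_fin prodr_ge0.
  - apply/measurable_EFinP;
    apply: (@tmeasurable_prod n _ _ (fun i x => k (lift ord0 i) (x 0 i))) => i.
    by apply: tmeasurable_comp => //; exact: tmeasurable_coord.
  by rewrite (IH (fun i => k (lift ord0 i)) (fun i => c (lift ord0 i)))// muleC.
rewrite ge0_integralZl//=; first last.
- rewrite lee_fin prodr_ge0// => i _; rewrite -lee_fin -kc.
  by apply: integral_ge0 => x _; rewrite lee_fin.
- by move=> x _; rewrite lee_fin.
- by apply/measurable_EFinP; exact: mk.
by rewrite kc big_ord_recl -EFinM mulrC.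
Qed.

Lemma integrable_weight n :
  (mu n).-integrable setT (fun t => (weight (row_of_tuple t))%:E).
Proof.
apply/integrableP; split; first by apply/measurable_EFinP; exact: tmeasurable_weight.
under eq_integral => t _ do rewrite /= ger0_norm ?weight_ge0//.
rewrite (@integral_prod_coord n (fun _ => oneDsqrV) (fun _ => pi)) ?ltry//.
- by move=> _; exact: measurable_oneDsqrV.
- by move=> _; exact: oneDsqrV_ge0.
- by move=> _; exact: integral_oneDsqrV.
Qed.

Lemma dominated_integrable n (f : 'rV[R]_n -> R) : dominated f ->
  (mu n).-integrable setT (EFin \o (fun t => f (row_of_tuple t))).
Proof.
move=> [mf [C fC]]; apply: (@le_integrable _ _ _ _ _ measurableT _
    (fun t => C%:E * (weight (row_of_tuple t))%:E)%E).
- exact/measurable_EFinP.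
- move=> t _; rewrite /= lee_fin (le_trans (fC _))//.
  exact: ler_norm.
- by apply: integrableZl => //; exact: integrable_weight.
Qed.

Lemma dominated_slice n (f : 'rV[R]_n.+1 -> R) x : dominated f ->
  dominated (fun v => f (consV x v)).
Proof.
move=> [mf [C fC]]; split; first exact: tmeasurable_slice.
exists `|C| => v; rewrite (le_trans (fC _))// weight_cons mulrCA.
rewrite (le_trans (ler_norm _))// !normrM (ger0_norm (weight_ge0 _)).
by rewrite ler_piMl ?mulr_ge0 ?weight_ge0// ger0_norm ?oneDsqrV_ge0 ?oneDsqrV_le1.
Qed.

Lemma integrable_line (k : R -> R) C :
  measurable_fun setT (k : T -> T) -> (forall x, `|k x| <= C * oneDsqrV x) ->
  leb.-integrable setT (EFin \o k).
Proof.
move=> mk kC; apply: (@le_integrable _ _ _ _ _ measurableT _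
    (fun x : T => C%:E * (oneDsqrV x)%:E)%E).
- exact/measurable_EFinP.
- by move=> t _; rewrite /= lee_fin (le_trans (kC _))// ler_norm.
- apply: integrableZl => //; apply/integrableP; split.
    by apply/measurable_EFinP; exact: measurable_oneDsqrV.
  under eq_integral => x _ do rewrite /= ger0_norm ?oneDsqrV_ge0//.
  by rewrite integral_oneDsqrV ltry.
Qed.

Lemma dominated_integrable_slice n (f : 'rV[R]_n.+1 -> R) v : dominated f ->
  leb.-integrable setT (EFin \o (fun x => f (consV x v))).
Proof.
move=> [mf [C fC]]; apply: (@integrable_line _ (C * weight v)).
  exact: measurable_slice.
by move=> x; rewrite mulrAC -mulrA -weight_cons.
Qed.

Section fubini_cons.
Variables (n : nat) (f : 'rV[R]_n.+1 -> R).
Hypothesis df : dominated f.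
Let g (p : T * n.-tuple T) := (f (consV p.1 (row_of_tuple p.2)))%:E.

Let gE : (fun t => (f (row_of_tuple t))%:E) \o @tuple_of_pair R n = g.
Proof. by apply/funext => p; rewrite /g /= row_of_consE. Qed.

Let integrable_g : (leb \x mu n)%E.-integrable setT g.
Proof.
have [mf [C fC]] := df.
have mg : measurable_fun setT g by exact/measurable_EFinP/tmeasurable_consl.
apply/integrableP; split => //.
(* The absolute value is compared with a multiple of the weight; Tonelli then reads the integral on
   the product as one on n + 1 coordinates, known to be finite. *)
apply: le_lt_trans (_ : (\int[leb \x mu n]_p
   (`|C| * weight (consV p.1 (row_of_tuple p.2)))%:E < +oo)%E).
  apply: ge0_le_integral => //.
  - exact: measurableT_comp.
  - apply/measurable_EFinP/measurable_funM => //.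
    by apply/(tmeasurable_consl (@weight n.+1)); exact: tmeasurable_weight.
  - move=> p _; rewrite /g /= lee_fin (le_trans (fC _))//.
    by rewrite ler_wpM2r ?weight_ge0// ler_norm.
rewrite fubini_tonelli1//=; first last.
- by move=> p; rewrite lee_fin mulr_ge0 ?weight_ge0.
- apply/measurable_EFinP/measurable_funM => //.
  by apply/(tmeasurable_consl (@weight n.+1)); exact: tmeasurable_weight.
rewrite /fubini_F /=.
rewrite -(@ge0_integral_cons n (fun x => `|C| * weight x)); first last.
- by move=> x; rewrite mulr_ge0 ?weight_ge0.
- by apply: tmeasurableM; [exact: tmeasurable_cst|exact: tmeasurable_weight].
have /dominated_integrable/integrableP[_] : dominated (fun x : 'rV[R]_n.+1 => `|C| * weight x).
  split; first by apply: tmeasurableM; [exact: tmeasurable_cst|exact: tmeasurable_weight].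
  by exists `|C| => x; rewrite ger0_norm// mulr_ge0 ?weight_ge0.
by under eq_integral => t _ do rewrite /= ger0_norm ?mulr_ge0 ?weight_ge0//.
Qed.

Let integral_cons :
  (\int[mu n.+1]_t (f (row_of_tuple t))%:E = \int[leb \x mu n]_p g p)%E.
Proof.
have [mf _] := df.
have h := @integral_pushforward _ _ _ _ R _ (@measurable_tuple_of_pair R n)
  (leb \x mu n)%E setT (fun t => (f (row_of_tuple t))%:E).
rewrite gE preimage_setT in h; apply: h => //.
by apply/measurable_EFinP; exact: mf.
Qed.

Lemma rint_cons : rint f = \int[leb]_x rint (fun v => f (consV x v)).
Proof.
rewrite /rint /Rintegral integral_cons -integral12_prod_meas1//.
congr fine; apply: eq_integral => x _; rewrite /fubini_F /= /g/= fineK//.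
by apply: integrable_fin_num => //; exact: (dominated_integrable (dominated_slice x df)).
Qed.

Lemma rint_consC : rint f = rint (fun v => \int[leb]_x f (consV x v)).
Proof.
rewrite /rint /Rintegral integral_cons -integral21_prod_meas1//.
congr fine; apply: eq_integral => x _; rewrite /fubini_G /= /g/= fineK//.
by apply: integrable_fin_num => //; exact: dominated_integrable_slice.
Qed.

End fubini_cons.

(* Iterating Fubini lets any one coordinate be integrated first. *)
Lemma rint_eq0_coord n (k : 'rV[R]_n -> R) (j : 'I_n) : dominated k ->
  (forall x, \int[leb]_s k (setc x j s) = 0) -> rint k = 0.
Proof.
elim: n k j => [|n IH] k j dk k0; first by case: j k0.
case: (unliftP ord0 j) => [i|] Ej; subst j.
  rewrite rint_cons// [LHS](@eq_Rintegral _ _ _ _ _ (fun=> 0)).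
    by rewrite Rintegral_cst// mul0r.
  move=> x _; apply: (IH _ i); first exact: dominated_slice.
  move=> v; rewrite -[RHS](k0 (consV x v)).
  by apply: eq_Rintegral => s _; rewrite setc_consS.
rewrite rint_consC// /rint [LHS](@eq_Rintegral _ _ _ _ _ (fun=> 0)).
  by rewrite Rintegral_cst// mul0r.
move=> t _; rewrite -[RHS](k0 (consV 0 (row_of_tuple t))).
by apply: eq_Rintegral => s _; rewrite setc_cons0.
Qed.

End tuple_integrals.

Section rV_ball.
Context {K : numFieldType}.

Lemma rV_ballP n (x y : 'rV[K]_n) e : 0 < e ->
  ball x e y <-> forall i, `|x 0 i - y 0 i| < e.
Proof.
move=> e0; split=> [[_ h] i|h]; first exact: h.
by split=> // i j; rewrite ord1; exact: h.
Qed.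

End rV_ball.

(** * Continuous functions are measurable for the product structure *)

Section continuous_measurable.
Context {R : realType}.
Local Notation T := (measurableTypeR R).

Let grid n k (t : n.-tuple T) (i : 'I_n) : int :=
  Num.floor (k.+1%:R * tnth t i).

Let gridpt n k (m : {ffun 'I_n -> int}) : 'rV[R]_n :=
  \row_i ((m i)%:~R / k.+1%:R).

Let measurable_grid n k (i : 'I_n) m :
  measurable [set t : n.-tuple T | grid k t i = m].
Proof.
have mf : measurable_fun setT (fun t : n.-tuple T => k.+1%:R * tnth t i : T).
  by apply: measurable_funM => //; exact: measurable_tnth.
have -> : [set t : n.-tuple T | grid k t i = m] =
    setT `&` (fun t => k.+1%:R * tnth t i) @^-1` `[m%:~R, (m + 1)%:~R[%classic.
  rewrite setTI; apply/seteqP; split=> t /=; rewrite in_itv /=.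
    by move=> <-; rewrite /grid floor_itv.
  by move=> h; apply: floor_def.
by apply: mf => //; exact: measurable_itv.
Qed.

(* A continuous function is the limit of its values at the points obtained by
   rounding the coordinates down to multiples of 1/(k+1). *)
Lemma continuous_tmeasurable n (f : 'rV[R]_n -> R) :
  continuous f -> tmeasurable f.
Proof.
move=> cf.
apply: (@measurable_fun_cvg _ _ _ _
  (fun k (t : n.-tuple T) => f (gridpt k [ffun i => grid k t i]))).
- move=> k _ Y mY; rewrite setTI.
  (* The rounded function takes one value per vector of integers, so the preimage of [Y] is a
     countable union of grid cells, namely those whose value lies in [Y]. *)
  rewrite (_ : _ @^-1` _ = \bigcup_(m : {ffun 'I_n -> int})
      (if `[< Y (f (gridpt k m)) >] then
        \bigcap_(i in [set: 'I_n]) [set t : n.-tuple T | grid k t i = m i]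
       else set0)); last first.
    apply/seteqP; split=> t /=.
      move=> Yt; exists [ffun i => grid k t i] => //.
      by rewrite asboolT// => i _ /=; rewrite ffunE.
    move=> [m _]; case: ifPn => // /asboolP Ym h.
    suff -> : [ffun i => grid k t i] = m by [].
    by apply/ffunP => i; rewrite ffunE; exact: h.
  apply: countable_bigcupT_measurable; first exact: countableP.
  move=> m; case: ifP => // _.
  by apply: fin_bigcap_measurable => // i _; exact: measurable_grid.
move=> t _; apply: (@cvg_comp _ _ _ (fun k => gridpt k [ffun i => grid k t i]) f
  _ _ _ _ (cf (row_of_tuple t))).
apply/cvg_ballP => e e0; near=> k.
apply/rV_ballP => // i; rewrite !mxE !ffunE /grid.
have k0 : 0 < k.+1%:R :> R by [].
have /andP[h1 h2] := floor_itv (k.+1%:R * tnth t i).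
apply: (@le_lt_trans _ _ k.+1%:R^-1).
  rewrite -(@ler_pM2l _ k.+1%:R)// mulfV ?gt_eqF//.
  rewrite -[X in X * _]gtr0_norm// -normrM mulrBr mulrCA mulfV ?gt_eqF// mulr1.
  rewrite ger0_norm ?subr_ge0// lerBlDl.
  by move: h2; rewrite intrD => /ltW.
by near: k; exact: near_infty_natSinv_lt (PosNum e0).
Unshelve. all: by end_near.
Qed.

End continuous_measurable.

(** * Complex integrals of dominated functions *)

Section complex_integrals.
Context {R : realType}.
Local Notation T := (measurableTypeR R).
Local Notation mu := (@lebesgue_tuple R).
Variable n : nat.
Implicit Types (f : 'rV[R]_n -> R) (g h : 'rV[R]_n -> R[i]).

Definition ctmeasurable g := tmeasurable (fun x => complex.Re (g x)) /\
  tmeasurable (fun x => complex.Im (g x)).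

Definition cdominated g := ctmeasurable g /\
  exists C, forall x, cabs (g x) <= C * weight x.

Definition wtot : R := rint (@weight R n).

Lemma dominated_weight : dominated (@weight R n).
Proof.
split; first exact: tmeasurable_weight.
by exists 1 => x; rewrite mul1r ger0_norm ?weight_ge0.
Qed.

Lemma wtot_ge0 : 0 <= wtot.
Proof. by apply: Rintegral_ge0 => t _; exact: weight_ge0. Qed.

Lemma ctmeasurable_cst c : ctmeasurable (fun _ => c).
Proof.
by split; [exact: (@tmeasurable_cst R n (complex.Re c))|
  exact: (@tmeasurable_cst R n (complex.Im c))].
Qed.

Lemma ctmeasurableD g h : ctmeasurable g -> ctmeasurable h ->
  ctmeasurable (fun x => g x + h x).
Proof.
move=> [g1 g2] [h1 h2]; split; rewrite /tmeasurable.
  by under eq_fun do rewrite ReD; exact: (tmeasurableD g1 h1).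
by under eq_fun do rewrite ImD; exact: (tmeasurableD g2 h2).
Qed.

Lemma ctmeasurableM g h : ctmeasurable g -> ctmeasurable h ->
  ctmeasurable (fun x => g x * h x).
Proof.
move=> [g1 g2] [h1 h2]; split; rewrite /tmeasurable.
  under eq_fun do rewrite ReM.
  exact: (tmeasurableB (tmeasurableM g1 h1) (tmeasurableM g2 h2)).
under eq_fun do rewrite ImM.
exact: (tmeasurableD (tmeasurableM g1 h2) (tmeasurableM g2 h1)).
Qed.

Lemma ctmeasurable_real f : tmeasurable f -> ctmeasurable (fun x => (f x)%:C).
Proof. by move=> mf; split => //; exact: (@tmeasurable_cst R n 0). Qed.

Lemma ctmeasurable_cis f : tmeasurable f -> ctmeasurable (fun x => cis (f x)).
Proof.
move=> mf; split.
  apply: (tmeasurable_comp _ mf); apply: continuous_measurable_fun.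
  exact: continuous_cos.
apply: (tmeasurable_comp _ mf); apply: continuous_measurable_fun.
exact: continuous_sin.
Qed.

Lemma ctmeasurable_cexp g : ctmeasurable g ->
  ctmeasurable (fun x => cexp (g x)).
Proof.
move=> [g1 g2]; apply: ctmeasurableM; last exact: ctmeasurable_cis.
apply: ctmeasurable_real; apply: (tmeasurable_comp _ g1).
by apply: continuous_measurable_fun; exact: continuous_expR.
Qed.

Lemma cdominated_bound g : cdominated g ->
  exists2 C, 0 <= C & forall x, cabs (g x) <= C * weight x.
Proof.
move=> [_ [C h]]; exists `|C| => // x.
by rewrite (le_trans (h x))// ler_wpM2r ?weight_ge0// ler_norm.
Qed.

Lemma cdominated_Re g : cdominated g -> dominated (fun x => complex.Re (g x)).
Proof.
move=> [[g1 g2] [C h]]; split => //; exists C => x.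
exact: le_trans (Re_le_cabs _) (h x).
Qed.

Lemma cdominated_Im g : cdominated g -> dominated (fun x => complex.Im (g x)).
Proof.
move=> [[g1 g2] [C h]]; split => //; exists C => x.
exact: le_trans (Im_le_cabs _) (h x).
Qed.

Lemma cdominatedD g h : cdominated g -> cdominated h ->
  cdominated (fun x => g x + h x).
Proof.
move=> [mg [C hg]] [mh [D hh]]; split; first exact: ctmeasurableD.
exists (C + D) => x; rewrite (le_trans (le_cabsD _ _))// mulrDl.
by rewrite lerD.
Qed.

Lemma cdominatedM g h B : ctmeasurable g -> (forall x, cabs (g x) <= B) ->
  cdominated h -> cdominated (fun x => g x * h x).
Proof.
move=> mg gB [mh [D hD]]; split; first exact: ctmeasurableM.
exists (B * D) => x; rewrite cabsM -mulrA ler_pM ?cabs_ge0//.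
Qed.

Lemma cdominatedZ a g : cdominated g -> cdominated (fun x => a * g x).
Proof. by apply: (@cdominatedM (fun _ => a)) => //; exact: ctmeasurable_cst. Qed.

Lemma cdominatedB g h : cdominated g -> cdominated h ->
  cdominated (fun x => g x - h x).
Proof.
move=> dg dh; have := cdominatedD dg (cdominatedZ (-1) dh).
by under eq_fun do rewrite mulN1r.
Qed.

Lemma cdominated_integrable g : cdominated g -> cintegrable g.
Proof.
move=> dg; split.
  exact: (dominated_integrable (cdominated_Re dg)).
exact: (dominated_integrable (cdominated_Im dg)).
Qed.

Lemma eq_cintegral g h : g =1 h -> cintegral g = cintegral h.
Proof. by move=> /funext ->. Qed.

Lemma cintegralD g h : cdominated g -> cdominated h ->
  cintegral (fun x => g x + h x) = cintegral g + cintegral h.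
Proof.
move=> /cdominated_integrable[ig1 ig2] /cdominated_integrable[ih1 ih2].
apply: complexP => /=.
  by under eq_Rintegral do rewrite ReD; rewrite RintegralD.
by under eq_Rintegral do rewrite ImD; rewrite RintegralD.
Qed.

Lemma cintegralZ a g : cdominated g ->
  cintegral (fun x => a * g x) = a * cintegral g.
Proof.
move=> /cdominated_integrable[g1 g2].
have scal c f : (mu n).-integrable setT (EFin \o (fun t => f (row_of_tuple t))) ->
    (mu n).-integrable setT (EFin \o (fun t => c * f (row_of_tuple t))).
  by move=> i; exact: (@integrableZl _ _ _ (mu n) _ measurableT c _ i).
apply: complexP => /=.
  under eq_Rintegral do rewrite ReM.
  rewrite (RintegralB _ (scal _ (fun x => complex.Re (g x)) g1)
    (scal _ (fun x => complex.Im (g x)) g2))//.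
  by rewrite ReM /= !RintegralZl.
under eq_Rintegral do rewrite ImM.
rewrite (RintegralD _ (scal _ (fun x => complex.Im (g x)) g2)
  (scal _ (fun x => complex.Re (g x)) g1))//.
by rewrite ImM /= !RintegralZl.
Qed.

Lemma cintegralB g h : cdominated g -> cdominated h ->
  cintegral (fun x => g x - h x) = cintegral g - cintegral h.
Proof.
move=> dg dh; rewrite -[in RHS]mulN1r -cintegralZ// -cintegralD//.
  by apply: eq_cintegral => x; rewrite mulN1r.
exact: cdominatedZ.
Qed.

Lemma le_rint f1 f2 : dominated f1 -> dominated f2 ->
  (forall x, f1 x <= f2 x) -> rint f1 <= rint f2.
Proof.
move=> d1 d2 h; apply: le_Rintegral => //.
- exact: dominated_integrable d1.
- exact: dominated_integrable d2.
Qed.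

Lemma rintZl c f : dominated f -> rint (fun x => c * f x) = c * rint f.
Proof. by move=> /dominated_integrable df; rewrite /rint RintegralZl. Qed.

Lemma rintD f1 f2 : dominated f1 -> dominated f2 ->
  rint (fun x => f1 x + f2 x) = rint f1 + rint f2.
Proof.
move=> /dominated_integrable d1 /dominated_integrable d2.
by rewrite /rint RintegralD.
Qed.

Lemma dominatedZ c f : dominated f -> dominated (fun x => c * f x).
Proof.
move=> [mf [C h]]; split; first exact: tmeasurableM (@tmeasurable_cst R n c) mf.
by exists (`|c| * C) => x; rewrite normrM -mulrA ler_wpM2l.
Qed.

Lemma dominatedD f1 f2 : dominated f1 -> dominated f2 ->
  dominated (fun x => f1 x + f2 x).
Proof.
move=> [m1 [C1 h1]] [m2 [C2 h2]]; split; first exact: tmeasurableD.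
by exists (C1 + C2) => x; rewrite (le_trans (ler_normD _ _))// mulrDl lerD.
Qed.

Lemma norm_rint_le f1 f2 : dominated f1 -> dominated f2 ->
  (forall x, `|f1 x| <= f2 x) -> `|rint f1| <= rint f2.
Proof.
move=> d1 d2 h; rewrite ler_norml; apply/andP; split.
  rewrite lerNl -mulN1r -rintZl//; apply: le_rint => //.
    exact: dominatedZ.
  by move=> x; rewrite mulN1r (le_trans _ (h x))// -normrN ler_norm.
by apply: le_rint => // x; rewrite (le_trans _ (h x))// ler_norm.
Qed.

(* The factor 2 comes from bounding real and imaginary parts separately. *)
Lemma cabs_cintegral_rint g f : cdominated g -> dominated f ->
  (forall x, cabs (g x) <= f x) -> cabs (cintegral g) <= 2 * rint f.
Proof.
move=> dg df h; rewrite (le_trans (cabs_le_ReIm _))// mulr_natl mulr2n.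
apply: lerD.
  apply: (norm_rint_le (cdominated_Re dg) df) => x.
  exact: le_trans (Re_le_cabs _) (h x).
apply: (norm_rint_le (cdominated_Im dg) df) => x.
exact: le_trans (Im_le_cabs _) (h x).
Qed.

Lemma cabs_cintegral_le g C : ctmeasurable g ->
  (forall x, cabs (g x) <= C * weight x) -> cabs (cintegral g) <= 2 * C * wtot.
Proof.
move=> mg h; rewrite -mulrA -rintZl; last exact: dominated_weight.
apply: cabs_cintegral_rint => //; first by split => //; exists C.
exact/dominatedZ/dominated_weight.
Qed.

Lemma ctmeasurable_continuous g : continuous (fun x => complex.Re (g x)) ->
  continuous (fun x => complex.Im (g x)) -> ctmeasurable g.
Proof. by move=> c1 c2; split; exact: continuous_tmeasurable. Qed.

End complex_integrals.

(** * Integrals on segments and truncation of integrals on the line *)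

Section line_integrals.
Context {R : realType}.
Local Notation T := (measurableTypeR R).
Local Notation leb := (@lebesgue_measure R).
Implicit Types (k : R -> R[i]) (f : R -> R).

Definition ccontinuous1 k := continuous (fun x => complex.Re (k x)) /\
  continuous (fun x => complex.Im (k x)).

Lemma ccontinuous1D k l : ccontinuous1 k -> ccontinuous1 l ->
  ccontinuous1 (fun x => k x + l x).
Proof.
move=> [k1 k2] [l1 l2]; split=> x.
  by under eq_fun do rewrite ReD; apply: cvgD; [exact: k1|exact: l1].
by under eq_fun do rewrite ImD; apply: cvgD; [exact: k2|exact: l2].
Qed.

Lemma ccontinuous1N k : ccontinuous1 k -> ccontinuous1 (fun x => - k x).
Proof.
move=> [k1 k2]; split=> x.
  by under eq_fun do rewrite ReN; apply: cvgN; exact: k1.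
by under eq_fun do rewrite ImN; apply: cvgN; exact: k2.
Qed.

Lemma ccontinuous1B k l : ccontinuous1 k -> ccontinuous1 l ->
  ccontinuous1 (fun x => k x - l x).
Proof. by move=> ck /ccontinuous1N; exact: ccontinuous1D. Qed.

Definition segint (a b : R) k : R[i] :=
  (\int[leb]_(x in `[a, b]) complex.Re (k x)) +i*
  (\int[leb]_(x in `[a, b]) complex.Im (k x)).

Lemma continuous_segment_integrable f a b : continuous f ->
  leb.-integrable `[a, b] (EFin \o f).
Proof.
move=> cf; apply: continuous_compact_integrable; first exact: segment_compact.
exact: continuous_subspaceT.
Qed.
Local Notation csi := continuous_segment_integrable.

Lemma segintD a b k l : ccontinuous1 k -> ccontinuous1 l ->
  segint a b (fun x => k x + l x) = segint a b k + segint a b l.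
Proof.
move=> [k1 k2] [l1 l2]; apply: complexP => /=.
  by under eq_Rintegral do rewrite ReD; rewrite RintegralD//; exact: csi.
by under eq_Rintegral do rewrite ImD; rewrite RintegralD//; exact: csi.
Qed.

Lemma segintN a b k : ccontinuous1 k ->
  segint a b (fun x => - k x) = - segint a b k.
Proof.
move=> ck; apply/eqP; rewrite -addr_eq0 -segintD//; last exact: ccontinuous1N.
under [X in segint _ _ X]eq_fun do rewrite addrC subrr.
by rewrite /segint /= !Rintegral_cst// !mul0r.
Qed.

Lemma segintB a b k l : ccontinuous1 k -> ccontinuous1 l ->
  segint a b (fun x => k x - l x) = segint a b k - segint a b l.
Proof.
by move=> ck cl; rewrite segintD ?segintN//; exact: ccontinuous1N.
Qed.

Lemma Rintegral_split f a m b : a <= m -> m <= b -> continuous f ->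
  \int[leb]_(x in `[a, b]) f x =
  \int[leb]_(x in `[a, m]) f x + \int[leb]_(x in `[m, b]) f x.
Proof.
move=> am mb cf.
rewrite -[X in _ = _ + X]Rintegral_itv_obnd_cbnd; last first.
  by apply: integrableS (csi m b cf) => //; exact: subset_itv_oc_cc.
rewrite -(@Rintegral_itvB _ _ (BLeft a) (BRight b) m) ?bnd_simp//.
  by rewrite addrC subrK.
exact: csi.
Qed.

Lemma segint_split a m b k : a <= m -> m <= b -> ccontinuous1 k ->
  segint a b k = segint a m k + segint m b k.
Proof.
move=> am mb [k1 k2]; apply: complexP => /=; exact: Rintegral_split.
Qed.

Lemma lebesgue_segment a b : a <= b -> fine (leb `[a, b]) = b - a.
Proof.
rewrite lebesgue_measure_itv /= lte_fin le_eqVlt => /predU1P[->|->//].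
by rewrite ltxx subrr.
Qed.

Lemma segint_cst a b c : a <= b -> segint a b (fun _ => c) = c * (b - a)%:C.
Proof.
move=> ab; apply: complexP; rewrite ?ReM ?ImM /= Rintegral_cst// lebesgue_segment//; ring.
Qed.

Lemma norm_Rintegral_segment f a b B : a <= b -> continuous f ->
  (forall x, a <= x <= b -> `|f x| <= B) ->
  `|\int[leb]_(x in `[a, b]) f x| <= B * (b - a).
Proof.
move=> ab cf fB; apply: (le_trans (le_normr_Rintegral _ (csi _ _ cf))) => //.
rewrite -lebesgue_segment// -Rintegral_cst//; apply: le_Rintegral => //.
- by apply: csi => x; apply: cvg_norm; exact: cf.
- by apply: csi => x; exact: cvg_cst.
Qed.

Lemma cabs_segint k a b B : a <= b -> ccontinuous1 k ->
  (forall x, a <= x <= b -> cabs (k x) <= B) ->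
  cabs (segint a b k) <= 2 * B * (b - a).
Proof.
move=> ab [k1 k2] kB; rewrite (le_trans (cabs_le_ReIm _))//.
rewrite -mulrA mulr_natl mulr2n lerD// norm_Rintegral_segment// => x /kB.
  exact: le_trans (Re_le_cabs _).
exact: le_trans (Im_le_cabs _).
Qed.

(* Truncation: the integral over the line is the limit of the integrals over
   [-A, A]. *)
Lemma Rintegral_line_eq0 f C D : continuous f ->
  (forall x, `|f x| <= C * oneDsqrV x) ->
  (forall A, 0 < A -> `|\int[leb]_(x in `[- A, A]) f x| <= D * oneDsqrV A) ->
  \int[leb]_x f x = 0.
Proof.
move=> cf fC fD.
have mf : measurable_fun setT (f : T -> T) by exact: continuous_measurable_fun.
have fint := integrable_line mf fC.
(* The half-length is n + 1 because the hypothesis on truncated integrals asks for A > 0; it also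
   makes N <= N^2 available in the final estimate. *)
pose I n : set R := `[- n.+1%:R, n.+1%:R]%classic.
have mI n : measurable (I n) by exact: measurable_itv.
have h1 : (\int[leb]_(x in I n) (f x)%:E)%E @[n --> \oo] --> (\int[leb]_x (f x)%:E)%E.
  under eq_cvg do rewrite integral_mkcond.
  have C0 : 0 <= C.
    have := le_trans (normr_ge0 _) (fC 0).
    by rewrite pmulr_lge0// oneDsqrV_gt0.
  have [|||||_ _] := @dominated_convergence _ _ _ leb setT measurableT
    (fun n => (EFin \o f) \_ (I n)) (EFin \o f) (fun x => (C * oneDsqrV x)%:E).
  - move=> n; apply/(measurable_restrictT _ _).1; first exact: mI.
    by apply/measurable_EFinP; exact: (measurable_funS measurableT _ mf).
  - by apply/measurable_EFinP; exact: mf.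
  - apply: aeW => x _; apply: (@cvg_near_cst _ _ _ _ _).
    near=> n; rewrite patchE ifT// inE /I /= in_itv /= -ler_norml.
    near: n; exists (Num.truncn `|x|) => // n /= xn.
    by rewrite (le_trans (ltW (truncnS_gt _)))// ler_nat ltnS.
  - have mw : measurable_fun setT (fun x : T => C * oneDsqrV x : T).
      by apply: measurable_funM => //; exact: measurable_oneDsqrV.
    apply: (@integrable_line _ _ C) => // x.
    by rewrite ger0_norm// mulr_ge0// oneDsqrV_ge0.
  - apply: aeW => x n _; rewrite patchE; case: ifP => _ /=.
      by rewrite lee_fin fC.
    by rewrite normr0 lee_fin mulr_ge0// oneDsqrV_ge0.
  - by apply.
have h2 : (\int[leb]_(x in I n) (f x)%:E)%E @[n --> \oo] --> 0%E.
  have E n : (\int[leb]_(x in I n) (f x)%:E)%E = (\int[leb]_(x in I n) f x)%:E.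
    rewrite /Rintegral fineK//.
    have i := csi (- n.+1%:R) n.+1%:R cf.
    exact: (@integrable_fin_num _ _ _ leb (I n) (mI n) _ i).
  under eq_cvg do rewrite E.
  apply: cvg_EFin; first exact: nearW.
  apply/cvgr0Pnorm_lt => e e0; near=> n.
  rewrite (le_lt_trans (fD _ _))// /oneDsqrV ltr_pdivrMr ?oneDsqr_gt0//.
  have h : `|D| / e < n.+1%:R.
    near: n; exists (Num.truncn (`|D| / e)) => // n /= xn.
    by rewrite (lt_le_trans (truncnS_gt _))// ler_nat ltnS.
  rewrite ltr_pdivrMr// in h.
  have n1 : 1 <= n.+1%:R :> R by rewrite ler1n.
  have := ler_norm D; set N := n.+1%:R in h n1 *; nra.
have := cvg_unique _ h1 h2; rewrite /Rintegral => ->//.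
Unshelve. all: by end_near.
Qed.

End line_integrals.

(** * Goursat's theorem and the contour shift in one variable *)

Section goursat.
Context {R : realType}.
Local Notation leb := (@lebesgue_measure R).
Implicit Types (h : R[i] -> R[i]).

(** Complex differentiability with real moduli and without division. Nothing is asked of the
    derivative beyond its existence, which is why the rectangle theorem has to be proved by
    bisection. *)
Definition cderivable_at h w := exists a, forall e : R, 0 < e ->
  exists2 d, 0 < d & forall v, cabs v < d ->
    cabs (h (w + v) - h w - a * v) <= e * cabs v.

Definition entire1 h := forall w, cderivable_at h w.

Lemma cderivable_continuous h w : cderivable_at h w -> forall e, 0 < e ->
  exists2 d, 0 < d & forall v, cabs v < d -> cabs (h (w + v) - h w) < e.
Proof.
move=> [a ha] e e0; have [d d0 hd] := ha 1 ltr01.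
have a1 : 0 < 1 + cabs a by rewrite ltr_wpDr ?cabs_ge0.
exists (Num.min d (e / (1 + cabs a))); first by rewrite lt_min d0 divr_gt0.
move=> v; rewrite lt_min => /andP[vd ve].
rewrite -(subrK (a * v) (_ - _)) (le_lt_trans (le_cabsD _ _))//.
rewrite (le_lt_trans (lerD (hd _ vd) (lexx _)))// cabsM -mulrDl.
by rewrite mulrC -ltr_pdivlMr.
Qed.

Lemma entire1_continuous_path h (p : R -> R[i]) : entire1 h ->
  (forall x y, cabs (p x - p y) <= `|x - y|) -> ccontinuous1 (fun x => h (p x)).
Proof.
move=> hh pl.
have key (f : R[i] -> R) : (forall z w, `|f z - f w| <= cabs (z - w)) ->
    continuous (fun x => f (h (p x))).
  move=> fl x; apply/cvgrPdist_lt => e e0.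
  have [d d0 hd] := cderivable_continuous (hh (p x)) e0.
  apply/nbhs_normP; exists d => //= y xy.
  rewrite distrC (le_lt_trans (fl _ _))//.
  rewrite (_ : p y = p x + (p y - p x)); last by rewrite addrC subrK.
  by apply: hd; rewrite (le_lt_trans (pl _ _))// distrC.
split; apply: key => z w.
  by rewrite -ReN -ReD Re_le_cabs.
by rewrite -ImN -ImD Im_le_cabs.
Qed.

Lemma entire1_hline h y : entire1 h -> ccontinuous1 (fun x => h (x +i* y)).
Proof.
move=> hh; apply: entire1_continuous_path => // a b.
have -> : (a +i* y) - (b +i* y) = (a - b)%:C by apply: complexP => /=; ring.
by rewrite cabs_real.
Qed.

Lemma entire1_vline h x : entire1 h -> ccontinuous1 (fun y => h (x +i* y)).
Proof.
move=> hh; apply: entire1_continuous_path => // a b.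
have -> : (x +i* a) - (x +i* b) = 'i * (a - b)%:C by apply: complexP => /=; ring.
by rewrite cabsM cabs_real (cabsE 'i) /= expr0n add0r expr1n sqrtr1 mul1r.
Qed.

(** The counterclockwise integral along the boundary of [a, b] x [c, d], with opposite sides merged
    into one integrand. *)
Definition rectint h (a b c d : R) : R[i] :=
  segint a b (fun x => h (x +i* c) - h (x +i* d)) +
  'i * segint c d (fun y => h (b +i* y) - h (a +i* y)).

Let cH h c d : entire1 h -> ccontinuous1 (fun x => h (x +i* c) - h (x +i* d)).
Proof. by move=> hh; apply: ccontinuous1B; exact: entire1_hline. Qed.

Let cV h a b : entire1 h -> ccontinuous1 (fun y => h (b +i* y) - h (a +i* y)).
Proof. by move=> hh; apply: ccontinuous1B; exact: entire1_vline. Qed.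

Lemma rectint_splitx h a m b c d : entire1 h -> a <= m -> m <= b ->
  rectint h a b c d = rectint h a m c d + rectint h m b c d.
Proof.
move=> hh am mb; rewrite /rectint (segint_split am mb); last exact: cH.
have -> : segint c d (fun y => h (b +i* y) - h (a +i* y)) =
  segint c d (fun y => h (m +i* y) - h (a +i* y)) +
  segint c d (fun y => h (b +i* y) - h (m +i* y)).
  rewrite -segintD; [|exact: cV|exact: cV]; congr segint.
  by apply/funext => y; ring.
ring.
Qed.

Lemma rectint_splity h a b c m d : entire1 h -> c <= m -> m <= d ->
  rectint h a b c d = rectint h a b c m + rectint h a b m d.
Proof.
move=> hh cm md; rewrite /rectint (segint_split cm md); last exact: cV.
have -> : segint a b (fun x => h (x +i* c) - h (x +i* d)) =
  segint a b (fun x => h (x +i* c) - h (x +i* m)) +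
  segint a b (fun x => h (x +i* m) - h (x +i* d)).
  rewrite -segintD; [|exact: cH|exact: cH]; congr segint.
  by apply/funext => y; ring.
ring.
Qed.

Let half_choice (z u v : R[i]) : z = u + v ->
  cabs z <= 2 * cabs u \/ cabs z <= 2 * cabs v.
Proof.
move=> ->; have [uv|uv] := leP (cabs u) (cabs v); [right|left];
  have := le_cabsD u v; lra.
Qed.

Definition quarter (p q : R * R * R * R) :=
  let: (a, b, c, d) := p in let: (a', b', c', d') := q in
  [/\ a <= a', b' <= b, c <= c', d' <= d &
      b' - a' = (b - a) / 2 /\ d' - c' = (d - c) / 2].

Definition rectI h (p : R * R * R * R) :=
  let: (a, b, c, d) := p in rectint h a b c d.

Definition nonempty_rect (p : R * R * R * R) :=
  let: (a, b, c, d) := p in a <= b /\ c <= d.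

(** The rectangle is halved in x and then in y; keeping the better half loses a factor 2 each time,
    hence the 4. *)
Lemma bisect_rect h p : entire1 h -> nonempty_rect p ->
  exists q, [/\ quarter p q, nonempty_rect q &
    cabs (rectI h p) <= 4 * cabs (rectI h q)].
Proof.
case: p => [[[a b] c] d] hh [/= ab cd].
have am : a <= (a + b) / 2 by lra.
have mb : (a + b) / 2 <= b by lra.
have cm : c <= (c + d) / 2 by lra.
have md : (c + d) / 2 <= d by lra.
have [a' [b' [h1 h2 h3 h4 h5]]] : exists a' b',
    [/\ a <= a', b' <= b, a' <= b', b' - a' = (b - a) / 2 &
        cabs (rectint h a b c d) <= 2 * cabs (rectint h a' b' c d)].
  have [le|le] := half_choice (rectint_splitx c d hh am mb).
    by exists a, ((a + b) / 2); split => //; lra.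
  by exists ((a + b) / 2), b; split => //; lra.
have [c' [d' [k1 k2 k3 k4 k5]]] : exists c' d',
    [/\ c <= c', d' <= d, c' <= d', d' - c' = (d - c) / 2 &
        cabs (rectint h a' b' c d) <= 2 * cabs (rectint h a' b' c' d')].
  have [le|le] := half_choice (rectint_splity a' b' hh cm md).
    by exists c, ((c + d) / 2); split => //; lra.
  by exists ((c + d) / 2), d; split => //; lra.
exists (a', b', c', d'); split; [exact: And5 h1 h2 k1 k2 (conj h4 k4)|by []|].
have E4 : 4 = 2 * 2 :> R by rewrite -natrM.
by apply: (le_trans h5); rewrite E4 -mulrA; apply: ler_wpM2l => //; exact: k5.
Qed.

Lemma entire1_affine u v : entire1 (fun z => u + v * z).
Proof.
move=> w; exists v => e e0; exists 1 => // z _.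
rewrite (_ : _ - _ - _ = 0) ?cabs0 ?mulr_ge0 ?cabs_ge0 ?ltW//; ring.
Qed.

Lemma entire1B h1 h2 : entire1 h1 -> entire1 h2 ->
  entire1 (fun z => h1 z - h2 z).
Proof.
move=> e1 e2 w; have [a ha] := e1 w; have [b hb] := e2 w.
exists (a - b) => e e0; have e20 : 0 < e / 2 by rewrite divr_gt0.
have [d d0 hd] := ha _ e20; have [d' d'0 hd'] := hb _ e20.
exists (Num.min d d'); first by rewrite lt_min d0.
move=> v; rewrite lt_min => /andP[vd vd'].
rewrite (_ : _ - _ - _ = (h1 (w + v) - h1 w - a * v) -
   (h2 (w + v) - h2 w - b * v)); last by ring.
rewrite (le_trans (le_cabsD _ _))// cabsN.
have := hd _ vd; have := hd' _ vd'; lra.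
Qed.

Lemma rectint_affine u v a b c d : a <= b -> c <= d ->
  rectint (fun z => u + v * z) a b c d = 0.
Proof.
move=> ab cd; rewrite /rectint.
rewrite [X in segint a b X](_ : _ = fun _ => v * ('i * (c - d)%:C)); last first.
  by apply/funext => x; apply: complexP; rewrite !(ReM, ImM, ReD, ImD, ReN, ImN) /=; ring.
rewrite [X in segint c d X](_ : _ = fun _ => v * (b - a)%:C); last first.
  by apply/funext => x; apply: complexP; rewrite !(ReM, ImM, ReD, ImD, ReN, ImN) /=; ring.
rewrite !segint_cst// !rmorphB /=; ring.
Qed.

Lemma rectintB h1 h2 a b c d : entire1 h1 -> entire1 h2 ->
  rectint (fun z => h1 z - h2 z) a b c d =
  rectint h1 a b c d - rectint h2 a b c d.
Proof.
move=> e1 e2; rewrite /rectint.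
rewrite [X in segint a b X](_ : _ = fun x =>
   (h1 (x +i* c) - h1 (x +i* d)) - (h2 (x +i* c) - h2 (x +i* d))); last first.
  by apply/funext => x; ring.
rewrite [X in segint c d X](_ : _ = fun y =>
   (h1 (b +i* y) - h1 (a +i* y)) - (h2 (b +i* y) - h2 (a +i* y))); last first.
  by apply/funext => x; ring.
rewrite (segintB _ _ (cH c d e1) (cH c d e2)) (segintB _ _ (cV a b e1) (cV a b e2)).
ring.
Qed.

(** The constant 4 is 2 for the pair of opposite sides times 2 from [cabs_segint], which estimates
    real and imaginary parts separately. *)
Lemma cabs_rectint h a b c d B : entire1 h -> a <= b -> c <= d ->
  (forall x y, a <= x <= b -> c <= y <= d -> cabs (h (x +i* y)) <= B) ->
  cabs (rectint h a b c d) <= 4 * B * (b - a + (d - c)).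
Proof.
move=> hh ab cd hB; rewrite (le_trans (le_cabsD _ _))//.
rewrite cabsM (cabsE 'i) /= expr0n add0r expr1n sqrtr1 mul1r mulrDr.
apply: lerD.
  rewrite (@le_trans _ _ (2 * (2 * B) * (b - a)))//; last by rewrite mulrA -natrM.
  apply: cabs_segint => //; first exact: cH.
  move=> x xab; rewrite (le_trans (le_cabsD _ _))// cabsN mulr_natl mulr2n.
  by rewrite lerD// hB// lexx ?cd ?andbT.
rewrite (@le_trans _ _ (2 * (2 * B) * (d - c)))//; last by rewrite mulrA -natrM.
apply: cabs_segint => //; first exact: cV.
move=> x xab; rewrite (le_trans (le_cabsD _ _))// cabsN mulr_natl mulr2n.
by rewrite lerD// hB// lexx ?ab ?andbT.
Qed.

Theorem goursat h a b c d : entire1 h -> a <= b -> c <= d ->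
  rectint h a b c d = 0.
Proof.
move=> hh ab cd.
(* Choice needs a total function, so degenerate input gets a default rectangle; all iterates stay
   nonempty and never meet it. *)
have /choice[next nextP] : forall p, exists q, nonempty_rect p ->
    [/\ quarter p q, nonempty_rect q & cabs (rectI h p) <= 4 * cabs (rectI h q)].
  move=> p; have [np|np] := pselect (nonempty_rect p).
    by have [q hq] := bisect_rect hh np; exists q.
  by exists p => /np.
pose s n := iter n next (a, b, c, d).
have sne n : nonempty_rect (s n).
  by elim: n => [//|n /nextP[]].
have sq n : quarter (s n) (s n.+1) by have [] := nextP _ (sne n).
have sI n : cabs (rectint h a b c d) <= 4 ^+ n * cabs (rectI h (s n)).
  elim: n => [|n /le_trans]; first by rewrite mul1r.
  apply; have [_ _] := nextP _ (sne n).
  by rewrite exprSr -mulrA ler_pM2l// exprn_gt0.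
pose al n := (s n).1.1.1; pose be n := (s n).1.1.2.
pose ga n := (s n).1.2; pose de n := (s n).2.
have sE n : s n = (al n, be n, ga n, de n).
  by rewrite /al /be /ga /de; case: (s n) => [[[]]].
have ne n : al n <= be n /\ ga n <= de n by have := sne n; rewrite sE.
have st n : [/\ al n <= al n.+1, be n.+1 <= be n, ga n <= ga n.+1,
    de n.+1 <= de n & be n.+1 - al n.+1 = (be n - al n) / 2 /\
    de n.+1 - ga n.+1 = (de n - ga n) / 2].
  by have := sq n; rewrite !sE.
have mono m n : (m <= n)%N ->
    [/\ al m <= al n, be n <= be m, ga m <= ga n & de n <= de m].
  elim: n => [|n IH]; first by rewrite leqn0 => /eqP->.
  rewrite leq_eqVlt => /predU1P[->//|/IH[? ? ? ?]].
  by have [? ? ? ? _] := st n; split; lra.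
have len n : be n - al n = (b - a) / 2 ^+ n /\ de n - ga n = (d - c) / 2 ^+ n.
  elim: n => [|n [IH1 IH2]]; first by rewrite expr0 !divr1.
  have [_ _ _ _ [-> ->]] := st n; rewrite IH1 IH2 exprSr.
  by split; rewrite invfM mulrA.
(* The suprema of the left and lower endpoints give a point common to all the nested rectangles. *)
pose x := sup (range al); pose y := sup (range ga).
have xP n : al n <= x <= be n.
  apply/andP; split.
    apply: ub_le_sup; last by exists n.
    exists b => _ [m _ <-]; have [_ ? _ _] := mono _ _ (leq0n m).
    by have [? _] := ne m; exact: (le_trans _ (_ : be m <= b)).
  apply: ge_sup; first by exists (al 0), 0%N.
  move=> _ [m _ <-]; have [? _ _ _] := mono _ _ (leq_maxl m n).
  have [_ ? _ _] := mono _ _ (leq_maxr m n).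
  have [? _] := ne (maxn m n); lra.
have yP n : ga n <= y <= de n.
  apply/andP; split.
    apply: ub_le_sup; last by exists n.
    exists d => _ [m _ <-]; have [_ _ _ ?] := mono _ _ (leq0n m).
    by have [_ ?] := ne m; exact: (le_trans _ (_ : de m <= d)).
  apply: ge_sup; first by exists (ga 0), 0%N.
  move=> _ [m _ <-]; have [_ _ ? _] := mono _ _ (leq_maxl m n).
  have [_ _ _ ?] := mono _ _ (leq_maxr m n).
  have [_ ?] := ne (maxn m n); lra.
pose L := b - a + (d - c); have L0 : 0 <= L by rewrite addr_ge0// subr_ge0.
have [u hu] := hh (x +i* y).
suff main e : 0 < e -> cabs (rectint h a b c d) <= 4 * L ^+ 2 * e.
  apply/eqP; rewrite -cabs_eq0 eq_le cabs_ge0 andbT.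
  apply/ler_addgt0Pl => e e0; rewrite addr0.
  have L1 : 0 < 4 * L ^+ 2 + 1 by rewrite ltr_wpDl// mulr_ge0// sqr_ge0.
  have /main/le_trans := divr_gt0 e0 L1; apply.
  rewrite mulrA ler_pdivrMr// mulrC ler_pM2l//; lra.
move=> e0; have [r r0 hr] := hu _ e0.
have [n Ln] : exists n, L / 2 ^+ n < r.
  exists (Num.truncn (L / r)).+1.
  rewrite ltr_pdivrMr ?exprn_gt0// mulrC -ltr_pdivrMr//.
  rewrite (lt_le_trans (truncnS_gt _))// -natrX ler_nat.
  exact/ltnW/ltn_expl.
apply: le_trans (sI n) _; rewrite sE /rectI.
(* Removing the affine part of [h] at the common point does not change the boundary integral, and
   what remains is at most e times the distance to that point. *)
pose g z := h z - ((h (x +i* y) - u * (x +i* y)) + u * z).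
have ge : entire1 g by apply: entire1B => //; exact: entire1_affine.
have -> : rectint h (al n) (be n) (ga n) (de n) =
    rectint g (al n) (be n) (ga n) (de n).
  have [? ?] := ne n.
  rewrite rectintB//; last exact: entire1_affine.
  by rewrite rectint_affine// subr0.
have gB p q : al n <= p <= be n -> ga n <= q <= de n ->
    cabs (g (p +i* q)) <= e * (L / 2 ^+ n).
  move=> pn qn; pose v := (p - x) +i* (q - y).
  have vL : cabs v <= L / 2 ^+ n.
    rewrite (le_trans (cabs_le_ReIm _))//= mulrDl.
    have [<- <-] := len n; apply: lerD; rewrite ler_norml; apply/andP;
      have := xP n; have := yP n; move: pn qn;
      move=> /andP[? ?] /andP[? ?] /andP[? ?] /andP[? ?]; split; lra.
  have Ev : p +i* q = (x +i* y) + v by apply: complexP => /=; ring.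
  rewrite /g Ev (_ : _ - _ = h (x +i* y + v) - h (x +i* y) - u * v); last by ring.
  rewrite (le_trans (hr _ _)) ?(le_lt_trans vL)// ler_wpM2l// ltW//.
have [n1 n2] := ne n.
(* The 4^n lost by bisection is compensated by two factors 2^-n: one from the perimeter, one from
   the size of [g] on the n-th rectangle. *)
have -> : 4 * L ^+ 2 * e = 4 ^+ n * (4 * (e * (L / 2 ^+ n)) * (L / 2 ^+ n)).
  have -> : (4 : R) ^+ n = 2 ^+ n * 2 ^+ n.
    by rewrite -exprMn; congr (_ ^+ _); rewrite -natrM.
  by field; rewrite expf_neq0.
rewrite ler_pM2l ?exprn_gt0//.
apply: le_trans (cabs_rectint ge n1 n2 gB) _.
by have [-> ->] := len n; rewrite -mulrDl.
Qed.

(** Goursat on [-A, A] x [c, d] equates the truncated difference with the two vertical sides, which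
    are of order 1 / (1 + A^2). Real and imaginary parts are stated apart because they feed the real
    criterion [rint_eq0_coord]. *)
Theorem contour_shift h c d C : entire1 h -> c <= d ->
  (forall x y, c <= y <= d -> cabs (h (x +i* y)) <= C * oneDsqrV x) ->
  \int[leb]_x (complex.Re (h (x +i* d)) - complex.Re (h (x +i* c))) = 0 /\
  \int[leb]_x (complex.Im (h (x +i* d)) - complex.Im (h (x +i* c))) = 0.
Proof.
move=> hh cd hC; pose k x := h (x +i* d) - h (x +i* c).
have [k1 k2] : ccontinuous1 k by exact: cH.
have kC x : cabs (k x) <= 2 * C * oneDsqrV x.
  rewrite (le_trans (le_cabsD _ _))// cabsN -mulrA mulr_natl mulr2n.
  by rewrite lerD// hC// lexx ?cd ?andbT.
have kA A : 0 < A -> cabs (segint (- A) A k) <= 4 * C * (d - c) * oneDsqrV A.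
  move=> A0; have AA : - A <= A by lra.
  have := goursat hh AA cd; rewrite /rectint => /eqP; rewrite addr_eq0 => /eqP E.
  have -> : segint (- A) A k = 'i * segint c d (fun y => h (A +i* y) - h (- A +i* y)).
    rewrite -[RHS]opprK -E -segintN; last exact: cH.
    by congr segint; apply/funext => x; rewrite opprB.
  rewrite cabsM (cabsE 'i) /= expr0n add0r expr1n sqrtr1 mul1r.
  rewrite (@le_trans _ _ (2 * (2 * C * oneDsqrV A) * (d - c)))//; last first.
    by rewrite le_eqVlt; apply/orP; left; apply/eqP; ring.
  apply: cabs_segint => //; first exact: cV.
  move=> y ycd; rewrite (le_trans (le_cabsD _ _))// cabsN -mulrA mulr_natl mulr2n.
  rewrite lerD// (le_trans (hC _ _ ycd))// ?lexx//.
  by rewrite /oneDsqrV sqrrN.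
split.
- transitivity (\int[leb]_x complex.Re (k x)).
    by apply: eq_Rintegral => x _; rewrite /k ReD ReN.
  apply: (Rintegral_line_eq0 k1) => [x|A A0].
    exact: le_trans (Re_le_cabs _) (kC x).
  exact: le_trans (Re_le_cabs _) (kA A A0).
- transitivity (\int[leb]_x complex.Im (k x)).
    by apply: eq_Rintegral => x _; rewrite /k ImD ImN.
  apply: (Rintegral_line_eq0 k2) => [x|A A0].
    exact: le_trans (Im_le_cabs _) (kC x).
  exact: le_trans (Im_le_cabs _) (kA A A0).
Qed.

End goursat.

(** * Rules of complex differentiation *)

Section entire_calculus.
Context {R : realType}.
Implicit Types (f g h : R[i] -> R[i]).

Lemma cderivable_comp f g w : cderivable_at f (g w) -> cderivable_at g w ->
  cderivable_at (fun z => f (g z)) w.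
Proof.
move=> [a ha] [b hb]; exists (a * b) => e e0.
(* [M] bounds the growth of the increment of [g] once e1 <= 1; the two errors, from [f] and from
   [g], then add up to at most e1 (M + |a|) |v|, whence the choice e / (2M). *)
pose M := 1 + cabs a + cabs b.
have M1 : 1 <= M by rewrite /M -addrA lerDl addr_ge0 ?cabs_ge0.
have M0 : 0 < M by exact: lt_le_trans M1.
pose e1 := Num.min 1 (e / (2 * M)).
have e10 : 0 < e1 by rewrite lt_min ltr01 divr_gt0// mulr_gt0.
have e11 : e1 <= 1 by rewrite ge_min lexx.
have e1e : e1 * (2 * M) <= e.
  by rewrite -ler_pdivlMr ?mulr_gt0// ge_min lexx orbT.
have [d1 d10 h1] := ha _ e10; have [d2 d20 h2] := hb _ e10.
exists (Num.min d2 (d1 / M)); first by rewrite lt_min d20 divr_gt0.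
move=> v; rewrite lt_min => /andP[vd2 vd1].
pose u := g (w + v) - g w.
have uv : cabs u <= M * cabs v.
  rewrite -(subrK (b * v) u) (le_trans (le_cabsD _ _))//.
  rewrite (le_trans (lerD (h2 _ vd2) (lexx _)))// cabsM -mulrDl.
  by rewrite ler_wpM2r ?cabs_ge0// lerD2r (le_trans e11)// lerDl cabs_ge0.
have ud : cabs u < d1.
  by rewrite (le_lt_trans uv)// mulrC -ltr_pdivlMr.
have -> : f (g (w + v)) - f (g w) - a * b * v =
    (f (g w + u) - f (g w) - a * u) + a * (u - b * v).
  by rewrite (_ : g w + u = g (w + v)) /u ?[g w + _]addrC ?subrK//; ring.
rewrite (le_trans (le_cabsD _ _))//.
apply: (@le_trans _ _ (e1 * (M * cabs v) + cabs a * (e1 * cabs v))).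
  apply: lerD.
    by rewrite (le_trans (h1 _ ud))// ler_wpM2l// ltW.
  by rewrite cabsM ler_wpM2l ?cabs_ge0// h2.
have -> : e1 * (M * cabs v) + cabs a * (e1 * cabs v) =
  e1 * (M + cabs a) * cabs v by ring.
rewrite ler_wpM2r ?cabs_ge0// (le_trans _ e1e)// ler_wpM2l ?ltW//.
by have := cabs_ge0 b; rewrite /M; lra.
Qed.

Lemma cderivable_scale f w c : cderivable_at f w ->
  cderivable_at (fun z => c * f z) w.
Proof.
move=> df; apply: (cderivable_comp (f := fun z => c * z) _ df).
exists c => e e0; exists 1 => // v _.
by rewrite (_ : _ - _ - _ = 0) ?cabs0 ?mulr_ge0 ?cabs_ge0 ?ltW//; ring.
Qed.

Lemma cderivable_sqr w : cderivable_at (fun z : R[i] => z ^+ 2) w.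
Proof.
exists (2 * w) => e e0; exists e => // v vd.
rewrite (_ : _ - _ - _ = v * v) ?cabsM ?ler_wpM2r ?cabs_ge0 ?ltW//; ring.
Qed.

Lemma cderivable_cexp (w : R[i]) : cderivable_at cexp w.
Proof.
exists (cexp w) => e e0.
(* The constant of the second-order remainder when |v| <= 1, increased by 1. *)
pose M := 4 * expR (complex.Re w) * expR 1 + 1.
have M0 : 0 < M by rewrite ltr_wpDl// !mulr_ge0 ?expR_ge0.
exists (Num.min 1 (e / M)); first by rewrite lt_min ltr01 divr_gt0.
move=> v; rewrite lt_min => /andP[v1 ve].
have -> : cexp (w + v) - cexp w - cexp w * v = cexp w * (cexp v - 1 - v).
  by rewrite cexpD; ring.
rewrite cabsM cabs_cexp (le_trans (ler_wpM2l (expR_ge0 _) (cabs_cexpB1B_le v)))//.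
set E := expR `|_|; have -> : expR (complex.Re w) * (4 * cabs v ^+ 2 * E) =
  (4 * expR (complex.Re w) * E) * cabs v * cabs v by ring.
rewrite ler_wpM2r ?cabs_ge0//.
move: ve; rewrite ltr_pdivlMr// => /ltW/(le_trans _); apply.
rewrite mulrC ler_wpM2l ?cabs_ge0// /M (@le_trans _ _ (4 * expR (complex.Re w) * expR 1)) ?lerDl//.
rewrite ler_wpM2l ?mulr_ge0 ?expR_ge0// ler_expR.
by rewrite (le_trans (Re_le_cabs _))// ltW.
Qed.

End entire_calculus.

Section weights.
Context {R : realType}.

(** Keeps the decay along the j-th coordinate line only, uniformly in the other coordinates; this is
    what the one-variable theorems require. *)
Lemma weight_setc n (x : 'rV[R]_n) j s : weight (setc x j s) <= oneDsqrV s.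
Proof.
rewrite /weight (bigD1 j)//= setcE eqxx ler_piMr ?oneDsqrV_ge0//.
suff /andP[] : 0 <= \prod_(i < n | i != j) oneDsqrV (setc x j s 0 i) <= 1 by [].
apply: (big_ind (fun y => 0 <= y <= 1)); first by rewrite ler01 lexx.
  move=> a b /andP[a0 a1] /andP[b0 b1].
  by rewrite mulr_ge0//= mulr_ile1.
by move=> i _; rewrite oneDsqrV_ge0 oneDsqrV_le1.
Qed.

End weights.

(** * Contour shift in R^n, coordinate by coordinate *)

Section contour_shift_nD.
Context {R : realType} {n : nat}.
Local Notation leb := (@lebesgue_measure R).
Implicit Types (F : 'rV[R[i]]_n -> R[i]) (x eta : 'rV[R]_n).

Definition cmk x eta : 'rV[R[i]]_n := \row_i (x 0 i +i* eta 0 i).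

(** The bound must be uniform over bounded imaginary parts, since a shift sweeps all the
    intermediate heights. Holomorphy is only asked in each variable separately. *)
Definition shiftable F :=
  [/\ forall z j, entire1 (fun s => F (setc z j s)),
      forall eta, ctmeasurable (fun x => F (cmk x eta)) &
      forall B, exists C, forall x eta, (forall i, `|eta 0 i| <= B) ->
        cabs (F (cmk x eta)) <= C * weight x].

Lemma cmk0 x : cmk x 0 = ofR x.
Proof. by apply/rowP => i; rewrite !mxE. Qed.

Lemma cmk_setc x eta j s t :
  cmk (setc x j s) (setc eta j t) = setc (cmk x eta) j (s +i* t).
Proof. by apply/rowP => i; rewrite !mxE; case: eqP. Qed.

Lemma shiftable_dominated F eta : shiftable F ->
  cdominated (fun x => F (cmk x eta)).
Proof.
move=> [_ mF bF]; split => //.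
have [C h] := bF (\sum_i `|eta 0 i|); exists C => x; apply: h => i.
by rewrite (bigD1 i)//= lerDl sumr_ge0.
Qed.

Lemma shift_coord_le F eta j s t : shiftable F -> s <= t ->
  cintegral (fun x => F (cmk x (setc eta j t))) =
  cintegral (fun x => F (cmk x (setc eta j s))).
Proof.
move=> sF st; have [eF _ bF] := sF.
have ds := shiftable_dominated (setc eta j s) sF.
have dt := shiftable_dominated (setc eta j t) sF.
(* This height covers every value of coordinate j between s and t and all the other coordinates of
   eta. *)
have [C hC] := bF (`|s| + `|t| + \sum_i `|eta 0 i|).
have C0 : 0 <= C.
  have := hC 0 0 (fun i => _); rewrite -(pmulr_lge0 C (weight_gt0 (0 : 'rV[R]_n))).
  move=> h; apply: le_trans (cabs_ge0 _) (h _) => i; rewrite mxE normr0.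
  by rewrite !addr_ge0// sumr_ge0.
have shift1 x : let h w := F (setc (cmk x eta) j w) in
  \int[leb]_u (complex.Re (h (u +i* t)) - complex.Re (h (u +i* s))) = 0 /\
  \int[leb]_u (complex.Im (h (u +i* t)) - complex.Im (h (u +i* s))) = 0.
  move=> h; apply: (@contour_shift _ h s t C) => //; first exact: eF.
  move=> u y /andP[sy yt]; rewrite /h -cmk_setc (le_trans (hC _ _ _))//.
    move=> i; rewrite setcE; case: eqP => _.
      apply: (@le_trans _ _ (`|s| + `|t|)); last by rewrite lerDl sumr_ge0.
      have [y0|y0] := leP 0 y.
        by rewrite ger0_norm// (le_trans yt)// (le_trans (ler_norm _))// lerDr.
      by rewrite ltr0_norm// -normrN -[`|t|]normrN (le_trans (_ : - y <= - s))
         ?lerN2// (le_trans (ler_norm _))// lerDl.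
    rewrite (bigD1 i)//=; set S := \sum_(_ < _ | _) _.
    have S0 : 0 <= S by exact: sumr_ge0.
    by have := normr_ge0 s; have := normr_ge0 t; lra.
  by rewrite ler_wpM2l// weight_setc.
apply/eqP; rewrite -subr_eq0 -cintegralB//; apply/eqP/complexP.
- rewrite /= -[LHS]/(rint (fun x =>
    complex.Re (F (cmk x (setc eta j t)) - F (cmk x (setc eta j s))))).
  apply: (rint_eq0_coord (j := j)).
    exact: (cdominated_Re (cdominatedB dt ds)).
  move=> x; rewrite -[RHS](shift1 x).1; apply: eq_Rintegral => u _.
  by rewrite !cmk_setc ReD ReN.
- rewrite /= -[LHS]/(rint (fun x =>
    complex.Im (F (cmk x (setc eta j t)) - F (cmk x (setc eta j s))))).
  apply: (rint_eq0_coord (j := j)).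
    exact: (cdominated_Im (cdominatedB dt ds)).
  move=> x; rewrite -[RHS](shift1 x).2; apply: eq_Rintegral => u _.
  by rewrite !cmk_setc ImD ImN.
Qed.

Lemma shift_coord F eta j s t : shiftable F ->
  cintegral (fun x => F (cmk x (setc eta j t))) =
  cintegral (fun x => F (cmk x (setc eta j s))).
Proof.
move=> sF; have [st|/ltW ts] := leP s t; first exact: shift_coord_le.
exact/esym/shift_coord_le.
Qed.

Theorem contour_shift_rV F eta : shiftable F ->
  cintegral (fun x => F (cmk x eta)) = cintegral (fun x => F (ofR x)).
Proof.
(* [r s] keeps the coordinates of eta listed in [s] and is 0 elsewhere; each new entry of the list
   raises one coordinate from its current value to that of eta. *)
move=> sF; pose r (s : seq 'I_n) : 'rV[R]_n := \row_i (if i \in s then eta 0 i else 0).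
have H s : cintegral (fun x => F (cmk x (r s))) = cintegral (fun x => F (ofR x)).
  elim: s => [|j s IH].
    rewrite (_ : r [::] = 0); last by apply/rowP => i; rewrite !mxE.
    by apply: eq_cintegral => x; rewrite cmk0.
  rewrite -IH (_ : r (j :: s) = setc (r s) j (eta 0 j)); last first.
    by apply/rowP => i; rewrite !mxE in_cons; case: eqP => [->|].
  by rewrite (shift_coord _ _ (r s 0 j))// setc_id.
rewrite -(H (enum 'I_n)); congr cintegral; apply/funext => x; congr (F (cmk x _)).
by apply/rowP => i; rewrite mxE mem_enum.
Qed.

End contour_shift_nD.

(** * Exchange of integrals on R^m x R^n *)

Section fubini_swap.
Context {R : realType} {m n : nat}.
Local Notation T := (measurableTypeR R).
Local Notation mu := (@lebesgue_tuple R).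
Implicit Types (f : 'rV[R]_m -> 'rV[R]_n -> R) (g : 'rV[R]_m -> 'rV[R]_n -> R[i]).

Definition measurable2 f := measurable_fun setT
  (fun p : m.-tuple T * n.-tuple T => f (row_of_tuple p.1) (row_of_tuple p.2) : T).

Definition cmeasurable2 g := measurable2 (fun x y => complex.Re (g x y)) /\
  measurable2 (fun x y => complex.Im (g x y)).

Lemma measurable2_fst (f : 'rV[R]_m -> R) : tmeasurable f ->
  measurable2 (fun x _ => f x).
Proof.
move=> mf; apply: (@measurableT_comp _ _ _ _ _ _ (fun t => f (row_of_tuple t)) _ fst) => //.
Qed.

Lemma measurable2_snd (f : 'rV[R]_n -> R) : tmeasurable f ->
  measurable2 (fun _ y => f y).
Proof.
move=> mf; apply: (@measurableT_comp _ _ _ _ _ _ (fun t => f (row_of_tuple t)) _ snd) => //.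
Qed.

Lemma measurable2D f1 f2 : measurable2 f1 -> measurable2 f2 ->
  measurable2 (fun x y => f1 x y + f2 x y).
Proof. exact: measurable_funD. Qed.

Lemma measurable2B f1 f2 : measurable2 f1 -> measurable2 f2 ->
  measurable2 (fun x y => f1 x y - f2 x y).
Proof. exact: measurable_funB. Qed.

Lemma measurable2M f1 f2 : measurable2 f1 -> measurable2 f2 ->
  measurable2 (fun x y => f1 x y * f2 x y).
Proof. exact: measurable_funM. Qed.

Lemma measurable2_sum I (s : seq I) (F : I -> 'rV[R]_m -> 'rV[R]_n -> R) :
  (forall i, measurable2 (F i)) ->
  measurable2 (fun x y => \sum_(i <- s) F i x y).
Proof.
move=> h; elim: s => [|i s IH]; rewrite /measurable2.
  by under eq_fun do rewrite big_nil; exact: measurable_cst.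
by under eq_fun do rewrite big_cons; exact: measurable2D (h i) IH.
Qed.

Lemma measurable2_comp f (k : R -> R) : measurable_fun setT (k : T -> T) ->
  measurable2 f -> measurable2 (fun x y => k (f x y)).
Proof. by move=> mk mf; exact: (measurableT_comp mk mf). Qed.

Lemma cmeasurable2_fst (g : 'rV[R]_m -> R[i]) : ctmeasurable g ->
  cmeasurable2 (fun x _ => g x).
Proof.
by move=> [g1 g2]; split; [exact: (measurable2_fst g1)|exact: (measurable2_fst g2)].
Qed.

Lemma cmeasurable2_snd (g : 'rV[R]_n -> R[i]) : ctmeasurable g ->
  cmeasurable2 (fun _ y => g y).
Proof.
by move=> [g1 g2]; split; [exact: (measurable2_snd g1)|exact: (measurable2_snd g2)].
Qed.

Lemma cmeasurable2_cis f : measurable2 f -> cmeasurable2 (fun x y => cis (f x y)).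
Proof.
move=> mf; split.
  apply: (measurable2_comp _ mf); apply: continuous_measurable_fun.
  exact: continuous_cos.
apply: (measurable2_comp _ mf); apply: continuous_measurable_fun.
exact: continuous_sin.
Qed.

Lemma cmeasurable2M g1 g2 : cmeasurable2 g1 -> cmeasurable2 g2 ->
  cmeasurable2 (fun x y => g1 x y * g2 x y).
Proof.
move=> [g1r g1i] [g2r g2i]; split; rewrite /measurable2.
  under eq_fun do rewrite ReM.
  exact: (measurable2B (measurable2M g1r g2r) (measurable2M g1i g2i)).
under eq_fun do rewrite ImM.
exact: (measurable2D (measurable2M g1r g2i) (measurable2M g1i g2r)).
Qed.

Lemma rint_swap f C : measurable2 f ->
  (forall x y, `|f x y| <= C * (weight x * weight y)) ->
  rint (fun x => rint (fun y => f x y)) = rint (fun y => rint (fun x => f x y)).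
Proof.
move=> mf fC.
have dx x : dominated (fun y => f x y).
  split; last by exists (C * weight x) => y; rewrite -mulrA.
  have [t ->] := row_of_tuple_surj x.
  exact: (measurableT_comp mf (measurable_pair1 t)).
have dy y : dominated (fun x => f x y).
  split; last by exists (C * weight y) => x; rewrite -mulrA (mulrC (weight y)).
  have [t ->] := row_of_tuple_surj y.
  exact: (measurableT_comp mf (measurable_pair2 t)).
pose g (p : m.-tuple T * n.-tuple T) :=
  (f (row_of_tuple p.1) (row_of_tuple p.2))%:E.
have mg : measurable_fun setT g by exact/measurable_EFinP.
have mw k c : tmeasurable (fun x : 'rV[R]_k => c * weight x).
  exact: tmeasurableM (@tmeasurable_cst R k c) (@tmeasurable_weight R k).
(* Integrability on the product is read off the iterated integral of |f|: the inner one is at most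
   |C| [wtot n] times the weight of x. *)
have ig : (mu m \x mu n)%E.-integrable setT g.
  apply/(@integrable12ltyP _ _ _ _ _ (mu m) (mu n) g mg).
  apply: (@le_lt_trans _ _ (\int[mu m]_x
      (`|C| * wtot n * weight (row_of_tuple x))%:E)%E).
    apply: ge0_le_integral => //.
    - by move=> x _; exact: integral_ge0.
    - apply: (@measurable_fun_fubini_tonelli_F _ _ _ _ _ (mu n) (abse \o g)) => //.
        exact: measurableT_comp.
      by move=> p; exact: abse_ge0.
    - by have /measurable_EFinP := mw m (`|C| * wtot n); exact.
    - move=> x _.
      apply: (@le_trans _ _ (\int[mu n]_y
        (`|C| * weight (row_of_tuple x) * weight (row_of_tuple y))%:E)%E).
        apply: ge0_le_integral => //.
        + apply: measurableT_comp => //.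
          exact: (measurableT_comp mg (measurable_pair1 x)).
        + by have /measurable_EFinP := mw n (`|C| * weight (row_of_tuple x)); exact.
        + move=> y _; rewrite /g /= lee_fin (le_trans (fC _ _))// mulrA.
          rewrite ler_wpM2r ?weight_ge0// ler_wpM2r ?weight_ge0//.
          exact: ler_norm.
      under eq_integral do rewrite EFinM.
      rewrite integralZl//; last exact: integrable_weight.
      rewrite -[X in (_ * X)%E]fineK; last first.
        by apply: integrable_fin_num => //; exact: integrable_weight.
      by rewrite -EFinM lee_fin mulrAC.
  have dw : dominated (fun x : 'rV[R]_m => `|C| * wtot n * weight x).
    by apply: dominatedZ; exact: dominated_weight.
  have /integrableP[_] := dominated_integrable dw.
  by under eq_integral => t _ do
    rewrite /= ger0_norm ?mulr_ge0 ?weight_ge0 ?wtot_ge0//.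
have := Fubini ig.
rewrite /rint /Rintegral => h.
under eq_integral => x _.
  rewrite fineK; last by apply: integrable_fin_num => //; exact: (dominated_integrable (dx _)).
  over.
under [in RHS]eq_integral => x _.
  rewrite fineK; last by apply: integrable_fin_num => //; exact: (dominated_integrable (dy _)).
  over.
by rewrite -h.
Qed.

Lemma cintegral_swap g C : cmeasurable2 g ->
  (forall x y, cabs (g x y) <= C * (weight x * weight y)) ->
  cintegral (fun x => cintegral (fun y => g x y)) =
  cintegral (fun y => cintegral (fun x => g x y)).
Proof.
move=> [m1 m2] gC; apply: complexP => /=.
  apply: (rint_swap (C := C) m1) => x y; exact: le_trans (Re_le_cabs _) (gC x y).
apply: (rint_swap (C := C) m2) => x y; exact: le_trans (Im_le_cabs _) (gC x y).
Qed.

End fubini_swap.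

(** * Euclidean dot product *)

Section dot_product.
Context {R : realType} {n : nat}.
Implicit Types (x y : 'rV[R]_n).

Lemma dotrC x y : dotr x y = dotr y x.
Proof. by apply: eq_bigr => i _; rewrite mulrC. Qed.

Lemma dotrZl a x y : dotr (a *: x) y = a * dotr x y.
Proof. by rewrite /dotr mulr_sumr; apply: eq_bigr => i _; rewrite mxE mulrA. Qed.

Lemma dotrZr a x y : dotr x (a *: y) = a * dotr x y.
Proof. by rewrite dotrC dotrZl dotrC. Qed.

Lemma dotrDl x x' y : dotr (x + x') y = dotr x y + dotr x' y.
Proof. by rewrite /dotr -big_split; apply: eq_bigr => i _; rewrite mxE mulrDl. Qed.

Lemma dotrNl x y : dotr (- x) y = - dotr x y.
Proof. by rewrite -scaleN1r dotrZl mulN1r. Qed.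

Lemma dotrBl x x' y : dotr (x - x') y = dotr x y - dotr x' y.
Proof. by rewrite dotrDl dotrNl. Qed.

Lemma dotrDr x y y' : dotr x (y + y') = dotr x y + dotr x y'.
Proof. by rewrite dotrC dotrDl !(dotrC x). Qed.

Lemma dotr_ge0 x : 0 <= dotr x x.
Proof. by apply: sumr_ge0 => i _; rewrite -expr2 sqr_ge0. Qed.

Lemma sqr_coord_le x i : x 0 i ^+ 2 <= dotr x x.
Proof.
rewrite /dotr (bigD1 i)//= expr2 lerDl.
by apply: sumr_ge0 => j _; rewrite -expr2 sqr_ge0.
Qed.

Lemma tmeasurable_dotr y : tmeasurable (fun x => dotr x y).
Proof.
apply: tmeasurable_sum => i; apply: tmeasurableM; first exact: tmeasurable_coord.
exact: tmeasurable_cst.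
Qed.

Lemma tmeasurable_dotrr : tmeasurable (fun x => dotr x x).
Proof.
by apply: tmeasurable_sum => i; apply: tmeasurableM; exact: tmeasurable_coord.
Qed.

Lemma measurable2_dotr : measurable2 (fun x y : 'rV[R]_n => dotr x y).
Proof.
apply: measurable2_sum => i; apply: measurable2M.
  exact: (measurable2_fst (tmeasurable_coord i)).
exact: (measurable2_snd (tmeasurable_coord i)).
Qed.

End dot_product.

(** * Gaussians and their Fourier transforms *)

Section gaussian_line.
Context {R : realType}.
Local Notation T := (measurableTypeR R).
Local Notation leb := (@lebesgue_measure R).

Definition gau (c y : R) := expR (- (c * y ^+ 2)).

Lemma gau_ge0 c y : 0 <= gau c y. Proof. exact: expR_ge0. Qed.

Lemma measurable_gau c m : measurable_fun setT (fun y : T => gau c (y - m) : T).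
Proof.
apply: (@measurableT_comp _ _ _ _ _ _ (@expR R)) => //.
apply: measurableT_comp => //; apply: measurable_funM => //.
by apply: measurable_funX; apply: measurable_funB.
Qed.

(** With z = y - m, the first factor comes from exp(c z^2) >= 1 + c z^2 and the second from 1 + y^2
    <= 2 (1 + m^2) (1 + z^2). *)
Lemma gau_le c m y : 0 < c ->
  gau c (y - m) <= (1 + c^-1) * (2 * (1 + m ^+ 2)) * oneDsqrV y.
Proof.
move=> c0; rewrite /gau expRN /oneDsqrV ler_pdivlMr ?oneDsqr_gt0//.
rewrite mulrC ler_pdivrMr ?expR_gt0//.
set z := y - m; have -> : y = z + m by rewrite /z subrK.
apply: (@le_trans _ _ (2 * (1 + m ^+ 2) * (1 + z ^+ 2))).
  by have := sqr_ge0 (z - m); have := sqr_ge0 (z * m); nra.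
rewrite [leRHS]mulrAC mulrC ler_wpM2r//.
  by rewrite mulr_ge0// ltW// oneDsqr_gt0.
apply: (@le_trans _ _ ((1 + c^-1) * (1 + c * z ^+ 2))).
  have := sqr_ge0 z; have : 0 < c^-1 by rewrite invr_gt0.
  have -> : (1 + c^-1) * (1 + c * z ^+ 2) = 1 + c * z ^+ 2 + c^-1 + z ^+ 2.
    by field; rewrite gt_eqF.
  move=> ? ?.
  have : 0 <= c * z ^+ 2 by rewrite mulr_ge0 ?sqr_ge0 ?ltW.
  lra.
apply: ler_wpM2l; first by rewrite addr_ge0// invr_ge0 ltW.
exact: expR_ge1Dx.
Qed.

Lemma integral_gau c m : 0 < c ->
  (\int[leb]_y (gau c (y - m))%:E = (Num.sqrt (pi / c))%:E)%E.
Proof.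
(* The Gaussian is a multiple of the normal density of mean m and variance 1 / (2c). *)
move=> c0; pose s := (Num.sqrt (c *+ 2))^-1.
have c20 : 0 < c *+ 2 by rewrite pmulrn_lgt0.
have s0 : s != 0 by rewrite gt_eqF// invr_gt0 sqrtr_gt0.
have s2 : s ^+ 2 *+ 2 = c^-1.
  rewrite exprVn sqr_sqrtr ?ltW// -mulr_natr -[c *+ 2]mulr_natr.
  by field; rewrite gt_eqF.
have p0 : 0 < Num.sqrt (pi / c) by rewrite sqrtr_gt0 divr_gt0 ?pi_gt0.
have E y : gau c (y - m) = Num.sqrt (pi / c) * normal_pdf m s y.
  rewrite normal_pdfE// /normal_peak /normal_fun -mulrnAl s2 [c^-1 * pi]mulrC.
  rewrite mulrA mulfV ?gt_eqF// mul1r invrK /gau; congr expR.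
  by rewrite mulNr mulrC.
under eq_integral do rewrite E EFinM.
rewrite ge0_integralZl//=; first last.
- by move=> x _; rewrite lee_fin normal_pdf_ge0.
- by apply/measurable_EFinP; exact: measurable_normal_pdf.
by rewrite integral_normal_pdf mule1.
Qed.

End gaussian_line.

Section gaussian.
Context {R : realType} {n : nat}.
Local Notation T := (measurableTypeR R).
Local Notation leb := (@lebesgue_measure R).
Implicit Types (c : R) (x y m : 'rV[R]_n).

Definition gauss c x := expR (- (c * dotr x x)).
Definition gconst c : R := Num.sqrt (pi / c).

Lemma gauss_prod c x : gauss c x = \prod_i gau c (x 0 i).
Proof.
rewrite /gauss /dotr mulr_sumr -sumrN expR_sum.
by apply: eq_bigr => i _; rewrite -expr2.
Qed.

Lemma gauss_ge0 c x : 0 <= gauss c x. Proof. exact: expR_ge0. Qed.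

Lemma tmeasurable_gauss c m : tmeasurable (fun x => gauss c (x - m)).
Proof.
rewrite (_ : (fun _ => _) = fun x => \prod_i gau c (x 0 i - m 0 i)); last first.
  by apply/funext => x; rewrite gauss_prod; apply: eq_bigr => i _; rewrite !mxE.
apply: tmeasurable_prod => i.
by apply: (tmeasurable_comp (measurable_gau c (m 0 i))); exact: tmeasurable_coord.
Qed.

Lemma dominated_gauss c m : 0 < c -> dominated (fun x => gauss c (x - m)).
Proof.
move=> c0; split; first exact: tmeasurable_gauss.
exists (\prod_i ((1 + c^-1) * (2 * (1 + m 0 i ^+ 2)))) => x.
rewrite ger0_norm ?gauss_ge0// gauss_prod /weight -big_split /=.
by apply: ler_prod => i _; rewrite gau_ge0 !mxE gau_le.
Qed.

Lemma rint_gauss c m : 0 < c -> rint (fun x => gauss c (x - m)) = gconst c ^+ n.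
Proof.
move=> c0; rewrite /rint /Rintegral.
rewrite -[RHS]/(fine (gconst c ^+ n)%:E) -[in RHS](card_ord n) -prodr_const.
congr fine; rewrite -(@integral_prod_coord R n (fun i (y : R) => gau c (y - m 0 i))).
- by apply: eq_integral => t _; rewrite gauss_prod; congr EFin;
    apply: eq_bigr => i _; rewrite !mxE.
- by move=> i; exact: measurable_gau.
- by move=> i y; exact: gau_ge0.
- by move=> i; exact: integral_gau.
Qed.

Lemma gconstM c c' : 0 < c -> 0 < c' ->
  gconst c * gconst c' = Num.sqrt (pi ^+ 2 / (c * c')).
Proof.
move=> c0 c'0; rewrite /gconst -sqrtrM ?divr_ge0 ?pi_ge0 ?ltW//.
by congr Num.sqrt; field; rewrite !gt_eqF.
Qed.

(** The entire extension of [gauss]: squares of coordinates, not squared moduli. *)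
Definition cgauss c (z : 'rV[R[i]]_n) := cexp (- (c%:C * \sum_i z 0 i ^+ 2)).

Lemma cgauss_cmk c x y : cgauss c (cmk x y) =
  (expR (c * dotr y y) * gauss c x)%:C * cis (- (2 * c * dotr x y)).
Proof.
have E : \sum_i (cmk x y) 0 i ^+ 2 =
    (dotr x x - dotr y y) +i* (2 * dotr x y).
  rewrite /dotr mulr_sumr -sumrB.
  elim/big_rec3 : _ => [//|i a b s _ ->].
  by apply: complexP; rewrite mxE expr2 ?ReD ?ImD ?ReM ?ImM /=; ring.
rewrite /cgauss /cexp E ReN ImN ReM ImM /= -expRD !mul0r subr0 addr0.
by congr ((expR _)%:C * cis _); ring.
Qed.

Lemma shiftable_cgauss c : 0 < c -> shiftable (cgauss c).
Proof.
move=> c0; split.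
- move=> z j w; rewrite /cgauss.
  pose S := \sum_(i < n | i != j) z 0 i ^+ 2.
  have -> : (fun s => cexp (- (c%:C * \sum_i setc z j s 0 i ^+ 2))) =
      (fun s => (fun u => cexp (- (c%:C * S)) * cexp (- c%:C * u)) (s ^+ 2)).
    apply/funext => s; rewrite -cexpD; congr cexp.
    rewrite (bigD1 j)//= setcE eqxx (eq_bigr (fun i => z 0 i ^+ 2)).
      by rewrite -/S; ring.
    by move=> i ij; rewrite setcE (negbTE ij).
  apply: (@cderivable_comp _ (fun u => cexp (- (c%:C * S)) * cexp (- c%:C * u))).
    apply: cderivable_scale.
    apply: (@cderivable_comp _ cexp (fun u => - c%:C * u)).
      exact: cderivable_cexp.
    exists (- c%:C) => e e0; exists 1 => // v _.
    by rewrite (_ : _ - _ - _ = 0) ?cabs0 ?mulr_ge0 ?cabs_ge0 ?ltW//; ring.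
  exact: cderivable_sqr.
- move=> y; rewrite /ctmeasurable; under eq_fun do rewrite cgauss_cmk.
  under [X in _ /\ tmeasurable X]eq_fun do rewrite cgauss_cmk.
  apply: ctmeasurableM.
    apply: ctmeasurable_real; apply: tmeasurableM; first exact: tmeasurable_cst.
    have := tmeasurable_gauss c 0.
    by under eq_fun do rewrite subr0.
  apply: ctmeasurable_cis.
  rewrite (_ : (fun _ => _) = (fun x => - (2 * c) * dotr x y)).
    apply: tmeasurableM; [exact: tmeasurable_cst|exact: tmeasurable_dotr].
  by apply/funext => x; ring.
- move=> B; have [_ [C hC]] := dominated_gauss 0 c0.
  exists (expR (c * (n%:R * B ^+ 2)) * C) => x y yB.
  rewrite cgauss_cmk cabsM cabs_cis mulr1 cabs_real normrM.
  rewrite ger0_norm ?expR_ge0// -mulrA; apply: ler_pM; rewrite ?expR_ge0//.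
    rewrite ler_expR (ler_wpM2l (ltW c0))// /dotr.
    apply: (@le_trans _ _ (\sum_(i < n) B ^+ 2)).
      apply: ler_sum => i _; rewrite -expr2 -real_normK ?num_real//.
      by rewrite lerXn2r ?nnegrE// (le_trans (normr_ge0 _) (yB i)).
    by rewrite sumr_const card_ord mulr_natl.
  by have := hC x; rewrite subr0.
Qed.

Lemma cintegral_real (f : 'rV[R]_n -> R) :
  cintegral (fun x => (f x)%:C) = (rint f)%:C.
Proof.
apply: complexP => //=; rewrite [LHS](@eq_Rintegral _ _ _ _ _ (fun=> 0))//.
by rewrite Rintegral_cst// mul0r.
Qed.

(** Completing the square by a contour shift: on R^n + i eta with eta = -(pi / c) m, the extended
    Gaussian is the character times the Gaussian, up to the constant exp(pi^2 |m|^2 / c). The shift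
    makes its integral equal to the plain Gaussian integral. *)
Lemma fourier_gauss c m : 0 < c ->
  cintegral (fun y => cis (2 * pi * dotr m y) * (gauss c y)%:C) =
  (gconst c ^+ n * gauss (pi ^+ 2 / c) m)%:C.
Proof.
move=> c0; have cn0 : c != 0 by rewrite gt_eqF.
pose eta := - (pi / c) *: m.
have := contour_shift_rV eta (shiftable_cgauss c0).
have dg : dominated (fun y : 'rV[R]_n => gauss c y).
  rewrite (_ : (fun _ => _) = fun x => gauss c (x - 0)).
    exact: dominated_gauss.
  by apply/funext => x; rewrite subr0.
have dc : cdominated (fun y => cis (2 * pi * dotr m y) * (gauss c y)%:C).
  apply: (@cdominatedM _ _ _ _ 1).
  - apply: ctmeasurable_cis; apply: tmeasurableM; first exact: tmeasurable_cst.
    rewrite (_ : dotr m = fun y => dotr y m); first exact: tmeasurable_dotr.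
    by apply/funext => y; rewrite dotrC.
  - by move=> x; rewrite cabs_cis.
  - split; first by apply: ctmeasurable_real; case: dg.
    have [_ [C h]] := dg; exists C => x; rewrite cabs_real; exact: h.
rewrite (@eq_cintegral _ _ _ (fun y => (expR (pi ^+ 2 / c * dotr m m))%:C *
   (cis (2 * pi * dotr m y) * (gauss c y)%:C))); last first.
  move=> y; rewrite cgauss_cmk /eta dotrZl !dotrZr rmorphM /=.
  rewrite (_ : c * _ = pi ^+ 2 / c * dotr m m); last by field.
  rewrite (_ : - _ = 2 * pi * dotr m y); last by rewrite (dotrC m); field.
  ring.
rewrite cintegralZ// [in RHS](@eq_cintegral _ _ _ (fun y => (gauss c y)%:C)); last first.
  move=> y; rewrite -cmk0 cgauss_cmk.
  rewrite (_ : dotr 0 0 = 0); last by rewrite -(scale0r 0) dotrZl mul0r.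
  rewrite (_ : dotr y 0 = 0); last by rewrite -(scale0r 0) dotrZr mul0r.
  by rewrite !mulr0 expR0 mul1r oppr0 cis0 mulr1.
rewrite cintegral_real (_ : rint _ = gconst c ^+ n); last first.
  rewrite -(rint_gauss 0 c0); congr rint.
  by apply/funext => x; rewrite subr0.
move=> E; rewrite rmorphM /= -E mulrAC -rmorphM /=.
by rewrite /gauss -expRD subrr expR0 mul1r.
Qed.

End gaussian.

(** * Fourier inversion by Gaussian regularization *)

Section inversion.
Context {R : realType} {n : nat}.
Implicit Types (f : 'rV[R]_n -> R[i]) (x y : 'rV[R]_n).

Definition fourier f y := cintegral (fun x => cis (- (2 * pi * dotr x y)) * f x).

Lemma ctmeasurable_character (a : R) x :
  ctmeasurable (fun y : 'rV[R]_n => cis (a * dotr x y)).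
Proof.
apply: ctmeasurable_cis; apply: tmeasurableM; first exact: tmeasurable_cst.
rewrite (_ : dotr x = fun y => dotr y x); first exact: tmeasurable_dotr.
by apply/funext => y; rewrite dotrC.
Qed.

Lemma cdominated_character (a : R) x f : cdominated f ->
  cdominated (fun y => cis (a * dotr x y) * f y).
Proof.
apply: (@cdominatedM _ _ _ _ 1); first exact: ctmeasurable_character.
by move=> y; rewrite cabs_cis.
Qed.

Lemma gaussN c x : gauss c (- x) = gauss c x.
Proof. by rewrite /gauss dotrNl dotrC dotrNl opprK. Qed.

(** Half of the exponent pays for the quadratic factor, because c q / 2 <= exp(c q / 2). It provides
    the second-moment bound for the kernel by integrating a wider Gaussian. *)
Lemma dotr_gauss_le c x : 0 < c ->
  dotr x x * gauss c x <= 2 / c * gauss (c / 2) x.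
Proof.
move=> c0; set q := dotr x x; have q0 : 0 <= q by exact: dotr_ge0.
rewrite /gauss -/q -(@ler_pM2l _ (expR (c * q))) ?expR_gt0//.
rewrite mulrCA -expRD subrr expR0 mulr1 mulrCA -expRD.
rewrite (_ : _ + _ = c / 2 * q); last by field.
rewrite -ler_pdivrMl ?divr_gt0//.
apply: le_trans (expR_ge1Dx _).
rewrite (_ : (2 / c)^-1 * q = c / 2 * q); last by field; rewrite gt_eqF.
by rewrite lerDr.
Qed.

Lemma gauss_1B_le c x : 0 <= c -> `|1 - gauss c x| <= c * dotr x x.
Proof.
move=> c0; have t0 : 0 <= c * dotr x x by rewrite mulr_ge0 ?dotr_ge0.
rewrite ger0_norm; last by rewrite subr_ge0 /gauss -expR0 ler_expR oppr_le0.
by have := expR_ge1Dx (- (c * dotr x x)); rewrite -/(gauss c x); lra.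
Qed.

Section smoothing.
Variables (f : 'rV[R]_n -> R[i]) (x0 : 'rV[R]_n) (c : R).
Hypotheses (c0 : 0 < c) (df : cdominated f).
Let c' := pi ^+ 2 / c.
Let c'0 : 0 < c'. Proof. by rewrite divr_gt0// exprn_gt0// pi_gt0. Qed.
(** The Fourier transform of the regularizing Gaussian, recentred at [x0]: a kernel of mass 1 that
    concentrates at [x0] as c tends to 0. *)
Let K x := gconst c ^+ n * gauss c' (x - x0).

Let dK : dominated K.
Proof. exact/dominatedZ/dominated_gauss. Qed.

Let K0 x : 0 <= K x.
Proof. by rewrite mulr_ge0 ?gauss_ge0// exprn_ge0// sqrtr_ge0. Qed.

(** The Gaussian makes the double integral absolutely convergent, so the order can be exchanged; the
    inner integral is then the transform of a Gaussian at x0 - x. *)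
Lemma fourier_smoothing : cdominated (fourier f) ->
  cintegral (fun y => (gauss c y)%:C * (cis (2 * pi * dotr x0 y) * fourier f y)) =
  cintegral (fun x => (K x)%:C * f x).
Proof.
move=> _; have [C C0 hC] := cdominated_bound df.
have [_ [D hD]] := dominated_gauss (0 : 'rV[R]_n) c0.
have {}hD y : `|gauss c y| <= D * weight y by have := hD y; rewrite subr0.
pose g x y := ((gauss c y)%:C * cis (2 * pi * dotr x0 y)) *
   (cis (- (2 * pi) * dotr x y) * f x).
have mg : ctmeasurable (fun y : 'rV[R]_n => (gauss c y)%:C).
  apply: ctmeasurable_real; rewrite (_ : gauss c = fun y => gauss c (y - 0)).
    exact: tmeasurable_gauss.
  by apply/funext => y; rewrite subr0.
have dg : cdominated (fun y : 'rV[R]_n => (gauss c y)%:C).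
  by split => //; exists D => y; rewrite cabs_real.
transitivity (cintegral (fun y => cintegral (fun x => g x y))).
  apply: eq_cintegral => y; rewrite mulrA -cintegralZ.
    by apply: eq_cintegral => x; rewrite /g mulNr.
  have := cdominated_character (- (2 * pi)) y df.
  by under eq_fun do rewrite mulNr dotrC.
rewrite -(@cintegral_swap _ _ _ g (D * C)).
- apply: eq_cintegral => x.
  transitivity (f x * cintegral (fun y => cis (2 * pi * dotr (x0 - x) y) * (gauss c y)%:C)).
    rewrite -cintegralZ; last exact: cdominated_character.
    apply: eq_cintegral => y; rewrite /g dotrBl mulrBr cisD mulNr; ring.
  by rewrite fourier_gauss// mulrC /K -gaussN opprB.
- apply: cmeasurable2M.
    apply: cmeasurable2_snd; apply: ctmeasurableM => //.
    exact: ctmeasurable_character.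
  apply: cmeasurable2M; last by apply: cmeasurable2_fst; case: df.
  apply: cmeasurable2_cis; apply: measurable2M; last exact: measurable2_dotr.
  exact: (measurable2_fst (@tmeasurable_cst R n (- (2 * pi)))).
- move=> x y; rewrite /g !cabsM !cabs_cis mulr1 mul1r cabs_real.
  rewrite (_ : _ * (_ * _) = (D * weight y) * (C * weight x)); last by ring.
  by rewrite ler_pM ?cabs_ge0.
Qed.

Lemma rint_kernel : rint K = 1.
Proof.
rewrite rintZl; last exact: dominated_gauss.
rewrite rint_gauss// -exprMn gconstM// /c'.
rewrite (_ : _ / _ = 1) ?sqrtr1 ?expr1n//.
by move: (pi_gt0 R); move: (pi : R) => p p0; field; rewrite !gt_eqF.
Qed.

(** The outer 2 comes from [cabs_cintegral_rint]. The second moment costs 2 / c', and sqrt 2 per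
    dimension is the gain of mass when c' is halved. *)
Lemma kernel_approx d D : 0 < d -> 0 <= D ->
  (forall x, cabs (f x - f x0) <= d + D * dotr (x - x0) (x - x0)) ->
  cabs (cintegral (fun x => (K x)%:C * f x) - f x0) <=
  2 * (d + D * (2 / c' * Num.sqrt 2 ^+ n)).
Proof.
move=> d0 D0 h; have [_ [C hC]] := dK.
have dKc : cdominated (fun x => (K x)%:C).
  by split; [apply: ctmeasurable_real; case: dK|exists C => x; rewrite cabs_real].
have dKf : cdominated (fun x => (K x)%:C * f x).
  have KB x : cabs (K x)%:C <= gconst c ^+ n.
    rewrite cabs_real ger0_norm// ler_piMr ?exprn_ge0 ?sqrtr_ge0//.
    rewrite /gauss -expR0 ler_expR oppr_le0 mulr_ge0 ?dotr_ge0//.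
    exact: ltW.
  by apply: cdominatedM KB df; case: dKc.
rewrite -[X in _ - X]mul1r -[1 in X in _ - X](_ : cintegral (fun x => (K x)%:C) = 1); last first.
  by rewrite cintegral_real rint_kernel.
rewrite [X in _ - X]mulrC -cintegralZ// -cintegralB//; last exact: cdominatedZ.
rewrite (@eq_cintegral _ _ _ (fun x => (K x)%:C * (f x - f x0))); last first.
  by move=> x; ring.
pose G x := d * K x + D * (gconst c ^+ n * (2 / c' * gauss (c' / 2) (x - x0))).
have c'20 : 0 < c' / 2 by rewrite divr_gt0.
have dG2 : dominated (fun x => gauss (c' / 2) (x - x0)) by exact: dominated_gauss.
have dG : dominated G.
  apply: dominatedD; first exact: dominatedZ.
  by do 3 apply: dominatedZ.
have -> : d + D * (2 / c' * Num.sqrt 2 ^+ n) = rint G.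
  rewrite rintD; [|exact: dominatedZ|by do 3 apply: dominatedZ].
  rewrite rintZl// rint_kernel mulr1 !rintZl//; [|by do ?apply: dominatedZ..].
  rewrite rint_gauss// [gconst c ^+ n * _]mulrCA -exprMn gconstM//.
  congr (_ + _ * (_ * Num.sqrt _ ^+ _)); rewrite /c'.
  by move: (pi_gt0 R); move: (pi : R) => p p0; field; rewrite !gt_eqF.
apply: cabs_cintegral_rint => //.
  have := cdominatedB dKf (cdominatedZ (f x0) dKc).
  by congr cdominated; apply/funext => x; ring.
move=> x; rewrite cabsM cabs_real ger0_norm//.
rewrite (le_trans (ler_wpM2l (K0 x) (h x)))// mulrDr /G [d * _]mulrC lerD2l.
rewrite [leLHS]mulrCA; apply: ler_wpM2l => //.
rewrite /K -(mulrA (gconst c ^+ n)); apply: ler_wpM2l.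
  by rewrite exprn_ge0// sqrtr_ge0.
by rewrite mulrC dotr_gauss_le.
Qed.

End smoothing.

(** Integrability of |y|^2 times the transform makes removing the regularization an error of order
    c. The last hypothesis is a modulus of continuity at [x0] with quadratic growth, in the shape
    that the second moment of the kernel can absorb. *)
Theorem fourier_inversion f x0 : cdominated f -> cdominated (fourier f) ->
  cdominated (fun y => (dotr y y)%:C * fourier f y) ->
  (forall d, 0 < d -> exists2 D, 0 <= D & forall x,
    cabs (f x - f x0) <= d + D * dotr (x - x0) (x - x0)) ->
  cintegral (fun y => cis (2 * pi * dotr x0 y) * fourier f y) = f x0.
Proof.
move=> df dF dF2 cf; have [C C0 hC] := cdominated_bound dF2.
set A := cintegral _.
pose E := 2 * C * wtot n.
have E0 : 0 <= E by rewrite !mulr_ge0 ?wtot_ge0.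
have step1 c : 0 < c -> cabs (A -
    cintegral (fun y => (gauss c y)%:C * (cis (2 * pi * dotr x0 y) * fourier f y))) <= c * E.
  move=> c0; have dchi := cdominated_character (2 * pi) x0 dF.
  have mg : ctmeasurable (fun y : 'rV[R]_n => (gauss c y)%:C).
    apply: ctmeasurable_real; rewrite (_ : gauss c = fun y => gauss c (y - 0)).
      exact: tmeasurable_gauss.
    by apply/funext => y; rewrite subr0.
  have dg : cdominated (fun y => (gauss c y)%:C * (cis (2 * pi * dotr x0 y) * fourier f y)).
    apply: (cdominatedM mg (B := 1)) dchi => y.
    rewrite cabs_real ger0_norm ?gauss_ge0// /gauss -expR0 ler_expR oppr_le0.
    by rewrite mulr_ge0 ?dotr_ge0// ltW.
  rewrite /A -cintegralB// /E (_ : c * _ = 2 * (c * C) * wtot n); last by ring.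
  apply: cabs_cintegral_le; first by case: (cdominatedB dchi dg).
  move=> y; set u := cis _.
  rewrite (_ : _ - _ = (1 - gauss c y)%:C * (u * fourier f y)); last first.
    by rewrite rmorphB /= rmorph1; ring.
  rewrite !cabsM cabs_cis mul1r cabs_real.
  have := hC y; rewrite cabsM cabs_real (ger0_norm (dotr_ge0 _)) => hy.
  rewrite (le_trans (ler_wpM2r (cabs_ge0 _) (gauss_1B_le y (ltW c0))))//.
  by rewrite -!mulrA ler_wpM2l// ltW.
apply/eqP; rewrite -subr_eq0 -cabs_eq0 eq_le cabs_ge0 andbT.
apply/ler_addgt0Pl => e e0; rewrite addr0.
have d0 : 0 < e / 4 by rewrite divr_gt0.
have [D D0 hD] := cf _ d0.
(* [M] collects the coefficients of c in the two errors; the remaining term 2 (e / 4) is e / 2, so c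
   (1 + M) = e / 2 is the right choice. *)
pose M := E + 4 * D / pi ^+ 2 * Num.sqrt 2 ^+ n.
have M0 : 0 <= M.
  rewrite addr_ge0// mulr_ge0 ?exprn_ge0 ?sqrtr_ge0//.
  by rewrite mulr_ge0 ?invr_ge0 ?exprn_ge0 ?pi_ge0// mulr_ge0.
pose c := e / (2 * (1 + M)).
have c0 : 0 < c by rewrite divr_gt0// mulr_gt0// ltr_wpDr.
have := step1 c c0; rewrite fourier_smoothing//.
have := kernel_approx c0 df d0 D0 hD; set B := cintegral _ => h1 h2.
rewrite -(subrK B A) -addrA (le_trans (le_cabsD _ _))//.
rewrite (le_trans (lerD h2 h1))//.
have -> : c * E + 2 * (e / 4 + D * (2 / (pi ^+ 2 / c) * Num.sqrt 2 ^+ n)) =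
    e / 2 + c * M.
  rewrite /M; clear h1 h2; clearbody c; move: (pi_gt0 R); move: (pi : R) => p p0.
  by field; rewrite !gt_eqF.
have : c * (1 + M) = e / 2.
  by rewrite /c; clearbody M; field; rewrite gt_eqF// ltr_wpDr.
lra.
Qed.

End inversion.

(** * Euclidean norm, continuity and compact supports *)

Section euclidean_norm.
Context {R : realType} {n : nat}.
Implicit Types (x y : 'rV[R]_n).

Lemma enorm_ge0 x : 0 <= enorm x. Proof. exact: sqrtr_ge0. Qed.

Lemma sqr_enorm x : enorm x ^+ 2 = dotr x x.
Proof. by rewrite sqr_sqrtr// dotr_ge0. Qed.

Lemma coord_le_enorm x i : `|x 0 i| <= enorm x.
Proof. by rewrite -sqrtr_sqr ler_wsqrtr// sqr_coord_le. Qed.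

Lemma dotr_sqr_le x y : dotr x y ^+ 2 <= dotr x x * dotr y y.
Proof.
set q := dotr y y; have [q0|q0] := eqVneq q 0.
  have -> : dotr x y = 0.
    rewrite /dotr big1// => i _; have := sqr_coord_le y i; rewrite -/q q0.
    rewrite le_eqVlt ltNge sqr_ge0 orbF sqrf_eq0 => /eqP ->.
    by rewrite mulr0.
  by rewrite expr0n q0 mulr0.
have {}q0 : 0 < q by rewrite lt0r q0 dotr_ge0.
(* The projection residue of x along y, multiplied by q so that no division occurs. *)
have := dotr_ge0 (q *: x - dotr x y *: y).
rewrite dotrBl !(dotrC _ (_ - _)) !dotrBl !dotrZl !dotrZr -/q (dotrC y x).
set p := dotr x y; set a := dotr x x.
rewrite (_ : _ - _ = q * (a * q - p ^+ 2)); last by ring.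
by rewrite pmulr_rge0// subr_ge0.
Qed.

Lemma dotr_le_enorm x y : dotr x y <= enorm x * enorm y.
Proof.
rewrite (le_trans (ler_norm _))// -sqrtr_sqr /enorm -sqrtrM ?dotr_ge0//.
by rewrite ler_wsqrtr// dotr_sqr_le.
Qed.

End euclidean_norm.

Section continuity_rV.
Context {R : realType} {n : nat}.
Implicit Types (f : 'rV[R]_n -> R).

Let continuous_add f g : continuous f -> continuous g ->
  continuous (fun x => f x + g x).
Proof. by move=> cf cg x; exact: (continuousD (cf x) (cg x)). Qed.

Let continuous_sub f g : continuous f -> continuous g ->
  continuous (fun x => f x - g x).
Proof. by move=> cf cg x; exact: (continuousB (cf x) (cg x)). Qed.

Let continuous_mul f g : continuous f -> continuous g ->
  continuous (fun x => f x * g x).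
Proof. by move=> cf cg x; exact: (continuousM (cf x) (cg x)). Qed.

Lemma continuous_sum_rV I (s : seq I) (F : I -> 'rV[R]_n -> R) :
  (forall i, continuous (F i)) -> continuous (fun x => \sum_(i <- s) F i x).
Proof.
move=> cF; elim: s => [|i s IH].
  rewrite (_ : (fun _ => _) = fun=> 0); first exact: cst_continuous.
  by apply/funext => x; rewrite big_nil.
rewrite (_ : (fun _ => _) = fun x => F i x + \sum_(j <- s) F j x).
  exact: continuous_add (cF i) IH.
by apply/funext => x; rewrite big_cons.
Qed.

Lemma continuous_dotr y : continuous (fun x : 'rV[R]_n => dotr x y).
Proof.
apply: continuous_sum_rV => i; apply: continuous_mul.
  exact: coord_continuous.
exact: cst_continuous.
Qed.

Lemma continuous_dotrr : continuous (fun x : 'rV[R]_n => dotr x x).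
Proof.
by apply: continuous_sum_rV => i; apply: continuous_mul; exact: coord_continuous.
Qed.

Lemma continuous_enorm : continuous (@enorm R n).
Proof.
move=> x; apply: (@continuous_comp _ _ _ (fun x => dotr x x) Num.sqrt).
  exact: continuous_dotrr.
exact: sqrt_continuous.
Qed.

Implicit Types (g h : 'rV[R]_n -> R[i]).

Definition ccontinuous g := continuous (fun x => complex.Re (g x)) /\
  continuous (fun x => complex.Im (g x)).

Lemma ccontinuousM g h : ccontinuous g -> ccontinuous h ->
  ccontinuous (fun x => g x * h x).
Proof.
move=> [g1 g2] [h1 h2]; split.
  rewrite (_ : (fun _ => _) = fun x => complex.Re (g x) * complex.Re (h x) -
      complex.Im (g x) * complex.Im (h x)).
    exact: continuous_sub (continuous_mul g1 h1) (continuous_mul g2 h2).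
  by apply/funext => x; rewrite ReM.
rewrite (_ : (fun _ => _) = fun x => complex.Re (g x) * complex.Im (h x) +
    complex.Im (g x) * complex.Re (h x)).
  exact: continuous_add (continuous_mul g1 h2) (continuous_mul g2 h1).
by apply/funext => x; rewrite ImM.
Qed.

Lemma ccontinuousD g h : ccontinuous g -> ccontinuous h ->
  ccontinuous (fun x => g x + h x).
Proof.
move=> [g1 g2] [h1 h2]; split.
  rewrite (_ : (fun _ => _) = fun x => complex.Re (g x) + complex.Re (h x)).
    exact: continuous_add.
  by apply/funext => x; rewrite ReD.
rewrite (_ : (fun _ => _) = fun x => complex.Im (g x) + complex.Im (h x)).
  exact: continuous_add.
by apply/funext => x; rewrite ImD.
Qed.

Lemma ccontinuous_cst c : ccontinuous (fun _ => c).
Proof. by split; exact: cst_continuous. Qed.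

Lemma ccontinuous_cexp g : ccontinuous g -> ccontinuous (fun x => cexp (g x)).
Proof.
move=> [g1 g2]; apply: ccontinuousM; split=> x /=.
- apply: (@continuous_comp _ _ _ (fun x => complex.Re (g x)) expR); first exact: g1.
  exact: continuous_expR.
- exact: (@cst_continuous _ _ (0 : R)).
- apply: (@continuous_comp _ _ _ (fun x => complex.Im (g x)) cos); first exact: g2.
  exact: continuous_cos.
- apply: (@continuous_comp _ _ _ (fun x => complex.Im (g x)) sin); first exact: g2.
  exact: continuous_sin.
Qed.

Lemma ccontinuous_measurable g : ccontinuous g -> ctmeasurable g.
Proof. by move=> [g1 g2]; exact: ctmeasurable_continuous. Qed.

Lemma continuous_support_bounded r f : continuous f ->
  (forall x, r < enorm x -> f x = 0) -> exists2 M, 0 <= M & forall x, `|f x| <= M.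
Proof.
move=> cf fr.
(* The cube is compact as a product of segments, and it contains the Euclidean ball of radius r. *)
pose A := [set v : 'rV[R]_n | forall i, `[- r, r]%classic (v 0 i)].
have cA : compact A.
  by apply: (@rV_compact R n (fun=> `[- r, r]%classic)) => i; exact: segment_compact.
have cfA : compact (f @` A).
  by apply: continuous_compact => //; exact: continuous_subspaceT.
have [M [_ hM]] := compact_bounded cfA.
exists (`|M| + 1) => // x.
have [xA|xA] := pselect (A x).
  have MM : M < `|M| + 1 by rewrite ltr_pwDr// ler_norm.
  by apply: (hM _ MM); exists x.
rewrite fr ?normr0//; rewrite ltNge; apply/negP => xr; apply: xA => i /=.
by rewrite in_itv /= -ler_norml (le_trans (coord_le_enorm _ _)).
Qed.

(** Turns a uniform bound on the ball into domination by the weight: each factor (1 + r^2) / (1 +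
    x_i^2) is at least 1. *)
Lemma weight_support r (x : 'rV[R]_n) : enorm x <= r -> 1 <= (1 + r ^+ 2) ^+ n * weight x.
Proof.
move=> xr; have r0 : 0 <= r := le_trans (enorm_ge0 x) xr.
have -> : (1 + r ^+ 2) ^+ n * weight x =
    \prod_i ((1 + r ^+ 2) * oneDsqrV (x 0 i)).
  by rewrite big_split /= prodr_const card_ord.
apply: (big_ind (fun y => 1 <= y)) => // [a b|i _]; first exact: mulr_ege1.
rewrite ler_pdivlMr ?oneDsqr_gt0// mul1r lerD2l -real_normK ?num_real//.
by rewrite lerXn2r ?nnegrE// (le_trans (coord_le_enorm _ _)).
Qed.

End continuity_rV.

(** * Partial derivatives and vanishing of their integrals *)

Section directional.
Context {R : realType} {n : nat}.
Implicit Types (f : 'rV[R]_n -> R) (x v : 'rV[R]_n).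

(** The increment bound is the form in which kernel estimates arrive; dividing by h leaves an error
    of order |h|. *)
Lemma is_derive_quad f x v d M :
  (forall h : R, `|h| <= 1 -> `|f (x + h *: v) - f x - h * d| <= M * h ^+ 2) ->
  is_derive x v f d.
Proof.
move=> fM; have M1 : 0 < `|M| + 1 by rewrite ltr_pwDr.
have H : (fun h => h^-1 *: ((f \o shift x) (h *: v) - f x)) @ 0^' --> d.
  apply/cvgrPdist_le => e e0; near=> h.
  have hn0 : h != 0 by near: h; exact: nbhs_dnbhs_neq.
  have h1 : `|h| <= 1 by near: h; exact: dnbhs0_le.
  have he : `|h| <= e / (`|M| + 1) by near: h; apply: dnbhs0_le; exact: divr_gt0.
  rewrite /= [_ *: v + x]addrC distrC.
  rewrite -(ler_pM2l (_ : 0 < `|h|)) ?normr_gt0// -normrM mulrBr.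
  rewrite /GRing.scale /= mulrA mulfV// mul1r.
  apply: le_trans (fM h h1) _.
  rewrite -real_normK ?num_real// expr2 mulrCA ler_wpM2l//.
  rewrite ler_pdivlMr// in he; apply: le_trans he.
  by rewrite mulrC ler_wpM2l// (le_trans (ler_norm _))// lerDl.
split; first exact: (cvgP d H).
by apply: cvg_lim.
Unshelve. all: by end_near.
Qed.

Lemma setc_shift x j (s h : R) :
  h *: delta_mx 0 j + setc x j s = setc x j (h + s).
Proof.
apply/rowP => i; rewrite !mxE eqxx /=; case: eqP => _.
  by rewrite mulr1.
by rewrite mulr0 add0r.
Qed.

Lemma is_derive_slice f x j s : derivable f (setc x j s) (delta_mx 0 j) ->
  is_derive s 1 (fun s => f (setc x j s)) ('D_(delta_mx 0 j) f (setc x j s)).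
Proof.
have E : (fun h : R => h^-1 *: (((fun s => f (setc x j s)) \o shift s) (h *: 1) - f (setc x j s))) =
    (fun h => h^-1 *: ((f \o shift (setc x j s)) (h *: delta_mx 0 j) - f (setc x j s))).
  by apply/funext => h /=; rewrite setc_shift /GRing.scale /= mulr1.
by move=> df; split; rewrite /derivable /derive E.
Qed.

Lemma continuous_setc x j : continuous (fun s : R => setc x j s).
Proof.
move=> s; apply/cvg_ballP => e e0; near=> t.
apply/rV_ballP => // i; rewrite !setcE; case: eqP => _.
  by near: t; exact: cvgr_dist_lt.
by rewrite subrr normr0.
Unshelve. all: by end_near.
Qed.

End directional.

Section line_derivative.
Context {R : realType}.
Local Notation leb := (@lebesgue_measure R).

(** On [-A, A] the integral of the derivative is a difference of two boundary values, each at most C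
    / (1 + A^2); hence the constant 2 C for the truncation criterion. *)
Lemma Rintegral_derive_eq0 (f df : R -> R) C :
  (forall s : R, is_derive s (1 : R) f (df s)) -> continuous df ->
  (forall s, `|f s| <= C * oneDsqrV s) -> (forall s, `|df s| <= C * oneDsqrV s) ->
  \int[leb]_s df s = 0.
Proof.
move=> fdf cdf fC dfC; apply: (Rintegral_line_eq0 (D := 2 * C) cdf dfC).
have cf : continuous f.
  by move=> s; apply/differentiable_continuous/derivable1_diffP; have [] := fdf s.
move=> A A0; have AA : - A < A by lra.
rewrite /Rintegral (@continuous_FTC2 _ df f)//=.
- have -> : 2 * C * oneDsqrV A = C * oneDsqrV A + C * oneDsqrV (- A).
    by rewrite /oneDsqrV sqrrN; ring.
  by rewrite (le_trans (ler_normB _ _))// lerD.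
- exact: continuous_subspaceT.
- split.
  + by move=> s _; have [] := fdf s.
  + by apply: cvg_at_right_filter; exact: cf.
  + by apply: cvg_at_left_filter; exact: cf.
- by move=> s _; rewrite derive1E; have [] := fdf s.
Qed.

End line_derivative.

Section complex_partial.
Context {R : realType} {n : nat}.
Implicit Types (g h : 'rV[R]_n -> R[i]) (j : 'I_n).

Definition is_cpartial j g dg := forall x,
  is_derive x (delta_mx 0 j) (fun x => complex.Re (g x)) (complex.Re (dg x)) /\
  is_derive x (delta_mx 0 j) (fun x => complex.Im (g x)) (complex.Im (dg x)).

Lemma is_cpartialM j g dg h dh : is_cpartial j g dg -> is_cpartial j h dh ->
  is_cpartial j (fun x => g x * h x) (fun x => g x * dh x + dg x * h x).
Proof.
move=> Hg Hh x; have [g1 g2] := Hg x; have [h1 h2] := Hh x; split.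
  rewrite (_ : (fun _ => _) = (fun x => complex.Re (g x)) * (fun x => complex.Re (h x)) -
    (fun x => complex.Im (g x)) * (fun x => complex.Im (h x))); last first.
    by apply/funext => y; rewrite ReM.
  apply: (is_derive_eq (is_deriveB (is_deriveM g1 h1) (is_deriveM g2 h2))).
  by rewrite ReD !ReM /GRing.scale /=; ring.
rewrite (_ : (fun _ => _) = (fun x => complex.Re (g x)) * (fun x => complex.Im (h x)) +
  (fun x => complex.Im (g x)) * (fun x => complex.Re (h x))); last first.
  by apply/funext => y; rewrite ImM.
apply: (is_derive_eq (is_deriveD (is_deriveM g1 h2) (is_deriveM g2 h1))).
by rewrite ImD !ImM /GRing.scale /=; ring.
Qed.

Lemma is_cpartial_quad j g dg M :
  (forall x (s : R), `|s| <= 1 ->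
    cabs (g (x + s *: delta_mx 0 j) - g x - s%:C * dg x) <= M x * s ^+ 2) ->
  is_cpartial j g dg.
Proof.
move=> H x; split; apply: (is_derive_quad (M := M x)) => s s1;
  apply: le_trans (H x s s1).
  rewrite (_ : _ - _ = complex.Re (g (x + s *: delta_mx 0 j) - g x - s%:C * dg x)).
    exact: Re_le_cabs.
  by rewrite !(ReD, ReN) ReM /= mul0r subr0.
rewrite (_ : _ - _ = complex.Im (g (x + s *: delta_mx 0 j) - g x - s%:C * dg x)).
  exact: Im_le_cabs.
by rewrite !(ImD, ImN) ImM /= mul0r addr0.
Qed.

Lemma rint_partial_eq0 (f df : 'rV[R]_n -> R) j :
  (forall x, is_derive x (delta_mx 0 j) f (df x)) -> continuous df ->
  dominated f -> dominated df -> rint df = 0.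
Proof.
move=> fdf cdf [_ [C hC]] Ddf; have [_ [D hD]] := Ddf.
apply: (rint_eq0_coord (j := j)) => // x.
apply: (@Rintegral_derive_eq0 _ (fun s => f (setc x j s)) _ (`|C| + `|D|)).
- move=> s; have [d1 d2] := fdf (setc x j s).
  by rewrite -d2; exact: is_derive_slice.
- move=> s; apply: (@continuous_comp _ _ _ (fun s => setc x j s) df).
    exact: continuous_setc.
  exact: cdf.
- move=> s; rewrite (le_trans (hC _))// (@le_trans _ _ (`|C| * weight (setc x j s)))//.
    by rewrite ler_wpM2r ?weight_ge0// ler_norm.
  by rewrite ler_pM ?weight_ge0 ?weight_setc// lerDl.
- move=> s; rewrite (le_trans (hD _))// (@le_trans _ _ (`|D| * weight (setc x j s)))//.
    by rewrite ler_wpM2r ?weight_ge0// ler_norm.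
  by rewrite ler_pM ?weight_ge0 ?weight_setc// lerDr.
Qed.

(** Applied to a product, this is integration by parts without boundary terms. *)
Lemma cintegral_partial_eq0 j g dg : is_cpartial j g dg -> ccontinuous dg ->
  cdominated g -> cdominated dg -> cintegral dg = 0.
Proof.
move=> gdg [c1 c2] Dg Ddg; apply: complexP.
  apply: (rint_partial_eq0 (fun x => (gdg x).1) c1); exact: cdominated_Re.
apply: (rint_partial_eq0 (fun x => (gdg x).2) c2); exact: cdominated_Im.
Qed.

End complex_partial.

(** * The Fourier kernel with complex frequency *)

Section kernel.
Context {R : realType} {n : nat}.
Implicit Types (x y : 'rV[R]_n) (z h : 'rV[R[i]]_n).

(** Bilinear, without conjugation, so that the kernel is entire in z. *)
Definition dotc x z : R[i] := \sum_i (x 0 i)%:C * z 0 i.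

Definition tpi : R[i] := (2 * pi)%:C * 'i.

(** The exponential e^{-2 pi i x.z}; for real z it is the character of the Fourier transform. *)
Definition chr z x : R[i] := cexp (- (tpi * dotc x z)).

Lemma cabs_tpi : cabs tpi = 2 * pi.
Proof.
rewrite cabsM cabs_real (cabsE 'i) /= expr0n add0r expr1n sqrtr1 mulr1.
by rewrite ger0_norm// mulr_ge0// pi_ge0.
Qed.

Lemma dotcDr x z h : dotc x (z + h) = dotc x z + dotc x h.
Proof. by rewrite /dotc -big_split; apply: eq_bigr => i _; rewrite mxE mulrDr. Qed.

Lemma dotcDl x y z : dotc (x + y) z = dotc x z + dotc y z.
Proof.
rewrite /dotc -big_split; apply: eq_bigr => i _.
by rewrite mxE rmorphD mulrDl.
Qed.

Lemma dotcZl (s : R) x z : dotc (s *: x) z = s%:C * dotc x z.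
Proof.
rewrite /dotc mulr_sumr; apply: eq_bigr => i _.
by rewrite mxE rmorphM mulrA.
Qed.

Lemma dotc_delta j z : dotc (delta_mx 0 j) z = z 0 j.
Proof.
rewrite /dotc (bigD1 j)//= mxE !eqxx rmorph1 mul1r big1 ?addr0// => i ij.
by rewrite mxE eqxx (negbTE ij) rmorph0 mul0r.
Qed.

Lemma dotc_cmk x a b : dotc x (cmk a b) = dotr x a +i* dotr x b.
Proof.
rewrite /dotc /dotr; elim/big_rec3 : _ => [//|i p q s _ ->].
by apply: complexP; rewrite mxE ?ReD ?ImD ?ReM ?ImM /=; ring.
Qed.

Definition ReC z : 'rV[R]_n := map_mx (@complex.Re R) z.

Lemma cmk_ReIm z : z = cmk (ReC z) (ImC z).
Proof. by apply/rowP => i; rewrite !mxE; case: (z 0 i). Qed.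

Lemma cabs_chr z x : cabs (chr z x) = expR (2 * pi * dotr x (ImC z)).
Proof.
rewrite cabs_cexp; congr expR; rewrite [z in dotc x z]cmk_ReIm dotc_cmk.
by rewrite ReN !ReM ImM /=; ring.
Qed.

Lemma chr_ofR y x : chr (ofR y) x = cis (- (2 * pi * dotr x y)).
Proof.
rewrite /chr -cmk0 dotc_cmk.
have -> : dotr x 0 = 0 by rewrite -(scale0r 0) dotrZr mul0r.
by rewrite /cexp ReN ImN !ReM !ImM /= (_ : - _ = 0) ?expR0 ?mul1r; [congr cis|]; ring.
Qed.

Lemma chrD z h x : chr (z + h) x = chr z x * cexp (- (tpi * dotc x h)).
Proof. by rewrite /chr dotcDr mulrDr opprD cexpD. Qed.

Lemma ccontinuous_dotc z : ccontinuous (fun x => dotc x z).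
Proof.
rewrite /ccontinuous [z]cmk_ReIm; split.
  rewrite (_ : (fun _ => _) = fun x => dotr x (ReC z)); first exact: continuous_dotr.
  by apply/funext => x; rewrite dotc_cmk.
rewrite (_ : (fun _ => _) = fun x => dotr x (ImC z)); first exact: continuous_dotr.
by apply/funext => x; rewrite dotc_cmk.
Qed.

Lemma ccontinuous_chr z : ccontinuous (chr z).
Proof.
apply: ccontinuous_cexp.
rewrite (_ : (fun _ => _) = fun x => (- tpi) * dotc x z); last first.
  by apply/funext => x; rewrite mulNr.
by apply: ccontinuousM; [exact: ccontinuous_cst|exact: ccontinuous_dotc].
Qed.

Lemma is_cpartial_chr z j :
  is_cpartial j (chr z) (fun x => - (tpi * z 0 j) * chr z x).
Proof.
set w := - (tpi * z 0 j).
apply: (is_cpartial_quad (M := fun x => cabs (chr z x) * (4 * cabs w ^+ 2 * expR (cabs w)))) => x s s1.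
have -> : chr z (x + s *: delta_mx 0 j) - chr z x - s%:C * (w * chr z x) =
    chr z x * (cexp (s%:C * w) - 1 - s%:C * w).
  rewrite {1}/chr dotcDl dotcZl dotc_delta mulrDr opprD cexpD -/(chr z x).
  by rewrite (_ : - (tpi * (s%:C * _)) = s%:C * w) /w; ring.
rewrite cabsM -mulrA ler_wpM2l ?cabs_ge0// (le_trans (cabs_cexpB1B_le _))//.
rewrite cabsM cabs_real exprMn real_normK ?num_real//.
rewrite (_ : _ * _ = 4 * cabs w ^+ 2 * s ^+ 2 * expR `|complex.Re (s%:C * w)|); last by ring.
rewrite [leRHS]mulrAC; apply: ler_wpM2l.
  by rewrite mulr_ge0 ?sqr_ge0// mulr_ge0// sqr_ge0.
rewrite ler_expR (le_trans (Re_le_cabs _))// cabsM cabs_real.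
by rewrite ler_piMl ?cabs_ge0.
Qed.

End kernel.

(** * Scalar test functions *)

Section test_functions.
Context {R : realType} {n : nat}.
Implicit Types (f : 'rV[R]_n -> R) (g : 'rV[R]_n -> R[i]).

Lemma dpartial_cat s t f : dpartial s (dpartial t f) = dpartial (s ++ t) f.
Proof. by rewrite /dpartial foldr_cat. Qed.

Lemma smooth_dpartial t f : smooth f -> smooth (dpartial t f).
Proof. by move=> sf s; rewrite dpartial_cat; exact: sf. Qed.

(** The support condition is put on every partial derivative, as vanishing off the ball: it passes
    to derivatives at once and no closure has to be handled. *)
Definition testfn r g := csmooth g /\
  forall s x, r < enorm x -> cdpartial s g x = 0.

(** Openness matters: the difference quotients at x are eventually taken inside [U], where the
    function is already known to vanish. *)
Lemma dpartial_open_eq0 (U : set 'rV[R]_n) f s : open U ->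
  (forall x, U x -> f x = 0) -> forall x, U x -> dpartial s f x = 0.
Proof.
move=> oU fU; elim: s => [//|i s IH] x Ux /=.
apply: cvg_lim => //; apply: (@cvg_near_cst _ _ _ _ _).
near=> h; rewrite /= (IH x Ux) subr0 IH ?scaler0//.
near: h; apply: cvg_within.
have : (fun h : R => h *: delta_mx 0 i + x) @ 0 --> x.
  rewrite -[X in _ --> X](add0r x); apply: cvgD; last exact: cvg_cst.
  rewrite -(scale0r (delta_mx 0 i)); apply: cvgZr_tmp; exact: cvg_id.
by apply; exact: open_nbhs_nbhs.
Unshelve. all: by end_near.
Qed.

Lemma in_Dr_testfn r g : in_Dr r g -> testfn r g.
Proof.
move=> [sg supp]; split=> // s x rx.
pose U := ~` closure [set x | g x != 0].
have oU : open U by apply: closed_openC; exact: closed_closure.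
have Ux : U x by move=> /supp /=; rewrite leNgt rx.
have gU y : U y -> g y = 0.
  move=> Uy; apply/eqP/negPn/negP => gy; apply: Uy; exact: subset_closure.
by rewrite /cdpartial !(dpartial_open_eq0 _ oU)// => y /gU ->.
Qed.

Lemma testfn_cdpartial r t g : testfn r g -> testfn r (cdpartial t g).
Proof.
move=> [[s1 s2] v]; split; first by split; exact: smooth_dpartial.
move=> s x rx; rewrite -[RHS](v (s ++ t) x rx) /cdpartial.
by rewrite -!dpartial_cat.
Qed.

Lemma testfn_eq0 r g x : testfn r g -> r < enorm x -> g x = 0.
Proof.
move=> [_ v] rx; have := v [::] x rx; rewrite /cdpartial /=.
by case: (g x).
Qed.

Lemma testfn_ccontinuous r g : testfn r g -> ccontinuous g.
Proof. by move=> [[s1 s2] _]; split; [exact: (s1 [::]).1|exact: (s2 [::]).1]. Qed.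

Lemma testfn_bounded r g : testfn r g ->
  exists2 M, 0 <= M & forall x, cabs (g x) <= M.
Proof.
move=> tg; have [c1 c2] := testfn_ccontinuous tg.
have v x : r < enorm x -> g x = 0 := testfn_eq0 tg.
have [x|M1 M10 h1] := continuous_support_bounded c1 (r := r).
  by move=> /v ->.
have [x|M2 M20 h2] := continuous_support_bounded c2 (r := r).
  by move=> /v ->.
exists (M1 + M2); first exact: addr_ge0.
by move=> x; rewrite (le_trans (cabs_le_ReIm _))// lerD.
Qed.

Lemma is_cpartial_testfn r g j : testfn r g ->
  is_cpartial j g (cdpartial [:: j] g).
Proof.
move=> [[s1 s2] _] x; split; apply: derivableP.
  exact: (s1 [::]).2.
exact: (s2 [::]).2.
Qed.

Lemma support_bound r g B : ctmeasurable g ->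
  (forall x, r < enorm x -> g x = 0) ->
  (forall x, enorm x <= r -> cabs (g x) <= B) -> 0 <= B ->
  forall x, cabs (g x) <= B * (1 + r ^+ 2) ^+ n * weight x.
Proof.
move=> mg v gB B0 x; have [xr|xr] := leP (enorm x) r.
  by rewrite (le_trans (gB x xr))// -mulrA ler_peMr// weight_support.
rewrite v// cabs0 mulr_ge0 ?weight_ge0// mulr_ge0// exprn_ge0//.
by rewrite addr_ge0// sqr_ge0.
Qed.

End test_functions.

(** * The Fourier-Laplace transform and its decay *)

Section laplace.
Context {R : realType} {n : nat}.
Implicit Types (g : 'rV[R]_n -> R[i]) (z : 'rV[R[i]]_n).

Definition lapl g z := cintegral (fun x => chr z x * g x).

Lemma lapl_ofR g y : lapl g (ofR y) = fourier g y.
Proof. by apply: eq_cintegral => x; rewrite chr_ofR. Qed.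

Lemma chr_support_le r z (x : 'rV[R]_n) : enorm x <= r ->
  cabs (chr z x) <= expR (2 * pi * r * enorm (ImC z)).
Proof.
move=> xr; rewrite cabs_chr ler_expR -!mulrA ler_pM2l// ler_pM2l ?pi_gt0//.
by rewrite (le_trans (dotr_le_enorm _ _))// ler_wpM2r ?enorm_ge0.
Qed.

(** The extra factor [h] stands for the polynomial coefficients and the kernel remainders met in the
    proof of holomorphy. It may be unbounded on R^n, since only its product with [g] on the ball is
    estimated. *)
Lemma chr_mul_bound r g h z M : ctmeasurable h -> testfn r g -> 0 <= M ->
  (forall x, enorm x <= r -> cabs (h x * g x) <= M) -> forall x,
  cabs (h x * (chr z x * g x)) <=
    expR (2 * pi * r * enorm (ImC z)) * M * (1 + r ^+ 2) ^+ n * weight x.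
Proof.
move=> mh tg M0 hM; apply: (@support_bound _ _ r).
- apply: ctmeasurableM => //; apply: ctmeasurableM.
    exact/ccontinuous_measurable/ccontinuous_chr.
  exact/ccontinuous_measurable/(testfn_ccontinuous tg).
- by move=> x rx; rewrite (testfn_eq0 tg)// !mulr0.
- move=> x xr; rewrite mulrCA cabsM ler_pM ?cabs_ge0 ?hM//.
  exact: chr_support_le.
- by rewrite mulr_ge0// expR_ge0.
Qed.

Lemma cdominated_chr_mul r g h z M : ctmeasurable h -> testfn r g -> 0 <= M ->
  (forall x, enorm x <= r -> cabs (h x * g x) <= M) ->
  cdominated (fun x => h x * (chr z x * g x)).
Proof.
move=> mh tg M0 hM; split.
  apply: ctmeasurableM => //; apply: ctmeasurableM.
    exact/ccontinuous_measurable/ccontinuous_chr.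
  exact/ccontinuous_measurable/(testfn_ccontinuous tg).
exists (expR (2 * pi * r * enorm (ImC z)) * M * (1 + r ^+ 2) ^+ n).
exact: chr_mul_bound.
Qed.

Lemma cdominated_lapl r g z : testfn r g -> cdominated (fun x => chr z x * g x).
Proof.
move=> tg; have [M M0 hM] := testfn_bounded tg.
have := @cdominated_chr_mul r g (fun _ => 1) z M (@ctmeasurable_cst R n 1) tg M0.
under eq_fun do rewrite mul1r.
by apply => x _; rewrite mul1r.
Qed.

Definition laplK (r : R) := 2 * (1 + r ^+ 2) ^+ n * wtot n.

Lemma laplK_ge0 r : 0 <= laplK r.
Proof.
by rewrite !mulr_ge0 ?wtot_ge0// exprn_ge0// addr_ge0// sqr_ge0.
Qed.

Lemma lapl_bound r g z M : testfn r g -> (forall x, cabs (g x) <= M) ->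
  cabs (lapl g z) <= laplK r * M * expR (2 * pi * r * enorm (ImC z)).
Proof.
move=> tg hM; have M0 : 0 <= M := le_trans (cabs_ge0 _) (hM 0).
have := @chr_mul_bound r g (fun _ => 1) z M (@ctmeasurable_cst R n 1) tg M0.
move=> h; have {}h x : cabs (chr z x * g x) <=
    expR (2 * pi * r * enorm (ImC z)) * M * (1 + r ^+ 2) ^+ n * weight x.
  by have := h (fun x _ => _) x; rewrite mul1r; apply => {}x; rewrite mul1r.
have := cabs_cintegral_le (cdominated_lapl z tg).1 h.
by rewrite /lapl /laplK => /le_trans; apply; rewrite le_eqVlt; apply/orP; left; apply/eqP; ring.
Qed.

(** The integral of the j-th derivative of [chr z] times [g] is zero; expanding it gives the two
    sides. *)
Lemma lapl_partial r g j z : testfn r g ->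
  lapl (cdpartial [:: j] g) z = tpi * z 0 j * lapl g z.
Proof.
move=> tg; have tdg := testfn_cdpartial [:: j] tg.
have d1 := cdominated_lapl z tg; have d2 := cdominated_lapl z tdg.
have d3 := cdominatedZ (- (tpi * z 0 j)) d1.
have := cintegral_partial_eq0
  (is_cpartialM (is_cpartial_chr z j) (is_cpartial_testfn j tg)).
have E x : - (tpi * z 0 j) * chr z x * g x = - (tpi * z 0 j) * (chr z x * g x) by ring.
move=> H; have : cintegral (fun x => chr z x * cdpartial [:: j] g x +
     - (tpi * z 0 j) * (chr z x * g x)) = 0.
  rewrite -[RHS]H.
  - by apply: eq_cintegral => x; rewrite E.
  - have cc := ccontinuous_chr z; have cg := testfn_ccontinuous tg.
    apply: ccontinuousD; first exact: ccontinuousM cc (testfn_ccontinuous tdg).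
    by apply: ccontinuousM => //; apply: ccontinuousM => //; exact: ccontinuous_cst.
  - exact: d1.
  - under eq_fun do rewrite E.
    exact: cdominatedD.
rewrite cintegralD// cintegralZ// => /eqP; rewrite mulNr subr_eq0 => /eqP.
by [].
Qed.

Lemma lapl_partial_nseq r g j z k : testfn r g ->
  lapl (cdpartial (nseq k j) g) z = (tpi * z 0 j) ^+ k * lapl g z.
Proof.
move=> tg; elim: k => [|k IH].
  rewrite mul1r; apply: eq_cintegral => x; congr (_ * _).
  by rewrite /cdpartial /=; case: (g x).
rewrite exprS -mulrA -IH -(lapl_partial _ _ (testfn_cdpartial (nseq k j) tg)).
by [].
Qed.

End laplace.

Section power_mean.
Context {R : realType}.

(** A crude power-mean inequality: with b the maximum of 1 and the a_j, the sum is at most (n + 1)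
    b, and b^N is one of the terms on the right. It makes pure derivatives sufficient for the
    decay. *)
Lemma exprD1_sum_le n N (a : 'I_n -> R) : (forall j, 0 <= a j) ->
  (1 + \sum_j a j) ^+ N <= n.+1%:R ^+ N * (1 + \sum_j a j ^+ N).
Proof.
move=> a0; have [b [b1 ab bN]] : exists b : R, [/\ 1 <= b, forall j, a j <= b &
    b ^+ N <= 1 + \sum_j a j ^+ N].
  have [/existsP[j0 j01]|none] := boolP [exists j, 1 < a j]; last first.
    exists 1; split=> // [j|].
      rewrite leNgt; apply/negP => j1; move/negP: none; apply.
      by apply/existsP; exists j.
    by rewrite expr1n lerDl sumr_ge0// => j _; rewrite exprn_ge0.
  case: (@arg_maxP _ _ _ j0 xpredT a isT) => j _ jmax.
  exists (a j); split=> [|i|]; last 2 first.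
  - exact: jmax.
  - rewrite (bigD1 j)//= addrCA lerDl addr_ge0// sumr_ge0// => i _.
    by rewrite exprn_ge0.
  - by rewrite (le_trans (ltW j01))//; exact: jmax.
have b0 : 0 <= b by exact: le_trans b1.
apply: (@le_trans _ _ ((n.+1%:R * b) ^+ N)); last first.
  by rewrite exprMn ler_wpM2l// exprn_ge0.
have s0 : 0 <= 1 + \sum_j a j by rewrite addr_ge0// sumr_ge0.
rewrite lerXn2r ?nnegrE ?mulr_ge0// -natr1 mulrDl mul1r addrC lerD//.
rewrite mulr_natl -[X in _ *+ X]card_ord -sumr_const.
by apply: ler_sum => j _; exact: ab.
Qed.

End power_mean.

Section multiindex.
Context {n : nat}.

Definition pure_index N (j i : 'I_n) : nat := if i == j then N else 0%N.

Lemma seq_of_pure_index N j : seq_of_multiindex (pure_index N j) = nseq N j.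
Proof.
rewrite /seq_of_multiindex.
have h (s : seq 'I_n) : uniq s ->
    flatten [seq nseq (pure_index N j i) i | i <- s] =
    if j \in s then nseq N j else [::].
  elim: s => [//|i s IH] /= /andP[ins us]; rewrite IH// in_cons /pure_index.
  case: eqP => [Ei|ij]; last by rewrite eq_sym; case: eqP ij => // ->.
  by rewrite -Ei (negbTE ins) cats0 eqxx.
by rewrite h ?enum_uniq// mem_enum.
Qed.

Lemma sum_pure_index N j : (\sum_i pure_index N j i)%N = N.
Proof.
rewrite (bigD1 j)//= /pure_index eqxx big1 ?addn0// => i ij.
by rewrite (negbTE ij).
Qed.

Lemma seq_of_index0 : seq_of_multiindex (fun _ : 'I_n => 0%N) = [::].
Proof.
by rewrite /seq_of_multiindex; elim: (enum _).
Qed.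

End multiindex.

Section laplace_decay.
Context {R : realType} {n : nat}.
Implicit Types (g : 'rV[R]_n -> R[i]) (z : 'rV[R[i]]_n).

(** (n + 1)^N comes from the power-mean inequality; the other n + 1 counts the undifferentiated
    function and the n pure derivatives. *)
Definition decayK (r : R) N : R := n.+1%:R ^+ N * n.+1%:R * @laplK R n r.

Lemma decayK_ge0 r N : 0 <= decayK r N.
Proof. by rewrite mulr_ge0 ?laplK_ge0// mulr_ge0// exprn_ge0. Qed.

Lemma sqr_cenorm z : cenorm z ^+ 2 = \sum_i cabs (z 0 i) ^+ 2.
Proof. by rewrite sqr_sqrtr// sumr_ge0// => i _; exact: sqr_ge0. Qed.

(** The derivative of order 2N in x_j multiplies the transform by (2 pi i z_j)^{2N}, hence controls
    |z_j|^{2N}. This is why N powers of 1 + |z|^2 cost 2N derivatives. *)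
Lemma lapl_decay r g N M z : testfn r g ->
  (forall a, (\sum_i a i <= N.*2)%N -> forall x, cabs (cD a g x) <= M) ->
  (1 + cenorm z ^+ 2) ^+ N * expR (- (2 * pi * r * enorm (ImC z))) *
    cabs (lapl g z) <= decayK r N * M.
Proof.
move=> tg hM; set E := expR _; pose E' := expR (2 * pi * r * enorm (ImC z)).
have EE' : E * E' = 1 by rewrite -expRD addNr expR0.
have E0 : 0 < E by exact: expR_gt0.
have b0 : cabs (lapl g z) <= @laplK R n r * M * E'.
  apply: lapl_bound tg _ => x; have := hM (fun _ => 0%N) _ x.
  rewrite /cD seq_of_index0 big1_eq => /(_ isT).
  by rewrite /cdpartial /=; case: (g x).
have bj j : (cabs (z 0 j) ^+ 2) ^+ N * cabs (lapl g z) <= @laplK R n r * M * E'.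
  apply: (@le_trans _ _ (cabs (lapl (cdpartial (nseq N.*2 j) g) z))).
    rewrite (lapl_partial_nseq _ _ _ tg) cabsM cabsX cabsM cabs_tpi -exprM mul2n.
    rewrite ler_wpM2r ?cabs_ge0// lerXn2r ?nnegrE ?mulr_ge0 ?cabs_ge0 ?pi_ge0//.
    (* The factors 2 pi are at least 1 and are simply dropped. *)
    rewrite ler_peMl ?cabs_ge0//; have := pi_ge2 R; lra.
  apply: (lapl_bound _ (testfn_cdpartial _ tg)) => x.
  have := hM (pure_index N.*2 j) _ x.
  by rewrite /cD seq_of_pure_index sum_pure_index => /(_ (leqnn _)).
rewrite sqr_cenorm.
have a0 j : 0 <= cabs (z 0 j) ^+ 2 by exact: sqr_ge0.
have c0 := cabs_ge0 (lapl g z).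
have h := exprD1_sum_le N a0.
rewrite mulrAC -ler_pdivlMr// (_ : E^-1 = E'); last by rewrite -expRN opprK.
apply: le_trans (ler_wpM2r c0 h) _; rewrite -mulrA.
rewrite (_ : decayK r N * M * E' = n.+1%:R ^+ N * (n.+1%:R * (@laplK R n r * M * E'))); last first.
  by rewrite /decayK; ring.
rewrite ler_wpM2l ?exprn_ge0// mulrDl mul1r -natr1 mulrDl mul1r addrC.
apply: lerD => //; rewrite mulr_suml.
rewrite mulr_natl -[X in _ *+ X]card_ord -sumr_const.
by apply: ler_sum => j _; exact: bj.
Qed.

End laplace_decay.

(** * Holomorphy of the Fourier-Laplace transform *)

Lemma coord_le_mx_norm (K : numFieldType) n (h : 'rV[K]_n) i : `|h 0 i| <= `|h|.
Proof.
rewrite real_leNgt ?normr_real//; apply/negP => lt.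
have e0 : 0 < `|h 0 i| by exact: le_lt_trans lt.
have : ball 0 `|h 0 i| h by rewrite mx_norm_ball /ball_ /= sub0r normrN.
by move/(rV_ballP _ _ e0)/(_ i); rewrite mxE sub0r normrN ltxx.
Qed.

Lemma differentiable_quad (K : numFieldType) (V W : normedModType K)
    (f : V -> W) (L : {linear V -> W}) z M : 0 <= M -> continuous L ->
  (forall h, `|h| <= 1 -> `|f (z + h) - f z - L h| <= M * `|h| ^+ 2) ->
  differentiable f z.
Proof.
move=> M0 contL H.
have E : f \o shift z = cst (f z) + L +o_ 0 id.
  apply/eqaddoP => e e0.
  have M1 : 0 < M + 1 by rewrite ltr_wpDl.
  near=> h.
  have h1 : `|h| <= 1 by near: h; exact: nbhs0_le.
  have he : `|h| <= e / (M + 1) by near: h; apply: nbhs0_le; exact: divr_gt0.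
  change (`|f (h + z) - (f z + L h)| <= e * `|h|).
  rewrite [h + z]addrC opprD addrA.
  apply: le_trans (H h h1) _.
  rewrite expr2 mulrA ler_wpM2r//.
  rewrite ler_pdivlMr// in he; apply: le_trans he; rewrite mulrC.
  by rewrite ler_wpM2l// lerDl.
apply/diff_locallyP; rewrite (diff_unique contL E).
by split.
Unshelve. all: by end_near.
Qed.

Lemma differentiable_rV_quad (K : numFieldType) n (f : 'rV[K]_n -> K^o)
    (c : 'I_n -> K) (z : 'rV[K]_n) (M : K) : 0 <= M ->
  (forall h : 'rV[K]_n, `|h| <= 1 ->
    `|f (z + h) - f z - \sum_i h 0 i * c i| <= M * `|h| ^+ 2) ->
  differentiable f z.
Proof.
move=> M0 H; pose L (h : 'rV[K]_n) : K^o := \sum_i h 0 i * c i.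
have linL : linear L.
  move=> a h k; rewrite /L /GRing.scale /= mulr_sumr -big_split.
  by apply: eq_bigr => i _; rewrite !mxE mulrDl mulrA.
pose Ll : {linear 'rV[K]_n -> K^o} :=
  HB.pack L (GRing.isLinear.Build _ _ _ _ _ linL).
have contL : continuous L.
  rewrite /L; elim: (index_enum _) => [|i s IH].
    rewrite (_ : (fun _ => _) = fun=> 0); first exact: cst_continuous.
    by apply/funext => h; rewrite big_nil.
  rewrite (_ : (fun _ => _) = fun h : 'rV[K]_n => (h 0 i * c i : K^o) +
      (\sum_(j <- s) h 0 j * c j : K^o)); last first.
    by apply/funext => h; rewrite big_cons.
  move=> h; apply: continuousD (IH h).
  by apply: (@continuousM _ _ (fun h : 'rV[K]_n => h 0 i) (fun=> c i));
    [exact: coord_continuous|exact: cst_continuous].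
exact: (differentiable_quad (L := Ll) M0 contL H).
Qed.

Section holomorphy.
Context {R : realType} {n : nat}.

(** Passes from norms with complex values to real moduli: t plays the sup norm of the increment h.
    The constant may depend on z, since differentiability is local. *)
Lemma holomorphic_quad (f : 'rV[R[i]]_n -> R[i]) (c : 'rV[R[i]]_n -> 'I_n -> R[i])
    (M : 'rV[R[i]]_n -> R) : (forall z, 0 <= M z) ->
  (forall (z h : 'rV[R[i]]_n) (t : R), 0 <= t <= 1 ->
    (forall i, cabs (h 0 i) <= t) ->
    cabs (f (z + h) - f z - \sum_i h 0 i * c z i) <= M z * t ^+ 2) ->
  holomorphic f.
Proof.
move=> M0 H z; apply: (@differentiable_rV_quad _ _ f (c z) z (M z)%:C).
  by rewrite lecR.
move=> h h1; pose t := complex.Re `|h|.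
have Eh : `|h| = t%:C by rewrite RRe_real// normr_real.
rewrite normcE Eh -rmorphXn -rmorphM lecR; apply: H.
  by rewrite -(lecR 0) -(lecR _ 1) -Eh normr_ge0.
by move=> i; rewrite -lecR -normcE -Eh; exact: coord_le_mx_norm.
Qed.

Lemma cintegral_sum I (s : seq I) (F : I -> 'rV[R]_n -> R[i]) :
  (forall i, cdominated (F i)) ->
  cintegral (fun x => \sum_(i <- s) F i x) = \sum_(i <- s) cintegral (F i).
Proof.
move=> dF; have [] : cdominated (fun x => \sum_(i <- s) F i x) /\
  cintegral (fun x => \sum_(i <- s) F i x) = \sum_(i <- s) cintegral (F i); last by [].
elim: s => [|i s [IH1 IH2]].
  rewrite big_nil (_ : (fun _ => _) = fun=> 0); last first.
    by apply/funext => x; rewrite big_nil.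
  split.
    split; first exact: ctmeasurable_cst.
    by exists 0 => x; rewrite cabs0 mul0r.
  by rewrite (cintegral_real (fun=> 0)) /rint Rintegral_cst// mul0r.
rewrite big_cons (_ : (fun _ => _) = fun x => F i x + \sum_(j <- s) F j x); last first.
  by apply/funext => x; rewrite big_cons.
by split; [exact: cdominatedD|rewrite cintegralD// IH2].
Qed.

(** Differentiation under the integral: the increment of the kernel is [chr z] times cexp(w) - 1,
    with w linear in h. Its linear part integrates to the differential, and the remainder [q] is of
    second order uniformly on the ball. *)
Theorem lapl_holomorphic r (g : 'rV[R]_n -> R[i]) : 0 <= r -> testfn r g ->
  holomorphic (lapl g).
Proof.
move=> r0 tg; have [M M0 gM] := testfn_bounded tg.
pose k i (x : 'rV[R]_n) := - (tpi * (x 0 i)%:C) : R[i].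
have mk i : ctmeasurable (k i).
  rewrite (_ : k i = fun x => - tpi * (x 0 i)%:C); last first.
    by apply/funext => x; rewrite /k mulNr.
  apply: ctmeasurableM; first exact: ctmeasurable_cst.
  by apply: (ctmeasurable_real (f := fun x => x 0 i)); exact: tmeasurable_coord.
have dk z i : cdominated (fun x => k i x * (chr z x * g x)).
  apply: (@cdominated_chr_mul _ _ r g (k i) z (2 * pi * r * M)) => //.
    by rewrite !mulr_ge0// pi_ge0.
  move=> x xr; rewrite cabsM ler_pM ?cabs_ge0// /k cabsN cabsM cabs_tpi cabs_real.
  by rewrite ler_wpM2l ?mulr_ge0 ?pi_ge0// (le_trans (coord_le_enorm _ _)).
(* For x in the ball and |h_i| <= t <= 1, the exponent w is at most A t; B is then the remainder
   bound 4 |w|^2 exp|Re w| times the bound on g, without t^2. *)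
pose A := 2 * pi * (n%:R * r).
have A0 : 0 <= A by rewrite !mulr_ge0// pi_ge0.
pose B := 4 * A ^+ 2 * expR A * M.
have B0 : 0 <= B by rewrite mulr_ge0// mulr_ge0 ?expR_ge0// mulr_ge0// sqr_ge0.
apply: (@holomorphic_quad _ (fun z i => cintegral (fun x => k i x * (chr z x * g x)))
   (fun z => 2 * (expR (2 * pi * r * enorm (ImC z)) * B * (1 + r ^+ 2) ^+ n) * wtot n)).
  move=> z; rewrite mulr_ge0 ?wtot_ge0// mulr_ge0// mulr_ge0 ?exprn_ge0//.
    by rewrite mulr_ge0 ?expR_ge0.
  by rewrite addr_ge0// sqr_ge0.
move=> z h t /andP[t0 t1] ht.
pose w (x : 'rV[R]_n) := - (tpi * dotc x h).
have wE x : w x = \sum_i h 0 i * k i x.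
  rewrite /w /dotc mulr_sumr -sumrN; apply: eq_bigr => i _.
  by rewrite /k; ring.
have mw : ctmeasurable w.
  rewrite (_ : w = fun x => - tpi * dotc x h); last first.
    by apply/funext => x; rewrite /w mulNr.
  apply: ctmeasurableM; first exact: ctmeasurable_cst.
  exact/ccontinuous_measurable/ccontinuous_dotc.
pose q x := cexp (w x) - 1 - w x.
have mq : ctmeasurable q.
  apply: (@ctmeasurableD _ _ (fun x => cexp (w x) - 1) (fun x => - w x)).
    apply: ctmeasurableD; first exact: ctmeasurable_cexp.
    exact: ctmeasurable_cst.
  have := ctmeasurableM (@ctmeasurable_cst R n (-1)) mw.
  by under eq_fun do rewrite mulN1r.
have wA x : enorm x <= r -> cabs (w x) <= A * t.
  move=> xr; rewrite cabsN cabsM cabs_tpi /A -!mulrA ler_pM2l// ler_pM2l ?pi_gt0//.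
  rewrite (le_trans (le_cabs_sum _ _ _))// mulr_natl -[X in _ *+ X]card_ord -sumr_const.
  apply: ler_sum => i _; rewrite cabsM cabs_real ler_pM ?cabs_ge0//.
  exact: le_trans (coord_le_enorm _ _) xr.
have qB x : enorm x <= r -> cabs (q x * g x) <= B * t ^+ 2.
  move=> xr; have wx := wA x xr.
  rewrite cabsM /B (_ : _ * _ * _ * _ * _ = 4 * (A * t) ^+ 2 * expR A * M); last by ring.
  rewrite ler_pM ?cabs_ge0//.
  apply: le_trans (cabs_cexpB1B_le _) _; apply: ler_pM.
  - by rewrite mulr_ge0// sqr_ge0.
  - exact: expR_ge0.
  - by rewrite ler_wpM2l// lerXn2r ?nnegrE ?cabs_ge0// mulr_ge0.
  - rewrite ler_expR (le_trans (Re_le_cabs _))// (le_trans wx)//.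
    by rewrite ler_piMr.
have dq : cdominated (fun x => q x * (chr z x * g x)).
  apply: (@cdominated_chr_mul _ _ r g q z (B * t ^+ 2)) => //.
  by rewrite mulr_ge0// sqr_ge0.
have -> : lapl g (z + h) - lapl g z -
    \sum_i h 0 i * cintegral (fun x => k i x * (chr z x * g x)) =
    cintegral (fun x => q x * (chr z x * g x)).
  under eq_bigr => i _ do rewrite -cintegralZ//.
  rewrite -cintegral_sum; last by move=> i; exact: cdominatedZ.
  have dS : cdominated (fun x => \sum_i h 0 i * (k i x * (chr z x * g x))).
    have := @cdominated_chr_mul _ _ r g w z (A * M) mw tg.
    rewrite (_ : (fun x => w x * (chr z x * g x)) =
      (fun x => \sum_i h 0 i * (k i x * (chr z x * g x)))); last first.
      apply/funext => x; rewrite wE mulr_suml; apply: eq_bigr => i _.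
      by rewrite mulrA.
    apply; first by rewrite mulr_ge0.
    move=> x xr; rewrite cabsM ler_pM ?cabs_ge0// (le_trans (wA x xr))//.
    by rewrite ler_piMr.
  rewrite /lapl -cintegralB; [|exact: (cdominated_lapl _ tg)..].
  rewrite -cintegralB//; last first.
    by apply: cdominatedB; exact: (cdominated_lapl _ tg).
  apply: eq_cintegral => x; rewrite chrD -/(w x).
  rewrite (_ : \sum_i _ = w x * (chr z x * g x)); last first.
    rewrite wE mulr_suml; apply: eq_bigr => i _.
    by rewrite mulrA.
  by rewrite /q; ring.
rewrite (_ : _ * t ^+ 2 =
  2 * (expR (2 * pi * r * enorm (ImC z)) * (B * t ^+ 2) * (1 + r ^+ 2) ^+ n) * wtot n); last by ring.
apply: cabs_cintegral_le; first by case: dq.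
apply: chr_mul_bound => //.
by rewrite mulr_ge0// sqr_ge0.
Qed.

End holomorphy.

(** * Inverse transforms of rapidly decreasing functions *)

Section rapid.
Context {R : realType} {n : nat}.
Implicit Types (q : 'rV[R]_n -> R[i]) (x y : 'rV[R]_n).

Definition rapid q := ctmeasurable q /\
  forall N, exists C, forall x, (1 + dotr x x) ^+ N * cabs (q x) <= C.

Definition invF q y := cintegral (fun x => cis (2 * pi * dotr x y) * q x).

Lemma oneDdotr_ge1 x : 1 <= 1 + dotr x x.
Proof. by rewrite lerDl dotr_ge0. Qed.

Lemma oneDdotr_gt0 x : 0 < 1 + dotr x x.
Proof. exact: lt_le_trans (oneDdotr_ge1 x). Qed.

Lemma weight_oneDdotr x : 1 <= (1 + dotr x x) ^+ n * weight x.
Proof.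
have := @weight_support R n (enorm x) x (lexx _).
by rewrite sqr_enorm.
Qed.

(** Trades [n] powers of 1 + |x|^2 for the weight; every later use of N + n comes from here. *)
Lemma weight_bound x c C : (1 + dotr x x) ^+ n * c <= C -> 0 <= c -> c <= C * weight x.
Proof.
move=> h c0; have w0 := weight_ge0 x.
apply: le_trans (ler_wpM2r w0 h); rewrite mulrAC.
by rewrite ler_peMl// weight_oneDdotr.
Qed.

Lemma rapid_cdominated q : rapid q -> cdominated q.
Proof.
move=> [mq rq]; split => //; have [C hC] := rq n; exists C => x.
by apply: weight_bound => //; exact: cabs_ge0.
Qed.

Lemma coord_le_oneDdotr x j : `|x 0 j| <= 1 + dotr x x.
Proof.
have := sqr_coord_le x j; rewrite -real_normK ?num_real// => h.
have := sqr_ge0 (`|x 0 j| - 1); nra.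
Qed.

Lemma cabs_tpiM (a : R) w : cabs (tpi * a%:C * w) = 2 * pi * `|a| * cabs w.
Proof. by rewrite cabsM (cabsM tpi) cabs_tpi cabs_real. Qed.

Lemma rapid_coord q j c : rapid q -> rapid (fun x => c * (x 0 j)%:C * q x).
Proof.
move=> [mq rq]; split.
  apply: ctmeasurableM => //; apply: ctmeasurableM; first exact: ctmeasurable_cst.
  by apply: (ctmeasurable_real (f := fun x => x 0 j)); exact: tmeasurable_coord.
move=> N; have [C hC] := rq N.+1; exists (cabs c * C) => x.
rewrite !cabsM cabs_real (_ : _ * _ = cabs c * ((1 + dotr x x) ^+ N * `|x 0 j| * cabs (q x))); last by ring.
rewrite ler_wpM2l ?cabs_ge0//; apply: le_trans (hC x).
rewrite ler_wpM2r ?cabs_ge0// exprSr ler_wpM2l ?coord_le_oneDdotr//.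
by rewrite exprn_ge0// ltW// oneDdotr_gt0.
Qed.

Lemma rapid_cis q (a : R) y : rapid q -> rapid (fun x => cis (a * dotr x y) * q x).
Proof.
move=> [mq rq]; split.
  apply: ctmeasurableM => //; apply: ctmeasurable_cis; apply: tmeasurableM.
    exact: tmeasurable_cst.
  exact: tmeasurable_dotr.
by move=> N; have [C hC] := rq N; exists C => x; rewrite cabsM cabs_cis mul1r.
Qed.

Lemma rapid_dotr q : rapid q -> rapid (fun x => (dotr x x)%:C * q x).
Proof.
move=> [mq rq]; split.
  by apply: ctmeasurableM => //; exact: (ctmeasurable_real tmeasurable_dotrr).
move=> N; have [C hC] := rq N.+1; exists C => x.
apply: le_trans (hC x); rewrite cabsM cabs_real ger0_norm ?dotr_ge0// mulrA.
rewrite ler_wpM2r ?cabs_ge0// exprSr ler_wpM2l//.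
  by rewrite exprn_ge0// ltW// oneDdotr_gt0.
by rewrite lerDr.
Qed.

(** The remainder of the character is at most 3 (2 pi x_j s)^2, and rapid decay absorbs the
    unbounded x_j^2. *)
Lemma is_cpartial_invF q j : rapid q ->
  is_cpartial j (invF q) (invF (fun x => tpi * (x 0 j)%:C * q x)).
Proof.
move=> rq; pose qj x : R[i] := tpi * (x 0 j)%:C * q x.
have rqj : rapid qj by exact: rapid_coord.
(* Multiplying twice by 2 pi i x_j produces exactly the square that appears in the remainder. *)
have rqjj : rapid (fun x => tpi * (x 0 j)%:C * qj x) by exact: rapid_coord.
have [_ [C hC]] := rapid_cdominated rqjj.
apply: (is_cpartial_quad (M := fun=> 2 * (3 * C) * wtot n)) => y s s1.
have dom p y' : rapid p -> cdominated (fun x => cis (2 * pi * dotr x y') * p x).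
  by move=> rp; exact/rapid_cdominated/rapid_cis.
pose D x := cis (2 * pi * dotr x (y + s *: delta_mx 0 j)) * q x -
   cis (2 * pi * dotr x y) * q x - s%:C * (cis (2 * pi * dotr x y) * qj x).
have dD : cdominated D.
  apply: cdominatedB; first by apply: cdominatedB; exact: dom.
  by apply: cdominatedZ; exact: dom.
rewrite /invF -cintegralZ; last exact: dom.
rewrite -cintegralB; [|exact: dom|exact: dom].
rewrite -cintegralB; last by apply: cdominatedZ; exact: dom.
  rewrite -/D (_ : 2 * (3 * C) * wtot n * s ^+ 2 = 2 * (3 * C * s ^+ 2) * wtot n); last by ring.
  apply: cabs_cintegral_le; first by case: dD.
  move=> x; pose u := 2 * pi * x 0 j * s.
  have -> : D x = cis (2 * pi * dotr x y) * (cis u - 1 - 'i * u%:C) * q x.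
    rewrite /D dotrDr dotrZr mulrDr cisD (_ : 2 * pi * (s * _) = u); last first.
      rewrite /u /dotr (bigD1 j)//= mxE !eqxx mulr1 big1 ?addr0; first by ring.
      by move=> i ij; rewrite mxE eqxx (negbTE ij) mulr0.
    by rewrite /qj /tpi /u !rmorphM /=; ring.
  rewrite !cabsM cabs_cis mul1r.
  apply: le_trans (ler_wpM2r (cabs_ge0 _) (cabs_cisB1B_le u)) _.
  have := hC x; rewrite !cabs_tpiM => hx.
  have -> : 3 * u ^+ 2 * cabs (q x) =
      3 * s ^+ 2 * (2 * pi * `|x 0 j| * (2 * pi * `|x 0 j| * cabs (q x))).
    by rewrite /u !exprMn -(real_normK (num_real (x 0 j))); ring.
  rewrite (_ : 3 * C * s ^+ 2 * weight x = 3 * s ^+ 2 * (C * weight x)); last by ring.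
  by rewrite ler_wpM2l// mulr_ge0// sqr_ge0.
by apply: cdominatedB; exact: dom.
Qed.

Lemma ccontinuous_lipschitz (g : 'rV[R]_n -> R[i]) (K : R) :
  (forall x h, cabs (g (x + h) - g x) <= K * \sum_i `|h 0 i|) -> ccontinuous g.
Proof.
move=> H; have key (f : R[i] -> R) : (forall z w, `|f z - f w| <= cabs (z - w)) ->
    continuous (fun x => f (g x)).
  move=> fl x; have F : Filter (nbhs x) by exact: nbhs_filter.
  apply/(@cvgrPdist_le _ _ _ (nbhs x) F) => e e0.
  have K1 : 0 < `|K| * n%:R + 1 by rewrite ltr_pwDr// mulr_ge0.
  have e1 : 0 < e / (`|K| * n%:R + 1) by exact: divr_gt0.
  apply/nbhs_ballP; exists (e / (`|K| * n%:R + 1)) => //= y.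
  move/(rV_ballP _ _ e1) => hy.
  rewrite distrC (le_trans (fl _ _))// (_ : y = x + (y - x)); last by rewrite addrC subrK.
  apply: le_trans (H _ _) _.
  apply: (@le_trans _ _ (`|K| * (n%:R * (e / (`|K| * n%:R + 1))))).
    apply: (@le_trans _ _ (`|K| * \sum_i `|(y - x) 0 i|)).
      by rewrite ler_wpM2r ?sumr_ge0// ler_norm.
    rewrite ler_wpM2l// mulr_natl -[X in _ *+ X]card_ord -sumr_const.
    by apply: ler_sum => i _; rewrite !mxE distrC ltW.
  have -> : `|K| * (n%:R * (e / (`|K| * n%:R + 1))) =
      e * (`|K| * n%:R / (`|K| * n%:R + 1)) by field; rewrite gt_eqF.
  apply: ler_piMr; first exact: ltW.
  by rewrite ler_pdivrMr// mul1r lerDl.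
split; apply: key => z w.
  by rewrite -ReN -ReD Re_le_cabs.
by rewrite -ImN -ImD Im_le_cabs.
Qed.

Lemma ccontinuous_invF q : rapid q -> ccontinuous (invF q).
Proof.
move=> rq; have [_ [C hC]] := rapid_cdominated (rapid_dotr rq).
have [_ [C' hC']] := rapid_cdominated rq.
apply: (@ccontinuous_lipschitz _ (2 * (4 * pi * (C' + C)) * wtot n)) => y h.
pose S := \sum_i `|h 0 i|.
have dom y' : cdominated (fun x => cis (2 * pi * dotr x y') * q x).
  by exact/rapid_cdominated/rapid_cis.
rewrite /invF -cintegralB//.
rewrite (_ : _ * S = 2 * (4 * pi * (C' + C) * S) * wtot n); last by rewrite -/S; ring.
apply: cabs_cintegral_le; first by case: (cdominatedB (dom (y + h)) (dom y)).
move=> x; rewrite dotrDr mulrDr cisD.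
set u := 2 * pi * dotr x h; rewrite (_ : _ - _ = cis (2 * pi * dotr x y) * ((cis u - 1) * q x)); last by ring.
rewrite !cabsM cabs_cis mul1r (le_trans (ler_wpM2r (cabs_ge0 _) (cabs_cisB1_le u)))//.
have hu : `|u| <= 2 * pi * ((1 + dotr x x) * S).
  rewrite /u normrM ger0_norm ?mulr_ge0 ?pi_ge0// ler_wpM2l ?mulr_ge0 ?pi_ge0//.
  rewrite /dotr (le_trans (ler_norm_sum _ _ _))// mulr_sumr.
  by apply: ler_sum => i _; rewrite normrM ler_wpM2r ?coord_le_oneDdotr.
have := hC x; rewrite cabsM cabs_real ger0_norm ?dotr_ge0// => h1.
have h2 := hC' x.
apply: (@le_trans _ _ (2 * (2 * pi * ((1 + dotr x x) * S)) * cabs (q x))).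
  by rewrite ler_wpM2r ?cabs_ge0// ler_wpM2l.
rewrite (_ : 2 * _ * cabs (q x) = (4 * pi * S) * (cabs (q x) + dotr x x * cabs (q x))); last by ring.
rewrite (_ : _ * weight x = (4 * pi * S) * (C' * weight x + C * weight x)); last by ring.
by rewrite ler_wpM2l ?lerD// mulr_ge0 ?sumr_ge0// mulr_ge0// pi_ge0.
Qed.

Definition wordmul (s : seq 'I_n) q x : R[i] :=
  foldr (fun j v => tpi * (x 0 j)%:C * v) (q x) s.

Lemma rapid_wordmul s q : rapid q -> rapid (wordmul s q).
Proof. by move=> rq; elim: s => [//|j s IH] /=; exact: rapid_coord. Qed.

Lemma dpartial_invF s q : rapid q ->
  dpartial s (fun y => complex.Re (invF q y)) =
    (fun y => complex.Re (invF (wordmul s q) y)) /\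
  dpartial s (fun y => complex.Im (invF q y)) =
    (fun y => complex.Im (invF (wordmul s q) y)).
Proof.
move=> rq; elim: s => [//|j s [IH1 IH2]] /=.
rewrite IH1 IH2; split; apply/funext => y;
  have [h1 h2] := is_cpartial_invF j (rapid_wordmul s rq) y.
  by have [_ ->] := h1.
by have [_ ->] := h2.
Qed.

Lemma csmooth_invF q : rapid q -> csmooth (invF q).
Proof.
move=> rq; split=> s; have rs := rapid_wordmul s rq;
  have [E1 E2] := dpartial_invF s rq; have [c1 c2] := ccontinuous_invF rs.
  rewrite E1; split => // i x; have [[]] := is_cpartial_invF i rs x.
  by [].
rewrite E2; split => // i x; have [_ []] := is_cpartial_invF i rs x.
by [].
Qed.

Lemma cdpartial_invF s q y : rapid q ->
  cdpartial s (invF q) y = invF (wordmul s q) y.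
Proof.
move=> rq; have [E1 E2] := dpartial_invF s rq.
by rewrite /cdpartial E1 E2; case: (invF _ _).
Qed.

Lemma cabs_wordmul s q x :
  cabs (wordmul s q x) <= (2 * pi) ^+ size s * (1 + dotr x x) ^+ size s * cabs (q x).
Proof.
elim: s => [|j s IH] /=; first by rewrite !mul1r.
rewrite cabs_tpiM !exprS.
rewrite (_ : _ * cabs (q x) = (2 * pi) * (1 + dotr x x) *
  ((2 * pi) ^+ size s * (1 + dotr x x) ^+ size s * cabs (q x))); last by ring.
rewrite ler_pM ?mulr_ge0 ?cabs_ge0 ?pi_ge0//.
by rewrite ler_wpM2l ?coord_le_oneDdotr// mulr_ge0// pi_ge0.
Qed.

(** Each derivative costs a factor 2 pi |x_j|, hence at most one power of 1 + |x|^2; the [n] further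
    powers make the integrand dominated. *)
Lemma cdpartial_invF_bound s N q C : rapid q -> (size s <= N)%N ->
  (forall x, (1 + dotr x x) ^+ (N + n) * cabs (q x) <= C) ->
  forall y, cabs (cdpartial s (invF q) y) <= 2 * ((2 * pi) ^+ N * C) * wtot n.
Proof.
move=> rq sN hC y; rewrite cdpartial_invF//.
have rw := rapid_cis (2 * pi) y (rapid_wordmul s rq).
apply: cabs_cintegral_le; first by case: rw.
move=> x; rewrite cabsM cabs_cis mul1r.
apply: weight_bound; last exact: cabs_ge0.
have p1 : 1 <= 2 * pi :> R by have := pi_ge2 R; lra.
have x1 := oneDdotr_ge1 x; have x0 := ltW (oneDdotr_gt0 x).
apply: le_trans (ler_wpM2l (exprn_ge0 _ x0) (cabs_wordmul s q x)) _.
have E (a b c d : R) : a * (b * c * d) = b * (c * a * d) by ring.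
rewrite E -exprD.
apply: ler_pM.
- by rewrite exprn_ge0// (le_trans _ p1).
- by rewrite mulr_ge0 ?cabs_ge0// exprn_ge0.
- exact: ler_weXn2l.
- apply: le_trans (hC x); rewrite ler_wpM2r ?cabs_ge0//.
  by rewrite ler_weXn2l// leq_add2r.
Qed.

End rapid.

(** * Holomorphic functions along coordinates and on translates of R^n *)

Lemma differentiable_coord_continuous (K : numFieldType) n (f : 'rV[K]_n -> K^o)
    (z : 'rV[K]_n) (e : K) : differentiable f z -> 0 < e ->
  exists2 d : K, 0 < d & forall h : 'rV[K]_n, (forall i, `|h 0 i| < d) ->
    `|f (z + h) - f z| < e.
Proof.
move=> /differentiable_continuous/cvgrPdist_lt H /H /nbhs_ballP[d d0 hd].
exists d => // h hh; rewrite distrC; apply: hd; apply/rV_ballP => // i.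
by rewrite mxE opprD addrA subrr sub0r normrN.
Qed.

Section holomorphic_coord.
Context {R : realType} {n : nat}.
Implicit Types (f : 'rV[R[i]]_n -> R[i]).

Lemma holomorphic_entire1 f z j : holomorphic f ->
  entire1 (fun s => f (setc z j s)).
Proof.
move=> hf w; have := hf (setc z j w).
move=> /(@diff_derivable _ _ _ _ _ (delta_mx 0 j)) /cvg_ex[/= a].
move=> /cvgrPdist_le H; exists a => e e0.
have : 0 < e%:C :> R[i] by rewrite ltcR.
move=> /H; rewrite near_withinE => /nbhs_ballP[d d0 hd].
have d'0 : 0 < complex.Re d by rewrite -ltcR RRe_real// gtr0_real.
exists (complex.Re d) => // v vd.
(* The limit defining the derivative ignores v = 0, and the rewriting below divides by v. *)
have [->|v0] := eqVneq v 0.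
  by rewrite addr0 subrr sub0r mulr0 oppr0 cabs0 mulr0.
have : ball (0 : R[i]^o) d v.
  by rewrite -ball_normE /ball_ /= sub0r normrN normcE -[d]RRe_real ?gtr0_real// ltcR.
move=> /hd /(_ v0).
have -> : v *: delta_mx 0 j + setc z j w = setc z j (w + v).
  apply/rowP => i; rewrite !mxE eqxx /=; case: eqP => _; last by rewrite mulr0 add0r.
  by rewrite mulr1 addrC.
rewrite /GRing.scale /= normcE lecR => h.
have -> : f (setc z j (w + v)) - f (setc z j w) - a * v =
    - ((a - v^-1 * (f (setc z j (w + v)) - f (setc z j w))) * v).
  rewrite mulrBl opprB [v^-1 * _]mulrC mulfVK//.
by rewrite cabsN cabsM ler_wpM2r ?cabs_ge0.
Qed.

Lemma holomorphic_continuous f (z : 'rV[R[i]]_n) : holomorphic f ->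
  forall e : R, 0 < e ->
  exists2 d : R, 0 < d & forall h : 'rV[R[i]]_n, (forall i, cabs (h 0 i) < d) ->
    cabs (f (z + h) - f z) < e.
Proof.
move=> hf e e0; have e'0 : 0 < e%:C :> R[i] by rewrite ltcR.
have [d d0 hd] := differentiable_coord_continuous (hf z) e'0.
exists (complex.Re d); first by rewrite -ltcR RRe_real// gtr0_real.
move=> h hh; rewrite -ltcR -normcE; apply: hd => i.
by rewrite normcE -[d]RRe_real ?gtr0_real// ltcR.
Qed.

Lemma holomorphic_ccontinuous f eta : holomorphic f ->
  ccontinuous (fun x => f (cmk x eta)).
Proof.
move=> hf; have key (k : R[i] -> R) : (forall z w, `|k z - k w| <= cabs (z - w)) ->
    continuous (fun x => k (f (cmk x eta))).
  move=> kl x; have F : Filter (nbhs x) by exact: nbhs_filter.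
  apply/(@cvgrPdist_lt _ _ _ (nbhs x) F) => e e0.
  have [d d0 hd] := holomorphic_continuous (cmk x eta) hf e0.
  apply/nbhs_ballP; exists d => //= y /(rV_ballP _ _ d0) hy.
  rewrite distrC (le_lt_trans (kl _ _))//.
  rewrite (_ : cmk y eta = cmk x eta + ofR (y - x)); last first.
    by apply/rowP => i; rewrite !mxE; apply: complexP => /=; ring.
  by apply: hd => i; rewrite !mxE cabs_real distrC.
split; apply: key => z w.
  by rewrite -ReN -ReD Re_le_cabs.
by rewrite -ImN -ImD Im_le_cabs.
Qed.

End holomorphic_coord.

(** * The scalar Paley-Wiener theorem *)

Section paley_wiener.
Context {R : realType} {n : nat}.
Implicit Types (f : 'rV[R[i]]_n -> R[i]) (x y eta : 'rV[R]_n).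

Definition pwfun s f := holomorphic f /\ forall N, exists M, forall z,
  (1 + cenorm z ^+ 2) ^+ N * expR (- (s * enorm (ImC z))) * cabs (f z) <= M.

Lemma ImC_cmk x eta : ImC (cmk x eta) = eta.
Proof. by apply/rowP => i; rewrite !mxE. Qed.

Lemma cenorm_cmk x eta : cenorm (cmk x eta) ^+ 2 = dotr x x + dotr eta eta.
Proof.
rewrite sqr_cenorm /dotr -big_split; apply: eq_bigr => i _.
by rewrite mxE sqr_cabs /= !expr2.
Qed.

Lemma enorm_le_sum x : enorm x <= \sum_i `|x 0 i|.
Proof.
have S0 : 0 <= \sum_i `|x 0 i| by exact: sumr_ge0.
rewrite -(@ler_pXn2r _ 2) ?nnegrE ?enorm_ge0// sqr_enorm /dotr expr2 mulr_suml.
apply: ler_sum => i _; rewrite -expr2 -real_normK ?num_real// expr2.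
by rewrite ler_wpM2l// (bigD1 i)//= lerDl sumr_ge0.
Qed.

Lemma pwfun_le s f N : pwfun s f -> exists2 M, 0 <= M & forall x eta,
  (1 + dotr x x) ^+ N * cabs (f (cmk x eta)) <= M * expR (s * enorm eta).
Proof.
move=> [_ /(_ N) [M hM]]; exists `|M| => // x eta.
rewrite -ler_pdivrMr ?expR_gt0// -expRN mulrAC.
apply: le_trans (ler_norm M); apply: le_trans (hM (cmk x eta)).
rewrite ImC_cmk cenorm_cmk ler_wpM2r ?cabs_ge0// ler_wpM2r ?expR_ge0//.
rewrite lerXn2r ?nnegrE ?addr_ge0 ?dotr_ge0//.
by rewrite lerD2l lerDl dotr_ge0.
Qed.

Lemma rapid_pwfun s f eta : pwfun s f -> rapid (fun x => f (cmk x eta)).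
Proof.
move=> pf; split.
  by apply/ccontinuous_measurable/holomorphic_ccontinuous; case: pf.
move=> N; have [M _ hM] := pwfun_le N pf.
by exists (M * expR (s * enorm eta)) => x.
Qed.

(** The entire extension of the integrand of the inverse transform at y. *)
Definition pwker f y z := cexp (tpi * dotc y z) * f z.

Lemma pwker_cmk f y x eta : pwker f y (cmk x eta) =
  (expR (- (2 * pi * dotr eta y)))%:C * (cis (2 * pi * dotr x y) * f (cmk x eta)).
Proof.
rewrite /pwker dotc_cmk /cexp !ReM !ImM /= mulrA; congr (_%:C * cis _ * _).
  by congr expR; rewrite (dotrC y x) (dotrC y eta); ring.
by rewrite (dotrC y x) (dotrC y eta); ring.
Qed.

Lemma cderivableM (f g : R[i] -> R[i]) w : cderivable_at f w -> cderivable_at g w ->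
  cderivable_at (fun z => f z * g z) w.
Proof.
move=> df dg.
(* Polarization reduces products to linear combinations and squares, for which the chain rule is
   available. *)
have -> : (fun z => f z * g z) = (fun z => (4^-1 : R[i]) * (f z + g z) ^+ 2 +
    - (4^-1) * (f z - g z) ^+ 2).
  by apply/funext => z; field.
have add (a b : R[i] -> R[i]) c : cderivable_at a w -> cderivable_at b w ->
    cderivable_at (fun z => a z + c * b z) w.
  move=> [a' ha] [b' hb]; exists (a' + c * b') => e e0.
  have c1 : 0 < 1 + cabs c by rewrite ltr_wpDr// cabs_ge0.
  have e1 : 0 < e / (1 + cabs c) by exact: divr_gt0.
  have [d1 d10 h1] := ha _ e1; have [d2 d20 h2] := hb _ e1.
  exists (Num.min d1 d2); first by rewrite lt_min d10.
  move=> v; rewrite lt_min => /andP[v1 v2].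
  rewrite (_ : _ - _ - _ = (a (w + v) - a w - a' * v) + c * (b (w + v) - b w - b' * v)); last by ring.
  rewrite (le_trans (le_cabsD _ _))// cabsM.
  rewrite (le_trans (lerD (h1 _ v1) (ler_wpM2l (cabs_ge0 c) (h2 _ v2))))//.
  by rewrite le_eqVlt; apply/orP; left; apply/eqP; field; rewrite gt_eqF.
apply: (add (fun z => 4^-1 * (f z + g z) ^+ 2) (fun z => (f z - g z) ^+ 2)).
  apply: cderivable_scale; apply: (cderivable_comp (cderivable_sqr _)).
  have := add f g 1 df dg.
  by under [fun z => f z + 1 * g z]eq_fun do rewrite mul1r.
apply: (cderivable_comp (cderivable_sqr _)).
have := add f g (-1) df dg.
by under [fun z => f z + _ * g z]eq_fun do rewrite mulN1r.
Qed.

Lemma shiftable_pwker s f y : pwfun s f -> 0 <= s -> shiftable (pwker f y).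
Proof.
move=> pf s0; have [hf _] := pf; split.
- move=> z j w; apply: (cderivableM (f := fun u => cexp (tpi * dotc y (setc z j u)))).
    pose S := \sum_(i < n | i != j) (y 0 i)%:C * z 0 i.
    have -> : (fun u => cexp (tpi * dotc y (setc z j u))) =
        (fun u => cexp (tpi * S) * cexp (tpi * (y 0 j)%:C * u)).
      apply/funext => u; rewrite -cexpD /dotc (bigD1 j)//= setcE eqxx; congr cexp.
      rewrite (eq_bigr (fun i => (y 0 i)%:C * z 0 i)); first by rewrite -/S; ring.
      by move=> i ij; rewrite setcE (negbTE ij).
    apply: cderivable_scale; apply: (cderivable_comp (cderivable_cexp _)).
    exists (tpi * (y 0 j)%:C) => e e0; exists 1 => // v _.
    by rewrite (_ : _ - _ - _ = 0) ?cabs0 ?mulr_ge0 ?cabs_ge0 ?ltW//; ring.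
  exact: holomorphic_entire1.
- move=> eta.
  rewrite (_ : (fun x => pwker f y (cmk x eta)) = (fun x =>
     (expR (- (2 * pi * dotr eta y)))%:C * (cis (2 * pi * dotr x y) * f (cmk x eta)))); last first.
    by apply/funext => x; rewrite pwker_cmk.
  apply: ctmeasurableM; first exact: ctmeasurable_cst.
  by have [] := rapid_cis (2 * pi) y (rapid_pwfun eta pf).
- move=> B; have [M M0 hM] := pwfun_le n pf.
  pose A := n%:R * `|B|.
  exists (expR (2 * pi * (A * enorm y)) * (M * expR (s * A))) => x eta etaB.
  have etaA : enorm eta <= A.
    rewrite (le_trans (enorm_le_sum _))// /A mulr_natl -[X in _ *+ X]card_ord -sumr_const.
    by apply: ler_sum => i _; rewrite (le_trans (etaB i))// ler_norm.
  rewrite pwker_cmk !cabsM cabs_cis mul1r cabs_real ger0_norm ?expR_ge0// -[leRHS]mulrA.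
  apply: ler_pM; rewrite ?expR_ge0 ?cabs_ge0//.
    rewrite ler_expR -mulrN ler_wpM2l ?mulr_ge0 ?pi_ge0// -dotrNl.
    apply: le_trans (dotr_le_enorm _ _) _; rewrite ler_wpM2r ?enorm_ge0//.
    by rewrite /enorm dotrNl dotrC dotrNl opprK.
  apply: weight_bound; last exact: cabs_ge0.
  apply: le_trans (hM x eta) _; rewrite ler_wpM2l// ler_expR.
  by rewrite ler_wpM2l.
Qed.

(** On the shifted contour the kernel acquires the factor exp(-2 pi eta.y), moved here to the other
    side. Large eta gives the support condition; fixed eta gives the transform of a translate. *)
Lemma invF_shift s f y eta : pwfun s f -> 0 <= s ->
  invF (fun x => f (cmk x eta)) y =
  (expR (2 * pi * dotr eta y))%:C * invF (fun x => f (ofR x)) y.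
Proof.
move=> pf s0; have := contour_shift_rV eta (shiftable_pwker y pf s0).
rewrite (eq_cintegral (pwker_cmk f y ^~ eta)) cintegralZ; last first.
  exact/rapid_cdominated/rapid_cis/(rapid_pwfun eta pf).
rewrite (_ : cintegral (fun x => pwker f y (ofR x)) = invF (fun x => f (ofR x)) y); last first.
  apply: eq_cintegral => x; rewrite -cmk0 pwker_cmk.
  rewrite (_ : dotr 0 y = 0); last by rewrite -(scale0r 0) dotrZl mul0r.
  by rewrite mulr0 oppr0 expR0 mul1r.
move=> <-; rewrite mulrA -rmorphM /= -expRD subrr expR0 mul1r.
by [].
Qed.

Lemma invF_support r f y : 0 <= r -> pwfun (2 * pi * r) f -> r < enorm y ->
  invF (fun x => f (ofR x)) y = 0.
Proof.
move=> r0 pf ry; have s0 : 0 <= 2 * pi * r by rewrite !mulr_ge0// pi_ge0.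
have [M M0 hM] := pwfun_le n pf.
have y0 : 0 < enorm y by exact: le_lt_trans ry.
(* At height t y the shift gains exp(2 pi t |y|^2) while the growth of f costs exp(2 pi r t |y|);
   [a] is the net rate, positive exactly because |y| > r. *)
pose a := 2 * pi * enorm y * (enorm y - r).
have a0 : 0 < a by rewrite mulr_gt0 ?subr_gt0// !mulr_gt0// pi_gt0.
pose K := 2 * M * wtot n.
have K0 : 0 <= K by rewrite !mulr_ge0// wtot_ge0.
have bound t : 0 < t -> cabs (invF (fun x => f (ofR x)) y) * (1 + t * a) <= K.
  move=> t0; have E := @invF_shift _ f y (t *: y) pf s0.
  have et : enorm (t *: y) = t * enorm y.
    by rewrite /enorm dotrZl dotrZr mulrA -expr2 sqrtrM ?sqr_ge0// sqrtr_sqr gtr0_norm.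
  have B : cabs (invF (fun x => f (cmk x (t *: y))) y) <= 2 * (M * expR (2 * pi * r * (t * enorm y))) * wtot n.
    have rr := rapid_cis (2 * pi) y (rapid_pwfun (t *: y) pf).
    apply: cabs_cintegral_le; first by case: rr.
    move=> x; rewrite cabsM cabs_cis mul1r; apply: weight_bound; last exact: cabs_ge0.
    by rewrite -et.
  move: B; rewrite E cabsM cabs_real ger0_norm ?expR_ge0// => B.
  have e1 : 1 + t * a <= expR (t * a) by exact: expR_ge1Dx.
  apply: le_trans (ler_wpM2l (cabs_ge0 _) e1) _.
  have -> : expR (t * a) = expR (2 * pi * dotr (t *: y) y) * expR (- (2 * pi * r * (t * enorm y))).
    rewrite -expRD; congr expR; rewrite dotrZl -sqr_enorm /a; ring.
  rewrite mulrA expRN ler_pdivrMr ?expR_gt0// mulrC.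
  by apply: le_trans B _; rewrite /K le_eqVlt; apply/orP; left; apply/eqP; ring.
apply/eqP; rewrite -cabs_eq0 eq_le cabs_ge0 andbT leNgt; apply/negP => c0.
set c := cabs _ in c0 bound.
(* For this t the left side of [bound] equals c + K + c a, which exceeds K; so a finite t replaces
   the limit. *)
have t0 : 0 < K / (c * a) + 1.
  by rewrite ltr_wpDl// divr_ge0// ltW// mulr_gt0.
have := bound _ t0.
rewrite (_ : c * _ = c + K + c * a); last by field; rewrite !gt_eqF.
by have := mulr_gt0 c0 a0; lra.
Qed.

Lemma invF_testfn r f : 0 <= r -> pwfun (2 * pi * r) f ->
  in_Dr r (invF (fun x => f (ofR x))).
Proof.
move=> r0 pf; have rf := rapid_pwfun 0 pf.
have E : (fun x => f (cmk x 0)) = (fun x => f (ofR x)).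
  by apply/funext => x; rewrite cmk0.
rewrite E in rf; split; first exact: csmooth_invF.
have cl : closed [set x : 'rV[R]_n | enorm x <= r].
  rewrite (_ : [set x | _] = @enorm R n @^-1` [set t | t <= r])//.
  by apply: closed_comp => [x _|]; [exact: continuous_enorm|exact: closed_le].
apply: (@subset_trans _ (closure [set x : 'rV[R]_n | enorm x <= r])); last first.
  by rewrite -((closure_id _).1 cl).
apply: closure_subset => x /= fx.
rewrite leNgt; apply/negP => rx; move/eqP: fx; apply.
exact: (invF_support r0 pf rx).
Qed.

Lemma cintegralJ (g : 'rV[R]_n -> R[i]) : cdominated g ->
  cintegral (fun x => (g x)^*) = (cintegral g)^*.
Proof.
move=> dg; apply: complexP.
  by rewrite /=; apply: eq_Rintegral => x _; case: (g _).
transitivity (rint (fun x => -1 * complex.Im (g x))).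
  rewrite /=; apply: eq_Rintegral => x _; case: (g _) => a b /=; ring.
by rewrite rintZl ?mulN1r//; exact: cdominated_Im.
Qed.

Lemma cisJ (t : R) : (cis t)^* = cis (- t).
Proof. by rewrite /cis cosN sinN. Qed.

Lemma cdominatedJ (g : 'rV[R]_n -> R[i]) : cdominated g ->
  cdominated (fun x => (g x)^*).
Proof.
move=> dg; have [_ [C hC]] := dg.
split; last by exists C => x; rewrite cabsJ.
split.
  rewrite (_ : (fun _ => _) = fun x => complex.Re (g x)); first by case: dg => [[]].
  by apply/funext => x; case: (g x).
have [mi _] := dominatedZ (-1) (cdominated_Im dg).
rewrite (_ : (fun _ => _) = fun x => -1 * complex.Im (g x))//.
by apply/funext => x; case: (g x) => a b /=; ring.
Qed.

(** Near [x0] continuity gives d. Elsewhere some coordinate is at distance at least e, so D |x -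
    x0|^2 with D = 2B / e^2 exceeds the total oscillation 2B. *)
Lemma local_quad_bound (q : 'rV[R]_n -> R[i]) x0 B :
  (forall x, cabs (q x) <= B) ->
  (forall e, 0 < e -> exists2 d, 0 < d & forall x,
    (forall i, `|x 0 i - x0 0 i| < d) -> cabs (q x - q x0) <= e) ->
  forall d, 0 < d -> exists2 D, 0 <= D & forall x,
    cabs (q x - q x0) <= d + D * dotr (x - x0) (x - x0).
Proof.
move=> qB cq d d0; have [e e0 he] := cq d d0.
have B0 : 0 <= B := le_trans (cabs_ge0 _) (qB 0).
exists (2 * B / e ^+ 2); first by rewrite divr_ge0 ?sqr_ge0// mulr_ge0.
move=> x; have D0 := dotr_ge0 (x - x0).
have DD : 0 <= 2 * B / e ^+ 2 by rewrite divr_ge0 ?sqr_ge0// mulr_ge0.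
have [h|/existsNP[i /negP]] := pselect (forall i, `|x 0 i - x0 0 i| < e).
  by rewrite (le_trans (he x h))// lerDl mulr_ge0.
rewrite -leNgt => ex; have h2 : e ^+ 2 <= dotr (x - x0) (x - x0).
  apply: le_trans (sqr_coord_le (x - x0) i); rewrite !mxE -[leRHS]real_normK ?num_real//.
  by rewrite lerXn2r ?nnegrE// (ltW e0).
apply: (@le_trans _ _ (2 * B)).
  rewrite (le_trans (le_cabsD _ _))// cabsN mulr_natl mulr2n.
  by rewrite lerD.
apply: (@le_trans _ _ (2 * B / e ^+ 2 * dotr (x - x0) (x - x0))); last by rewrite lerDr ltW.
by rewrite -mulrA ler_peMr ?mulr_ge0// mulrC ler_pdivlMr ?exprn_gt0// mul1r.
Qed.

Lemma ccontinuous_quad (q : 'rV[R]_n -> R[i]) x0 : ccontinuous q ->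
  forall e, 0 < e -> exists2 d, 0 < d & forall x,
    (forall i, `|x 0 i - x0 0 i| < d) -> cabs (q x - q x0) <= e.
Proof.
move=> [c1 c2] e e0; have F : Filter (nbhs x0) by exact: nbhs_filter.
have e20 : 0 < e / 2 by exact: divr_gt0.
have /(@cvgrPdist_lt _ _ _ (nbhs x0) F) /(_ _ e20) /nbhs_ballP[d1 d10 h1] := c1 x0.
have /(@cvgrPdist_lt _ _ _ (nbhs x0) F) /(_ _ e20) /nbhs_ballP[d2 d20 h2] := c2 x0.
exists (Num.min d1 d2); first by rewrite lt_min d10.
move=> x hx; rewrite (le_trans (cabs_le_ReIm _))// ReD ImD ReN ImN.
have /h1 /= k1 : ball x0 d1 x.
  by apply/rV_ballP => // i; rewrite distrC (lt_le_trans (hx i))// ge_min lexx.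
have /h2 /= k2 : ball x0 d2 x.
  by apply/rV_ballP => // i; rewrite distrC (lt_le_trans (hx i))// ge_min lexx orbT.
by rewrite [e]splitr ltW// ltrD// distrC.
Qed.

Lemma testfn_cdominated r (g : 'rV[R]_n -> R[i]) (h : 'rV[R]_n -> R[i]) :
  testfn r g -> ccontinuous h -> cdominated (fun x => h x * g x).
Proof.
move=> tg ch; have cg := testfn_ccontinuous tg.
have [c1 c2] := ccontinuousM ch cg.
have v x : r < enorm x -> h x * g x = 0.
  by move=> rx; rewrite (testfn_eq0 tg rx) mulr0.
have [x|M1 M10 h1] := continuous_support_bounded c1 (r := r).
  by move=> /v ->.
have [x|M2 M20 h2] := continuous_support_bounded c2 (r := r).
  by move=> /v ->.
split; first exact: ctmeasurable_continuous.
exists ((M1 + M2) * (1 + r ^+ 2) ^+ n); apply: support_bound v _ _.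
- exact: ctmeasurable_continuous.
- by move=> x _; rewrite (le_trans (cabs_le_ReIm _))// lerD.
- exact: addr_ge0.
Qed.

(** With z = x0 + i eta, the inversion theorem is applied to the conjugate of x |-> f(x + i eta).
    Its transform is the conjugate of exp(2 pi eta.y) g(y), and conjugating the resulting formula at
    x0 yields the kernel [chr z]. *)
Theorem lapl_invF r f z : 0 <= r -> pwfun (2 * pi * r) f ->
  lapl (invF (fun x => f (ofR x))) z = f z.
Proof.
move=> r0 pf; have s0 : 0 <= 2 * pi * r by rewrite !mulr_ge0// pi_ge0.
rewrite [z]cmk_ReIm; set x0 := ReC z; set eta := ImC z.
set g := invF _; have tg : testfn r g by exact/in_Dr_testfn/invF_testfn.
pose q x := (f (cmk x eta))^*.
have rf := rapid_pwfun eta pf; have df := rapid_cdominated rf.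
have dq : cdominated q by exact: cdominatedJ.
have Fq y : fourier q y = ((expR (2 * pi * dotr eta y))%:C * g y)^*.
  rewrite -(invF_shift y eta pf s0) /invF -cintegralJ.
    by apply: eq_cintegral => x; rewrite rmorphM /q -cisJ.
  exact/rapid_cdominated/rapid_cis.
have cexpeta : ccontinuous (fun y : 'rV[R]_n => (expR (2 * pi * dotr eta y))%:C).
  rewrite (_ : (fun _ => _) = (fun y => cexp ((2 * pi)%:C * (dotr y eta)%:C))).
    apply: ccontinuous_cexp; apply: ccontinuousM; first exact: ccontinuous_cst.
    by split; [exact: continuous_dotr|exact: cst_continuous].
  by apply/funext => y; rewrite -rmorphM /cexp /= cis0 mulr1 dotrC.
have dFq : cdominated (fourier q).
  rewrite (_ : fourier q = fun y => ((expR (2 * pi * dotr eta y))%:C * g y)^*); last exact/funext.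
  by apply: cdominatedJ; exact: testfn_cdominated tg cexpeta.
have dFq2 : cdominated (fun y => (dotr y y)%:C * fourier q y).
  have cd : ccontinuous (fun y : 'rV[R]_n => (dotr y y)%:C).
    by split; [exact: continuous_dotrr|exact: cst_continuous].
  have := cdominatedJ (testfn_cdominated tg (ccontinuousM cd cexpeta)).
  congr cdominated; apply/funext => y; rewrite Fq -mulrA rmorphM.
  by congr (_ * _); rewrite /= oppr0.
have [_ [C hC]] := df.
have cq : ccontinuous (fun x => f (cmk x eta)) by apply: holomorphic_ccontinuous; case: pf.
have qB x : cabs (q x) <= `|C|.
  rewrite cabsJ (le_trans (hC x))// (le_trans (ler_wpM2r (weight_ge0 _) (ler_norm C)))//.
  by rewrite ler_piMr// weight_le1.
have loc e : 0 < e -> exists2 d, 0 < d & forall x,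
    (forall i, `|x 0 i - x0 0 i| < d) -> cabs (q x - q x0) <= e.
  move=> e0; have [d d0 hd] := ccontinuous_quad x0 cq e0.
  by exists d => // x /hd; rewrite /q -rmorphB cabsJ.
have := fourier_inversion dq dFq dFq2 (local_quad_bound qB loc).
move=> /(congr1 conjc); rewrite /q -/(conjc _) conjcK => <-.
have dchi := cdominated_character (2 * pi) x0 dFq.
rewrite -cintegralJ//; apply: eq_cintegral => y.
rewrite [RHS](_ : _ = cis (- (2 * pi * dotr x0 y)) * conjc (fourier q y)); last by rewrite -cisJ -rmorphM.
rewrite Fq conjcK mulrA; congr (_ * _).
rewrite /chr /cexp dotc_cmk [RHS]mulrC. rewrite !ReN !ImN !ReM !ImM /=.
congr ((expR _)%:C * cis _); rewrite ?(dotrC y); ring.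
Qed.

Theorem invF_lapl r (g : 'rV[R]_n -> R[i]) y : testfn r g ->
  (forall N, exists M, forall z, (1 + cenorm z ^+ 2) ^+ N *
    expR (- (2 * pi * r * enorm (ImC z))) * cabs (lapl g z) <= M) ->
  0 <= r -> invF (fun x => lapl g (ofR x)) y = g y.
Proof.
move=> tg bg r0.
have pf : pwfun (2 * pi * r) (lapl g) by split=> //; exact: lapl_holomorphic tg.
have rf := rapid_pwfun 0 pf.
have E : (fun x => lapl g (cmk x 0)) = fourier g.
  by apply/funext => x; rewrite cmk0 lapl_ofR.
rewrite E in rf.
have dg : cdominated g.
  have := testfn_cdominated tg (ccontinuous_cst 1).
  by under eq_fun do rewrite mul1r.
have [M M0 gM] := testfn_bounded tg.
have := fourier_inversion dg (rapid_cdominated rf) (rapid_cdominated (rapid_dotr rf))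
  (local_quad_bound gM (ccontinuous_quad y (testfn_ccontinuous tg))).
move=> <-; apply: eq_cintegral => x; by rewrite lapl_ofR dotrC.
Qed.

End paley_wiener.

(** * Uniform boundedness and Riesz representation *)

Section hilbert.
Variables (R : realType) (H : completeNormedModType R[i]).
Variable ip : {dot H for Num.conj}.
Hypothesis ip_norm : forall u : H, `|u| ^+ 2 = ip u u.
Implicit Types u v w x : H.

Definition hnorm u : R := complex.Re `|u|.

Lemma hnormE u : `|u| = (hnorm u)%:C.
Proof. by rewrite /hnorm RRe_real. Qed.

Lemma hnorm_ge0 u : 0 <= hnorm u.
Proof. by rewrite -lecR -hnormE normr_ge0. Qed.

Lemma hnorm0 : hnorm 0 = 0.
Proof. by rewrite /hnorm normr0. Qed.

Lemma hnorm_eq0 u : hnorm u = 0 -> u = 0.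
Proof. by move=> u0; apply/eqP; rewrite -normr_eq0 hnormE u0. Qed.

Lemma le_hnormD u v : hnorm (u + v) <= hnorm u + hnorm v.
Proof. by rewrite -lecR rmorphD /= -!hnormE ler_normD. Qed.

Lemma hnormZ (a : R[i]) u : hnorm (a *: u) = cabs a * hnorm u.
Proof. by rewrite /hnorm normrZ normcE (hnormE u) ReM /= mulr0 subr0. Qed.

Lemma hnormN u : hnorm (- u) = hnorm u.
Proof. by rewrite /hnorm normrN. Qed.

Lemma hnormB u v : hnorm (u - v) = hnorm (v - u).
Proof. by rewrite -hnormN opprB. Qed.

Lemma ipC u v : ip u v = conjc (ip v u).
Proof. by rewrite (hermitian_subproof u v) expr0 mul1r. Qed.

Lemma ipDl u v w : ip (u + v) w = ip u w + ip v w.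
Proof. exact: linearDl. Qed.

Lemma ipBl u v w : ip (u - v) w = ip u w - ip v w.
Proof. exact: linearBl. Qed.

Lemma ipZl (a : R[i]) u v : ip (a *: u) v = a * ip u v.
Proof. by rewrite linearZl_LR. Qed.

Lemma ipDr u v w : ip w (u + v) = ip w u + ip w v.
Proof. exact: linearDr. Qed.

Lemma ipBr u v w : ip w (u - v) = ip w u - ip w v.
Proof. exact: linearBr. Qed.

Lemma ipZr (a : R[i]) u v : ip u (a *: v) = conjc a * ip u v.
Proof. by rewrite linearZr_LR. Qed.

Lemma sqr_hnorm u : hnorm u ^+ 2 = complex.Re (ip u u).
Proof. by rewrite -ip_norm hnormE -rmorphXn. Qed.

Definition rip u v : R := complex.Re (ip u v).

Lemma ripC u v : rip u v = rip v u.
Proof. by rewrite /rip ipC; case: (ip v u). Qed.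

Lemma ripDl u v w : rip (u + v) w = rip u w + rip v w.
Proof. by rewrite /rip ipDl ReD. Qed.

Lemma ripZl (t : R) u v : rip (t%:C *: u) v = t * rip u v.
Proof. by rewrite /rip ipZl ReM /= mul0r subr0. Qed.

Lemma ripDr u v w : rip w (u + v) = rip w u + rip w v.
Proof. by rewrite ripC ripDl !(ripC w). Qed.

Lemma ripZr (t : R) u v : rip u (t%:C *: v) = t * rip u v.
Proof. by rewrite ripC ripZl ripC. Qed.

Lemma sqr_hnormD u v :
  hnorm (u + v) ^+ 2 = hnorm u ^+ 2 + 2 * rip u v + hnorm v ^+ 2.
Proof. by rewrite !sqr_hnorm -!/(rip _ _) ripDl !ripDr (ripC v u); ring. Qed.

Lemma sqr_hnormZ (t : R) u : hnorm (t%:C *: u) ^+ 2 = t ^+ 2 * hnorm u ^+ 2.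
Proof. by rewrite hnormZ exprMn cabs_real real_normK// num_real. Qed.

Lemma cabs_ip_le u v : cabs (ip u v) <= hnorm u * hnorm v.
Proof.
have [v0|v0] := eqVneq (hnorm v) 0.
  by rewrite (hnorm_eq0 v0) linear0r cabs0 mulr_ge0// hnorm_ge0.
have v2 : 0 < hnorm v ^+ 2 by rewrite exprn_gt0// lt_neqAle eq_sym v0 hnorm_ge0.
pose c := ip u v; pose k : R := (hnorm v ^+ 2)^-1.
have h : 0 <= hnorm (u - (k%:C * c) *: v) ^+ 2 by exact: sqr_ge0.
have E : hnorm (u - (k%:C * c) *: v) ^+ 2 = hnorm u ^+ 2 - k * cabs c ^+ 2.
  (* The scalar is split into its real part k and c, so that the real expansion of the square
     applies. *)
  have -> : u - (k%:C * c) *: v = u + (- k)%:C *: (c *: v).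
    by rewrite scalerA rmorphN mulNr scaleNr.
  rewrite sqr_hnormD ripZr sqr_hnormZ hnormZ /rip ipZr -/c.
  have -> : complex.Re (conjc c * c) = cabs c ^+ 2.
    by rewrite sqr_cabs; case: (c) => a b /=; ring.
  have k0 : k * hnorm v ^+ 2 = 1 by rewrite /k mulVf// gt_eqF.
  have E (a b d e : R) : e * d = 1 -> a + 2 * (- e * b ^+ 2) + (- e) ^+ 2 * (b ^+ 2 * d) = a - e * b ^+ 2.
    by move=> h1; rewrite (_ : (- e) ^+ 2 * _ = e * (e * d) * b ^+ 2); [rewrite h1|]; ring.
  by rewrite exprMn E.
rewrite E subr_ge0 /k mulrC ler_pdivrMr// -exprMn in h.
by rewrite -(@ler_pXn2r _ 2)// nnegrE ?mulr_ge0 ?hnorm_ge0// cabs_ge0.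
Qed.

Lemma ip_inj u v : (forall w, ip u w = ip v w) -> u = v.
Proof.
move=> E; apply/eqP; rewrite -subr_eq0; apply/eqP/hnorm_eq0/eqP.
by rewrite -sqrf_eq0 sqr_hnorm ipBl E subrr.
Qed.

Lemma hcauchy_cvg (x : nat -> H) :
  (forall e : R, 0 < e -> exists N, forall k l, (N <= k)%N -> (N <= l)%N ->
     hnorm (x k - x l) <= e) ->
  exists y, forall e : R, 0 < e -> exists N, forall k, (N <= k)%N ->
     hnorm (y - x k) <= e.
Proof.
move=> cx.
have cvx : cvgn x.
  apply: cauchy_cvg; apply/cauchy_ballP => e e0.
  have eE : e = (complex.Re e)%:C by rewrite RRe_real// gtr0_real.
  have e1 : 0 < complex.Re e by rewrite -ltcR -eE.
  have [N hN] := cx _ (divr_gt0 e1 (ltr0n _ 2)).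
  exists (x @` [set k | (N <= k)%N], x @` [set k | (N <= k)%N]) => /=.
    by split; exists N => // k Nk; exists k.
  move=> -[_ _] /= [[k Nk <-] [l Nl <-]]; rewrite -ball_normE /= eE hnormE ltcR.
  by rewrite (le_lt_trans (hN _ _ Nk Nl))// ltr_pdivrMr// ltr_pMr// ltr1n.
exists (limn x) => e e0.
have e1 : (0 : R[i]) < e%:C by rewrite ltcR.
have /cvgrPdist_le /(_ _ e1) [N _ hN] := cvx.
by exists N => k /hN /=; rewrite hnormE lecR.
Qed.

Lemma hseries_cvg (x : nat -> H) (C q : R) : 0 <= C -> 0 < q < 1 ->
  (forall k, hnorm (x k.+1 - x k) <= C * q ^+ k) ->
  exists y, forall k, hnorm (y - x k) <= C * q ^+ k / (1 - q).
Proof.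
move=> C0 /andP[q0 q1] hx; have q1' : 0 < 1 - q by rewrite subr_gt0.
have tail k l : hnorm (x (k + l)%N - x k) <= C * q ^+ k / (1 - q).
  have : hnorm (x (k + l)%N - x k) <= C * q ^+ k * ((1 - q ^+ l) / (1 - q)).
    elim: l => [|l IHl]; first by rewrite addn0 subrr hnorm0 expr0 subrr mul0r mulr0.
    rewrite addnS (_ : x _ - x k = (x (k + l).+1 - x (k + l)%N) + (x (k + l)%N - x k)); last first.
      by rewrite addrA subrK.
    rewrite (le_trans (le_hnormD _ _))// (le_trans (lerD (hx _) IHl))//.
    rewrite le_eqVlt; apply/orP; left; apply/eqP; rewrite exprD exprS; field.
    by rewrite gt_eqF.
  move=> /le_trans; apply; apply: ler_wpM2l.
    by rewrite mulr_ge0// exprn_ge0// ltW.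
  by rewrite ler_piMl ?invr_ge0 ?(ltW q1')// gerBl exprn_ge0// ltW.
have qcvg : (fun k => C * q ^+ k / (1 - q)) @ \oo --> 0.
  rewrite -[X in _ --> X](mul0r (1 - q)^-1); apply: cvgMl.
  rewrite -[X in _ --> X](mulr0 C); apply: cvgMr.
  by apply: cvg_expr; rewrite ger0_norm// ltW.
have small e : 0 < e -> exists N, forall k, (N <= k)%N -> C * q ^+ k / (1 - q) <= e.
  move=> e0; have /cvgrPdist_le /(_ _ e0) [N _ hN] := qcvg.
  exists N => k /hN /=; rewrite sub0r normrN => /(le_trans (ler_norm _)); exact.
have [e e0|y hy] := hcauchy_cvg (x := x).
  have [N hN] := small _ (divr_gt0 e0 (ltr0n _ 2)).
  exists N => k l Nk Nl.
  rewrite -(subrK (x N) (x k)) -addrA (le_trans (le_hnormD _ _))//.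
  rewrite [e]splitr lerD// ?(hnormB (x N)).
    by rewrite -(subnKC Nk) (le_trans (tail _ _))// hN.
  by rewrite -(subnKC Nl) (le_trans (tail _ _))// hN.
exists y => k; apply/ler_addgt0Pr => e e0.
have [N hN] := hy _ e0; have h := hN (k + N)%N (leq_addl _ _).
rewrite -(subrK (x (k + N)%N) y) -addrA (le_trans (le_hnormD _ _))//.
by rewrite [leRHS]addrC lerD.
Qed.

(* Sokal's gliding hump: a sign at each step makes [ip v_k x_(k+1)] large, and
   the later steps are too short to undo this. *)
Theorem uniform_boundedness (I : Type) (v : I -> H) :
  (forall u, exists M : R, forall i, cabs (ip (v i) u) <= M) ->
  exists M : R, forall i, hnorm (v i) <= M.
Proof.
move=> bv; apply: contrapT => nb.
have big (M : R) : exists i, M < hnorm (v i).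
  apply: contrapT => /forallNP hM; apply: nb; exists M => i.
  by rewrite leNgt; apply/negP/hM.
(* The 3^k matches the step lengths 3^-k chosen below, and the 2 makes up for the half lost to the
   later steps. *)
have [idx hidx] := choice (fun k : nat => big (2 * k%:R * 3 ^+ k)).
pose w k : H := ((3^-1) ^+ k / hnorm (v (idx k)))%:C *: v (idx k).
have vk0 k : 0 < hnorm (v (idx k)).
  by apply: le_lt_trans (hidx k); rewrite !mulr_ge0 ?exprn_ge0.
have hw k : hnorm (w k) = (3^-1) ^+ k.
  rewrite /w hnormZ cabs_real ger0_norm; first by rewrite divfK// gt_eqF.
  by rewrite divr_ge0 ?hnorm_ge0// exprn_ge0// invr_ge0.
have ipw k : ip (v (idx k)) (w k) = ((3^-1) ^+ k * hnorm (v (idx k)))%:C.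
  rewrite /w ipZr -ip_norm hnormE -rmorphXn.
  rewrite (_ : conjc _ = ((3^-1) ^+ k / hnorm (v (idx k)))%:C).
    by rewrite -rmorphM /=; congr _%:C; field; rewrite gt_eqF ?vk0.
  by rewrite /= oppr0.
pose step k y := if 3^-1 ^+ k * hnorm (v (idx k)) <= cabs (ip (v (idx k)) (y + w k))
  then y + w k else y - w k.
have hstep k y : 3^-1 ^+ k * hnorm (v (idx k)) <= cabs (ip (v (idx k)) (step k y)).
  (* If both signs failed, the difference of the two values, twice the product with [w k], would be
     too small. *)
  rewrite /step; case: ifPn => //; rewrite -ltNge => lt1; rewrite leNgt; apply/negP => lt2.
  have : cabs (ip (v (idx k)) (y + w k) - ip (v (idx k)) (y - w k)) <
     3^-1 ^+ k * hnorm (v (idx k)) + 3^-1 ^+ k * hnorm (v (idx k)).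
    by rewrite (le_lt_trans (le_cabsD _ _))// cabsN ltrD.
  rewrite ipDr ipBr opprB addrC addrA subrK -mulr2n ipw -rmorphMn cabs_real.
  by rewrite mulr2n ltNge ler_norm.
pose x := fix x k := if k is k'.+1 then step k' (x k') else 0.
have dx k : hnorm (x k.+1 - x k) <= 1 * 3^-1 ^+ k.
  rewrite mul1r -hw /= /step; case: ifP => _.
    by rewrite addrAC subrr add0r.
  by rewrite addrAC subrr add0r hnormN.
have [||y hy] := hseries_cvg _ _ dx => //.
  by rewrite invr_gt0 invf_lt1//= ltr0n ltr1n.
have [M hM] := bv y.
pose k := (Num.truncn `|M|).+1.
have kM : M < k%:R by rewrite (le_lt_trans (ler_norm _))// truncnS_gt.
have := hM (idx k); apply/negP; rewrite -ltNge (lt_le_trans kM)//.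
(* The steps after k have total length at most 3^-(k+1) / (1 - 1/3) = 3^-k / 2. *)
have h1 : cabs (ip (v (idx k)) (x k.+1 - y)) <= hnorm (v (idx k)) * (3^-1 ^+ k / 2).
  rewrite (le_trans (cabs_ip_le _ _))// ler_wpM2l ?hnorm_ge0// hnormB (le_trans (hy _))//.
  by rewrite mul1r exprS le_eqVlt; apply/orP; left; apply/eqP; field.
have h2 := hstep k (x k); rewrite -/(x k.+1) in h2.
have h3 : cabs (ip (v (idx k)) (x k.+1)) <= cabs (ip (v (idx k)) y) +
    hnorm (v (idx k)) * (3^-1 ^+ k / 2).
  rewrite -[x k.+1](subrK y) addrC ipDr; apply: (le_trans (le_cabsD _ _)).
  by rewrite lerD2l; exact: h1.
have h4 : k%:R <= 3^-1 ^+ k * hnorm (v (idx k)) / 2.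
  rewrite ler_pdivlMr// exprVn ler_pdivlMl ?exprn_gt0//.
  by apply: le_trans (ltW (hidx k)); rewrite mulrC (mulrC 2).
lra.
Qed.

(** The first-order condition for a minimum. The test value is t = -a / (b + 1), where b + 1 also
    covers b = 0. *)
Lemma sqr_root_zero (a b : R) : 0 <= b -> (forall t, 0 <= 2 * t * a + t ^+ 2 * b) -> a = 0.
Proof.
move=> b0 h; apply/eqP; apply: contrapT => /negP a0.
have b1 : 0 < b + 1 by rewrite ltr_wpDl.
have := h (- a / (b + 1)).
have -> : 2 * (- a / (b + 1)) * a + (- a / (b + 1)) ^+ 2 * b =
   - (a ^+ 2 * (b + 2) / (b + 1) ^+ 2) by field; rewrite gt_eqF.
apply/negP; rewrite -ltNge oppr_lt0 divr_gt0// ?exprn_gt0//.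
by rewrite mulr_gt0 ?exprn_even_gt0// ltr_wpDl.
Qed.

(* The representing vector minimizes [|u|^2 - 2 Re (L u)]. *)
Theorem riesz_representation (L : H -> R[i]) (C : R) :
  (forall (a : R[i]) u v, L (a *: u + v) = conjc a * L u + L v) ->
  (forall u, cabs (L u) <= C * hnorm u) ->
  exists v, forall u, ip v u = L u.
Proof.
move=> linL bL.
have LD u v : L (u + v) = L u + L v.
  by rewrite -[u]scale1r linL /= oppr0 mul1r scale1r.
have L0 : L 0 = 0 by apply: (addrI (L 0)); rewrite -LD !addr0.
have LZ a u : L (a *: u) = conjc a * L u by rewrite -[a *: u]addr0 linL L0 addr0.
pose l u := complex.Re (L u).
have lD u v : l (u + v) = l u + l v by rewrite /l LD ReD.
have lZ (t : R) u : l (t%:C *: u) = t * l u.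
  by rewrite /l LZ ReM /= oppr0 mul0r subr0.
have lb u : l u <= C * hnorm u.
  exact: le_trans (ler_norm _) (le_trans (Re_le_cabs _) (bL u)).
pose J u := hnorm u ^+ 2 - 2 * l u.
have JD u h : J (u + h) = J u + 2 * (rip u h - l h) + hnorm h ^+ 2.
  by rewrite /J sqr_hnormD lD; ring.
(* The parallelogram law for [J]: the linear terms cancel. As [J] at the midpoint is at least its
   infimum, minimizing sequences are Cauchy. *)
have Jpar u v : hnorm (u - v) ^+ 2 = 2 * J u + 2 * J v - 4 * J ((2^-1)%:C *: (u + v)).
  rewrite /J sqr_hnormZ lZ lD sqr_hnormD.
  rewrite -[- v]scaleN1r (_ : -1 = (-1)%:C); last by rewrite rmorphN1.
  by rewrite sqr_hnormD sqr_hnormZ ripZr; field.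
have Jlb u : - C ^+ 2 <= J u.
  have := lb u; have := sqr_ge0 (hnorm u - C).
  rewrite /J sqrrB; move: (hnorm u) (l u) => a b; nra.
pose S := [set t | exists u, t = J u].
have Slb : has_inf S.
  split; first by exists (J 0); exists 0.
  by exists (- C ^+ 2) => _ [u ->]; exact: Jlb.
pose d := inf S.
have dJ u : d <= J u by apply: ge_inf; [case: Slb|exists u].
have ex k : exists u, J u <= d + (k.+1%:R)^-1.
  have k0 : 0 < (k.+1%:R : R)^-1 by rewrite invr_gt0.
  by have [_ [u ->] /ltW] := inf_adherent k0 Slb; exists u.
have [x hx] := choice ex.
have small e : 0 < e -> exists N, forall k, (N <= k)%N -> J (x k) <= d + e.
  move=> e0; exists (Num.truncn e^-1) => k Nk.
  rewrite (le_trans (hx k))// lerD2l invf_ple ?posrE//.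
  by rewrite ltW// (lt_le_trans (truncnS_gt _))// ler_nat ltnS.
have [e e0|v hv] := hcauchy_cvg (x := x).
  have [N hN] := small (e ^+ 2 / 4) (divr_gt0 (exprn_gt0 2 e0) (ltr0n _ 4)).
  exists N => k m Nk Nm; rewrite -(@ler_pXn2r _ 2)// ?nnegrE ?hnorm_ge0 ?(ltW e0)//.
  rewrite Jpar; have := hN _ Nk; have := hN _ Nm.
  by have := dJ ((2^-1)%:C *: (x k + x m)); lra.
(* The variation is taken at a near-minimizer u close to v: near-minimality and the replacement of u
   by v cost e / 2 each. *)
have Re_eq h : rip v h = l h.
  apply/eqP; rewrite -subr_eq0; apply/eqP.
  apply: (@sqr_root_zero _ (hnorm h ^+ 2)); first exact: sqr_ge0.
  move=> t; rewrite -(addr0 (_ + _)).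
  apply/ler_addgt0Pr => e e0.
  have K0 : 0 < 2 * (2 * `|t| * hnorm h + 1).
    by rewrite mulr_gt0// ltr_wpDl// !mulr_ge0 ?hnorm_ge0.
  have [N1 hN1] := hv _ (divr_gt0 e0 K0).
  have [N2 hN2] := small _ (divr_gt0 e0 (ltr0n _ 2)).
  have := hN1 _ (leq_addr N2 N1); have := hN2 _ (leq_addl N1 N2).
  set u := x _ => h1 h2.
  have := dJ (u + t%:C *: h); rewrite JD ripZr lZ sqr_hnormZ => h3.
  have h4 : `|t * (rip v h - rip u h)| <= `|t| * (hnorm (v - u) * hnorm h).
    rewrite normrM ler_wpM2l//.
    have -> : rip v h - rip u h = rip (v - u) h.
      by rewrite /rip ipBl ReD ReN.
    exact: le_trans (Re_le_cabs _) (cabs_ip_le _ _).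
  have h5 : 2 * (`|t| * (hnorm (v - u) * hnorm h)) <= e / 2.
    rewrite ler_pdivlMr// in h2.
    have := ler_wpM2r (hnorm_ge0 h) (ler_wpM2r (normr_ge0 t) h2).
    have := hnorm_ge0 (v - u).
    nra.
  move: h4; rewrite ler_norml => /andP[h6 h7].
  rewrite mulrBr in h6 h7; lra.
exists v => u; apply: complexP; first exact: Re_eq.
(* Testing against i u turns the identity of real parts into that of imaginary parts. *)
have := Re_eq ('i *: u); rewrite /rip /l ipZr LZ !ReM /=.
rewrite !mul0r !sub0r !mulN1r !opprK; exact.
Qed.

End hilbert.

(** * Continuity tested on a subbase *)

Section subbase.
Variables (T : topologicalType) (I : choiceType) (D : set I) (b : I -> set T).
Hypothesis openE : open = [set \bigcup_(A in D') A | D' in subset^~ (finI_from D b)].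

Lemma subbase_open i : D i -> open (b i).
Proof.
move=> Di; rewrite openE; exists [set b i]; last by rewrite bigcup_set1.
by move=> _ ->; exact: finI_from1.
Qed.

Lemma subbase_continuous (S : topologicalType) (f : S -> T) :
  (forall i, D i -> open (f @^-1` b i)) -> continuous f.
Proof.
move=> ob; apply/continuousP => A; rewrite openE => -[D' sD' <-].
rewrite preimage_bigcup; apply: bigcup_open => B /sD' [E sE <-].
rewrite preimage_bigcap bigcap_fset big_seq.
apply: (big_ind open) => [|P Q|i iE]; [exact: openT|exact: openI|apply: ob].
by have := sE i iE; rewrite inE.
Qed.

End subbase.


(** * Linearity of the scalar transforms and finiteness of derivative bounds *)

Section scalar_linearity.
Context {R : realType} {n : nat}.
Implicit Types g h q p : 'rV[R]_n -> R[i].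

Lemma lapl_linear r (a : R[i]) g h z : testfn r g -> testfn r h ->
  lapl (fun x => a * g x + h x) z = a * lapl g z + lapl h z.
Proof.
move=> tg th; have dg := cdominated_lapl z tg; have dh := cdominated_lapl z th.
rewrite /lapl -cintegralZ// -cintegralD//; last exact: cdominatedZ.
by apply: eq_cintegral => x; ring.
Qed.

Lemma invF_linear (a : R[i]) q p y : rapid q -> rapid p ->
  invF (fun x => a * q x + p x) y = a * invF q y + invF p y.
Proof.
move=> rq rp; have dq := rapid_cdominated (rapid_cis (2 * pi) y rq).
have dp := rapid_cdominated (rapid_cis (2 * pi) y rp).
rewrite /invF -cintegralZ// -cintegralD//; last exact: cdominatedZ.
by apply: eq_cintegral => x; ring.
Qed.

Lemma cdpartialD s g h : csmooth g -> csmooth h -> forall x,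
  cdpartial s (fun x => g x + h x) x = cdpartial s g x + cdpartial s h x.
Proof.
move=> [g1 g2] [h1 h2] x; rewrite /cdpartial.
have E (k : R[i] -> R) (kD : forall z w, k (z + w) = k z + k w) :
    smooth (fun x => k (g x)) -> smooth (fun x => k (h x)) ->
    dpartial s (fun x => k (g x + h x)) x =
    dpartial s (fun x => k (g x)) x + dpartial s (fun x => k (h x)) x.
  move=> sg sh; rewrite (_ : (fun x => k (g x + h x)) =
    1 *: (fun x => k (g x)) + (fun x => k (h x))).
    by rewrite dpartial_linear// scale1r.
  by rewrite scale1r; apply/funext => t; rewrite kD.
by apply: complexP; rewrite ?ReD ?ImD /=;
  [exact: (E _ (@ReD R) g1 h1)|exact: (E _ (@ImD R) g2 h2)].
Qed.

Lemma size_seq_of_multiindex (a : 'I_n -> nat) :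
  size (seq_of_multiindex a) = (\sum_i a i)%N.
Proof.
rewrite /seq_of_multiindex size_flatten sumnE /shape -map_comp big_map big_enum /=.
by apply: eq_bigr => i _; rewrite size_nseq.
Qed.

(** Every entry of a multi-index of order at most N is itself at most N, so the finite functions
    indexing the maximum in [nu] reach all of them. *)
Lemma multiindex_ffun N (a : 'I_n -> nat) : (\sum_i a i <= N)%N ->
  exists b : {ffun 'I_n -> 'I_N.+1}, a = fun i => b i : nat.
Proof.
move=> aN; exists [ffun i => inord (a i)]; apply/funext => i.
rewrite ffunE inordK// ltnS (leq_trans _ aN)//.
by rewrite (bigD1 i)//= leq_addr.
Qed.

Lemma testfn_cD_bounded r N g : testfn r g ->
  exists M, forall a, (\sum_i a i <= N)%N -> forall x, cabs (cD a g x) <= M.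
Proof.
move=> tg; have bd (b : {ffun 'I_n -> 'I_N.+1}) : exists M : R, 0 <= M /\
    forall x, cabs (cD (fun i => b i : nat) g x) <= M.
  have [M M0 hM] := testfn_bounded (testfn_cdpartial
    (seq_of_multiindex (fun i => b i : nat)) tg).
  by exists M.
have [M hM] := choice bd; exists (\sum_b M b) => a /multiindex_ffun[b ->] x.
rewrite (le_trans ((hM b).2 x))// (bigD1 b)//= lerDl.
by apply: sumr_ge0 => c _; case: (hM c).
Qed.

End scalar_linearity.

(** * The seminorms of the two spaces *)

Section seminorms.
Context {R : realType} {H : completeNormedModType R[i]}.
Variables (ip : {dot H for Num.conj}) (n : nat).

Lemma nu_le N u (phi : 'rV[R]_n -> H) c : 0 <= c ->
  (forall a, (\sum_i a i <= N)%N -> forall x,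
     cabs (cD a (fun x => ip (phi x) u) x) <= c) ->
  (nu ip N u phi <= c%:E)%E.
Proof.
move=> c0 hc; apply: bigmax_le; first by rewrite lee_fin.
move=> a aN; apply: ge_ereal_sup => _ [x _ <-]; rewrite lee_fin; exact: hc.
Qed.

Lemma nu_bound N u (phi : 'rV[R]_n -> H) c : (nu ip N u phi <= c%:E)%E ->
  forall a, (\sum_i a i <= N)%N -> forall x,
     cabs (cD a (fun x => ip (phi x) u) x) <= c.
Proof.
move=> hc a aN x; have [b ab] := multiindex_ffun aN.
rewrite -lee_fin (le_trans _ hc)//; apply: le_trans (le_bigmax_cond _ _ (j := b) _).
  by rewrite ab; apply: ereal_sup_ubound; exists x.
by rewrite -[X in (X <= _)%N](_ : \sum_i a i = _)%N// ab.
Qed.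

Lemma nu_ge0 N u (phi : 'rV[R]_n -> H) : (0 <= nu ip N u phi)%E.
Proof. exact: bigmax_ge_id. Qed.

Lemma nu0 N u : (nu ip N u (0%R : 'rV[R]_n -> H) <= 0%:E)%E.
Proof.
apply: nu_le => // a _ x; rewrite /cD /cdpartial.
have E t : dpartial t (0 : 'rV[R]_n -> R) = 0.
  have := @dpartial_linear R n t (-1) 0 0 smooth0 smooth0.
  by rewrite scaler0 addr0 scaleN1r addNr.
rewrite (_ : (fun x => complex.Re _) = 0); last by apply/funext => y; rewrite linear0l.
rewrite (_ : (fun x => complex.Im _) = 0); last by apply/funext => y; rewrite linear0l.
by rewrite E (_ : _ +i* _ = 0) ?cabs0.
Qed.

Lemma rho0 s N u : (rho ip s N u (0%R : 'rV[R[i]]_n -> H) <= 0%:E)%E.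
Proof.
apply: ge_ereal_sup => _ [z _ <-].
by rewrite lee_fin linear0l cabs0 mulr0.
Qed.

Lemma rho_le s N u (F : 'rV[R[i]]_n -> H) c :
  (forall z, (1 + cenorm z ^+ 2) ^+ N * expR (- (s * enorm (ImC z))) *
    cabs (ip (F z) u) <= c) -> (rho ip s N u F <= c%:E)%E.
Proof.
by move=> hc; apply: ge_ereal_sup => _ [x _ <-]; rewrite lee_fin; exact: hc.
Qed.

Lemma rho_bound s N u (F : 'rV[R[i]]_n -> H) c : (rho ip s N u F <= c%:E)%E ->
  forall z, (1 + cenorm z ^+ 2) ^+ N * expR (- (s * enorm (ImC z))) *
    cabs (ip (F z) u) <= c.
Proof.
move=> hc z; rewrite -lee_fin (le_trans _ hc)//.
by apply: ereal_sup_ubound; exists z.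
Qed.

Lemma rho_ge0 s N u (F : 'rV[R[i]]_n -> H) : (0 <= rho ip s N u F)%E.
Proof.
apply: (@le_trans _ _ ((1 + cenorm (0 : 'rV[R[i]]_n) ^+ 2) ^+ N *
  expR (- (s * enorm (ImC (0 : 'rV[R[i]]_n)))) * cabs (ip (F 0) u))%:E).
  rewrite lee_fin mulr_ge0 ?cabs_ge0// mulr_ge0 ?expR_ge0//.
  by rewrite exprn_ge0// addr_ge0// sqr_ge0.
by apply: ereal_sup_ubound; exists 0.
Qed.

Lemma ereal_lt_fin (X : \bar R) (e : R) : (0 <= X)%E -> (X < e%:E)%E ->
  exists c, [/\ 0 <= c, c < e & (X <= c%:E)%E].
Proof.
case: X => [x| |]//; rewrite lee_fin lte_fin => x0 xe.
by exists x; split.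
Qed.

Lemma DH_in_Dr r (phi : DHspace ip n r) u : in_Dr r (fun x => ip (phi x) u).
Proof. by have := DHvalP phi; rewrite inE; apply. Qed.

Lemma DH_testfn r (phi : DHspace ip n r) u : testfn r (fun x => ip (phi x) u).
Proof. exact/in_Dr_testfn/DH_in_Dr. Qed.

Lemma PWH_pwfun s (F : PWHspace ip n s) u : pwfun s (fun z => ip (F z) u).
Proof.
have := PWHvalP F; rewrite inE => -[hF bF]; split; first exact: hF.
by move=> N; exact/rho_bounded.
Qed.

Lemma nuD r N u (f g : DHspace ip n r) c d : 0 <= c -> 0 <= d ->
  (nu ip N u f <= c%:E)%E -> (nu ip N u g <= d%:E)%E ->
  (nu ip N u (f + g)%R <= (c + d)%:E)%E.
Proof.
move=> c0 d0 /nu_bound hf /nu_bound hg; apply: nu_le; first exact: addr_ge0.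
move=> a aN x; have [[sf _] [sg _]] := (DH_in_Dr f u, DH_in_Dr g u).
rewrite /cD (_ : (fun x => _) = (fun x => ip (f x) u + ip (g x) u)).
  by rewrite cdpartialD// (le_trans (le_cabsD _ _))// lerD//; [exact: hf|exact: hg].
by apply/funext => t; rewrite -ipDl.
Qed.

Lemma rhoD s N u (F G : 'rV[R[i]]_n -> H) c d :
  (rho ip s N u F <= c%:E)%E -> (rho ip s N u G <= d%:E)%E ->
  (rho ip s N u (F + G)%R <= (c + d)%:E)%E.
Proof.
move=> /rho_bound hF /rho_bound hG; apply: rho_le => z.
apply: le_trans (lerD (hF z) (hG z)); rewrite -mulrDr ler_wpM2l//.
  by rewrite mulr_ge0 ?expR_ge0// exprn_ge0// addr_ge0// sqr_ge0.
rewrite (_ : ip _ u = ip (F z) u + ip (G z) u) ?le_cabsD//.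
by rewrite -ipDl.
Qed.

End seminorms.

(** * The transforms of Hilbert space valued functions *)

Section weak_transforms.
Context {R : realType} {H : completeNormedModType R[i]}.
Variables (ip : {dot H for Num.conj}).
Hypothesis ip_norm : forall u : H, `|u| ^+ 2 = ip u u.
Variables (n : nat) (r : R).
Hypothesis r_gt0 : 0 < r.
Local Notation D := (DHspace ip n r).
Local Notation PW := (PWHspace ip n (2 * pi * r)).
Implicit Types (phi psi : D) (F G : PW) (u v w : H).

Let r_ge0 : 0 <= r := ltW r_gt0.

Lemma ip_linr (a : R[i]) u v w : ip w (a *: u + v) = conjc a * ip w u + ip w v.
Proof. by rewrite ipDr ipZr. Qed.

Lemma DH_bounded phi : exists2 M, 0 <= M & forall x, hnorm (phi x) <= M.
Proof.
have [u|M hM] := uniform_boundedness ip_norm (v := phi).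
  by have [M _ hM] := testfn_bounded (DH_testfn phi u); exists M.
by exists M => //; exact: le_trans (hnorm_ge0 _) (hM 0).
Qed.

(** Riesz requires a bound linear in the norm of u; it comes from |(phi(x), u)| <= M |u| with M
    independent of u. *)
Lemma weak_lapl phi z : exists v, forall u, ip v u = lapl (fun x => ip (phi x) u) z.
Proof.
have [M M0 hM] := DH_bounded phi.
apply: (riesz_representation ip_norm
  (L := fun u => lapl (fun x => ip (phi x) u) z) (C := @laplK R n r * M * expR (2 * pi * r * enorm (ImC z)))) => [a u v|u].
  by rewrite -(lapl_linear _ _ (DH_testfn phi u) (DH_testfn phi v));
    apply: eq_cintegral => x; rewrite ip_linr.
rewrite (le_trans (lapl_bound z (DH_testfn phi u) (M := M * hnorm u) _))//; last first.
  by rewrite le_eqVlt; apply/orP; left; apply/eqP; ring.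
by move=> x; rewrite (le_trans (cabs_ip_le ip_norm _ _))// ler_wpM2r ?hnorm_ge0.
Qed.

Definition wlapl phi z : H := projT1 (cid (weak_lapl phi z)).

Lemma wlaplE phi z u : ip (wlapl phi z) u = lapl (fun x => ip (phi x) u) z.
Proof. by rewrite /wlapl; case: cid. Qed.

Lemma wlapl_PWH phi : wlapl phi \in PWH ip (2 * pi * r).
Proof.
rewrite inE; split=> [u|u N].
  rewrite (_ : (fun z => _) = lapl (fun x => ip (phi x) u)).
    exact: lapl_holomorphic r_ge0 (DH_testfn phi u).
  by apply/funext => z; rewrite wlaplE.
have [M hM] := testfn_cD_bounded N.*2 (DH_testfn phi u).
apply/rho_bounded; exists (@decayK R n r N * M) => z; rewrite wlaplE.
exact: lapl_decay (DH_testfn phi u) hM.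
Qed.

Definition weak_fourier phi : PW := PWHSpace (wlapl_PWH phi).

Lemma weak_fourierE phi z u :
  ip (weak_fourier phi z) u = lapl (fun x => ip (phi x) u) z.
Proof. exact: wlaplE. Qed.

Lemma weak_fourier_linear : linear weak_fourier.
Proof.
move=> a phi psi; apply: val_inj; apply/funext => z; apply: (ip_inj ip_norm) => u.
rewrite -[LHS]/(ip (weak_fourier _ z) u) weak_fourierE.
rewrite -[RHS]/(ip (a *: weak_fourier phi z + weak_fourier psi z) u).
rewrite ipDl ipZl !weak_fourierE -(lapl_linear _ _ (DH_testfn phi u) (DH_testfn psi u)).
by apply: eq_cintegral => x; congr (_ * _); rewrite -ipZl -ipDl.
Qed.

HB.instance Definition _ :=
  GRing.isLinear.Build R[i] D PW _ weak_fourier weak_fourier_linear.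

Lemma rho_weak_fourier N u phi c : (nu ip N.*2 u phi <= c%:E)%E ->
  (rho ip (2 * pi * r) N u (weak_fourier phi) <= (@decayK R n r N * c)%:E)%E.
Proof.
move=> /nu_bound hc; apply: rho_le => z; rewrite weak_fourierE.
exact: lapl_decay (DH_testfn phi u) hc.
Qed.

Lemma PWH_rapid F u : rapid (fun x => ip (F (ofR x)) u).
Proof.
rewrite (_ : (fun x => _) = fun x => ip (F (cmk x 0)) u).
  exact: rapid_pwfun 0 (PWH_pwfun F u).
by apply/funext => x; rewrite cmk0.
Qed.

(** Uniform boundedness is applied to the weighted family, indexed by x, so that one constant gives
    norm decay and not only decay for each u. *)
Lemma PWH_bounded F N : exists2 M, 0 <= M & forall x : 'rV[R]_n,
  (1 + dotr x x) ^+ N * hnorm (F (ofR x)) <= M.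
Proof.
have w0 (x : 'rV[R]_n) : 0 <= (1 + dotr x x) ^+ N by rewrite exprn_ge0// addr_ge0// dotr_ge0.
have [u|M hM] := uniform_boundedness ip_norm
    (v := fun x : 'rV[R]_n => ((1 + dotr x x) ^+ N)%:C *: F (ofR x)).
  have [_ /(_ N) [M hM]] := PWH_rapid F u; exists M => x.
  by rewrite ipZl cabsM cabs_real ger0_norm.
exists M; first exact: le_trans (hnorm_ge0 _) (hM 0).
by move=> x; have := hM x; rewrite hnormZ cabs_real ger0_norm.
Qed.

Lemma weak_invF F y : exists v, forall u, ip v u = invF (fun x => ip (F (ofR x)) u) y.
Proof.
have [M M0 hM] := PWH_bounded F n.
apply: (riesz_representation ip_norm
  (L := fun u => invF (fun x => ip (F (ofR x)) u) y) (C := 2 * M * wtot n)) => [a u v|u].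
  by rewrite -(invF_linear _ _ (PWH_rapid F u) (PWH_rapid F v));
    apply: eq_cintegral => x; rewrite ip_linr.
have hC x : (1 + dotr x x) ^+ (0 + n) * cabs (ip (F (ofR x)) u) <= M * hnorm u.
  rewrite add0n (le_trans _ (ler_wpM2r (hnorm_ge0 u) (hM x)))// -[leRHS]mulrA ler_wpM2l//.
    by rewrite exprn_ge0// addr_ge0// dotr_ge0.
  exact: cabs_ip_le.
have := cdpartial_invF_bound (s := [::]) (PWH_rapid F u) (leqnn 0) hC y.
rewrite expr0 mul1r (_ : cdpartial _ _ _ = invF (fun x => ip (F (ofR x)) u) y).
  by move=> /le_trans; apply; rewrite le_eqVlt; apply/orP; left; apply/eqP; ring.
exact: complexP.
Qed.

Definition winvF F y : H := projT1 (cid (weak_invF F y)).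

Lemma winvFE F y u : ip (winvF F y) u = invF (fun x => ip (F (ofR x)) u) y.
Proof. by rewrite /winvF; case: cid. Qed.

Lemma winvF_DH F : winvF F \in DH ip r.
Proof.
rewrite inE => u; rewrite (_ : (fun x => _) = invF (fun x => ip (F (ofR x)) u)).
  exact: (invF_testfn r_ge0 (PWH_pwfun F u)).
by apply/funext => y; rewrite winvFE.
Qed.

Definition weak_conj_fourier F : D := DHSpace (winvF_DH F).

Lemma weak_conj_fourierE F y u :
  ip (weak_conj_fourier F y) u = invF (fun x => ip (F (ofR x)) u) y.
Proof. exact: winvFE. Qed.

(** Continuity of the inverse needs the seminorm of a difference of images. *)
Lemma weak_conj_fourierB F G :
  weak_conj_fourier F - weak_conj_fourier G = weak_conj_fourier (F - G).
Proof.
apply: val_inj; apply/funext => y; apply: (ip_inj ip_norm) => u.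
rewrite -[RHS]/(ip (weak_conj_fourier _ y) u) weak_conj_fourierE.
rewrite -[LHS]/(ip (weak_conj_fourier F y - weak_conj_fourier G y) u).
rewrite ipBl !weak_conj_fourierE.
have := invF_linear (-1) y (PWH_rapid G u) (PWH_rapid F u).
rewrite mulN1r addrC => <-; apply: eq_cintegral => x.
by rewrite mulN1r addrC -ipBl.
Qed.

Lemma nu_weak_conj_fourier N u F c : 0 <= c ->
  (rho ip (2 * pi * r) (N + n) u F <= c%:E)%E ->
  (nu ip N u (weak_conj_fourier F) <= (2 * (2 * pi) ^+ N * wtot n * c)%:E)%E.
Proof.
move=> c0 /rho_bound hc; apply: nu_le.
  by rewrite mulr_ge0// mulr_ge0 ?wtot_ge0// mulr_ge0// exprn_ge0// mulr_ge0// pi_ge0.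
move=> a aN x; rewrite /cD.
rewrite (_ : (fun x => _) = invF (fun x => ip (F (ofR x)) u)); last first.
  by apply/funext => y; rewrite weak_conj_fourierE.
rewrite (le_trans (@cdpartial_invF_bound _ _ _ N _ c (PWH_rapid F u) _ _ x))//.
- by rewrite size_seq_of_multiindex.
- move=> y; apply: le_trans (hc (ofR y)).
  rewrite -cmk0 ImC_cmk cenorm_cmk.
  have d0 : dotr (0 : 'rV[R]_n) 0 = 0 by rewrite -(scale0r 0) dotrZr mul0r.
  by rewrite /enorm d0 addr0 sqrtr0 mulr0 oppr0 expR0 mulr1.
- by rewrite le_eqVlt; apply/orP; left; apply/eqP; ring.
Qed.

Lemma weak_fourierK : cancel weak_fourier weak_conj_fourier.
Proof.
move=> phi; apply: val_inj; apply/funext => y; apply: (ip_inj ip_norm) => u.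
rewrite -[LHS]/(ip (weak_conj_fourier _ y) u) weak_conj_fourierE.
rewrite (_ : (fun x => _) = fun x => lapl (fun x => ip (phi x) u) (ofR x)); last first.
  by apply/funext => x; rewrite weak_fourierE.
apply: (invF_lapl y (DH_testfn phi u)) => //.
by move=> N; have [M hM] := testfn_cD_bounded N.*2 (DH_testfn phi u);
  exists (@decayK R n r N * M) => z; exact: lapl_decay (DH_testfn phi u) hM.
Qed.

Lemma weak_conj_fourierK : cancel weak_conj_fourier weak_fourier.
Proof.
move=> F; apply: val_inj; apply/funext => z; apply: (ip_inj ip_norm) => u.
rewrite -[LHS]/(ip (weak_fourier _ z) u) weak_fourierE.
rewrite (_ : (fun x => _) = invF (fun x => ip (F (ofR x)) u)).
  exact: (lapl_invF z r_ge0 (PWH_pwfun F u)).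
by apply/funext => y; rewrite weak_conj_fourierE.
Qed.

Lemma weak_fourier_is_fourier phi y : is_fourier ip phi y (weak_fourier phi (ofR y)).
Proof.
move=> u; rewrite (_ : (fun x => _) = fun x => chr (ofR y) x * ip (phi x) u).
  split; last exact: weak_fourierE.
  exact/cdominated_integrable/cdominated_lapl/DH_testfn.
by apply/funext => x; rewrite ipZl chr_ofR.
Qed.

Lemma weak_conj_fourier_is_conj_fourier F y :
  is_conj_fourier ip (fun x => F (ofR x)) y (weak_conj_fourier F y).
Proof.
move=> u; rewrite (_ : (fun x => _) = fun x => cis (2 * pi * dotr x y) * ip (F (ofR x)) u).
  split; last exact: weak_conj_fourierE.
  exact/cdominated_integrable/rapid_cdominated/rapid_cis/PWH_rapid.
by apply/funext => x; rewrite ipZl.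
Qed.

Lemma weak_fourier_continuous : continuous weak_fourier.
Proof.
apply: (subbase_continuous (D := [set i : nat * H * PW * R | 0 < i.2])
  (b := @rho_ball R H ip n (2 * pi * r))); first by [].
move=> [[[N u] F] e] /= e0; rewrite openE => phi.
move=> /(ereal_lt_fin (rho_ge0 _ _ _ _ _))[c [c0 ce hc]].
have K0 := @decayK_ge0 R n r N; set K := decayK r N in K0.
have K1 : 0 < K + 1 by rewrite ltr_wpDl.
(* The generating semiballs have arbitrary centres, so the transform of phi is only known to be at
   seminorm distance at most c < e from [F]. The room left is e - c, and K + 1 keeps the quotient
   meaningful when K = 0. *)
have d0 : 0 < (e - c) / (K + 1) by rewrite divr_gt0// subr_gt0.
rewrite /interior nbhsE; exists (@nu_ball R H ip n r (N.*2, u, phi, (e - c) / (K + 1))).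
  split; last first.
    by rewrite /nu_ball /= subrr (le_lt_trans (nu0 _ _ _ _))// lte_fin.
  exact: (subbase_open (D := [set i : nat * H * D * R | 0 < i.2])
    (b := @nu_ball R H ip n r)).
move=> psi /(ereal_lt_fin (nu_ge0 _ _ _ _))[c' [c'0 c'e hc']].
have h := rhoD (@rho_weak_fourier N u (psi - phi) c' hc') hc.
rewrite /rho_ball /preimage /= in h *.
(* Splitting through the transform of phi: the first term is estimated by linearity, the second is
   at most c. *)
have E : (wlapl psi - F : _ -> H) = wlapl (psi - phi) + (wlapl phi - F).
  have := linearB weak_fourier psi phi.
  move=> /(congr1 (@PWHval R H ip n _)) /= ->.
  by apply/funext => z; rewrite /= addrA subrK.
rewrite E; apply: le_lt_trans h _; rewrite lte_fin -ltrBrDr.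
by apply: le_lt_trans (_ : _ <= (K + 1) * c') _;
  [rewrite ler_wpM2r// lerDl|rewrite mulrC -ltr_pdivlMr].
Qed.

Lemma weak_conj_fourier_continuous : continuous weak_conj_fourier.
Proof.
apply: (subbase_continuous (D := [set i : nat * H * D * R | 0 < i.2])
  (b := @nu_ball R H ip n r)); first by [].
move=> [[[N u] phi] e] /= e0; rewrite openE => F.
move=> /(ereal_lt_fin (nu_ge0 _ _ _ _))[c [c0 ce hc]].
pose K : R := 2 * (2 * pi) ^+ N * wtot n.
have K0 : 0 <= K.
  by rewrite mulr_ge0 ?wtot_ge0// mulr_ge0// exprn_ge0// mulr_ge0// pi_ge0.
have K1 : 0 < K + 1 by rewrite ltr_wpDl.
have d0 : 0 < (e - c) / (K + 1) by rewrite divr_gt0// subr_gt0.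
rewrite /interior nbhsE.
exists (@rho_ball R H ip n (2 * pi * r) ((N + n)%N, u, F, (e - c) / (K + 1))).
  split; last first.
    by rewrite /rho_ball /= subrr (le_lt_trans (rho0 _ _ _ _ _))// lte_fin.
  exact: (subbase_open (D := [set i : nat * H * PW * R | 0 < i.2])
    (b := @rho_ball R H ip n (2 * pi * r))).
move=> G /(ereal_lt_fin (rho_ge0 _ _ _ _ _))[c' [c'0 c'e hc']].
have h := nuD (f := weak_conj_fourier (G - F)) (g := weak_conj_fourier F - phi)
  (mulr_ge0 K0 c'0) c0 (nu_weak_conj_fourier c'0 hc') hc.
rewrite /nu_ball /preimage /= in h *.
have E : (winvF G - phi : _ -> H) = winvF (G - F) + (winvF F - phi).
  have := weak_conj_fourierB G F.
  move=> /(congr1 (@DHval R H ip n _)) /= <-.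
  by apply/funext => z; rewrite /= addrA subrK.
rewrite E; apply: le_lt_trans h _; rewrite lte_fin -ltrBrDr.
by apply: le_lt_trans (_ : _ <= (K + 1) * c') _;
  [rewrite ler_wpM2r// lerDl|rewrite mulrC -ltr_pdivlMr].
Qed.

End weak_transforms.

Theorem theorem2p3 (R : realType) (H : completeNormedModType R[i])
    (ip : {dot H for Num.conj})
    (ip_norm : forall u : H, `|u| ^+ 2 = ip u u)
    (H_separable : exists2 D : set H, countable D & dense D)
    (n : nat) (n_gt0 : (0 < n)%N) (r : R) (r_gt0 : 0 < r) :
  exists (Fc : {linear DHspace ip n r -> PWHspace ip n (2 * pi * r)})
         (Fc_inv : PWHspace ip n (2 * pi * r) -> DHspace ip n r),
    [/\ forall (phi : DHspace ip n r) (y : 'rV[R]_n),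
          is_fourier ip phi y (Fc phi (ofR y)),
        cancel Fc Fc_inv /\ cancel Fc_inv Fc,
        continuous Fc /\ continuous Fc_inv &
        forall (F : PWHspace ip n (2 * pi * r)) (y : 'rV[R]_n),
          is_conj_fourier ip (fun x => F (ofR x)) y (Fc_inv F y)].
Proof.
exists (weak_fourier ip_norm r_gt0), (weak_conj_fourier ip_norm r_gt0); split.
- exact: weak_fourier_is_fourier.
- by split; [exact: weak_fourierK|exact: weak_conj_fourierK].
- split; [exact: weak_fourier_continuous|exact: weak_conj_fourier_continuous].
- exact: weak_conj_fourier_is_conj_fourier.
Qed.
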